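(* Consider the queueing network with interference graph $G$ operated under Congestion Control Algorithm 1 with parameter $\beta>0$ (described in the context). There is a vector $\bar{\boldsymbol\lambda}\in[0,1]^n$ such that, with probability $1$, $$\lim_{t\to\infty}\frac{Q_i(t)}t=0\quad\text{for all }i,\qquad\text{and}\qquad \lim_{j\to\infty}\boldsymbol\lambda(j)=\bar{\boldsymbol\lambda},$$ and $\bar{\boldsymbol\lambda}$ satisfies $$\sum_iU_i(\bar\lambda_i)\ \ge\ \sum_iU_i(\lambda_i^* )-\frac{\log|\mathcal I(G)|}{\beta},$$ where $\boldsymbol\lambda^*$ is the solution of the utility maximization problem: maximize $\sum_{i=1}^nU_i(\lambda_i)$ over $\boldsymbol\lambda\in\boldsymbol\Lambda$.
   Context: **Network.** $G=(V,E)$ is a finite graph with $V=\{1,\dots,n\}$; $\mathcal N(i)=\{j:(i,j)\in E\}$; $\mathcal I(G)=\{\boldsymbol\rho\in\{0,1\}^n:\rho_i+\rho_j\le 1\ \forall (i,j)\in E\}$. $\boldsymbol\sigma(t)\in\mathcal I(G)$ is the schedule ($\sigma_i(t)=1$ iff node $i$ is transmitting at time $t\in\mathbb R_+$). Queues $\mathbf Q(t)\in\mathbb R_+^n$ start with $\mathbf Q(0)=\mathbf 0$ and satisfy, for $0\le s<t$, $Q_i(t)=Q_i(s)-\int_s^t\sigma_i(u)\mathbf 1_{\{Q_i(u)>0\}}du+A_i(s,t)$, where $A_i(s,t)$ is the work arriving to queue $i$ during $(s,t]$. **Capacity.** $\mathcal C$ is the convex hull of $\mathcal I(G)$; $\boldsymbol\Lambda=\{\boldsymbol\lambda\in\mathbb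 R_+^n:\boldsymbol\lambda\le\gamma\text{ componentwise for some }\gamma\in\mathcal C\}$. **Utilities.** Each $U_i:[0,1]\to\mathbb R$ is strictly concave and increasing. **CSMA dynamics.** Node $i$ has a parameter $r_i(t)$. A waiting node $i$ ($\sigma_i=0$) has a clock ringing at rate $\exp(r_i(t))$; when it rings, $\sigma_i$ becomes $1$ if $\sigma_k=0$ for all $k\in\mathcal N(i)$, and otherwise a new waiting period starts. A transmission lasts an exponential time of mean $1$, after which $\sigma_i$ becomes $0$. All clocks are independent. **Congestion Control Algorithm 1.** Update times $0=L(0)<L(1)<\cdots$ with $T(j)=L(j+1)-L(j)=\exp(\sqrt j)$ and step sizes $\alpha(j)=1/j$ for $j\ge1$ ($T(0)=L(1)$ and $\alpha(0)$ fixed positive constants). On $[L(j),L(j+1))$ the parameters are constant, $r_i(t)=r_i(j)$, and data is generated at node $i$ deterministically at rate $\lambda_i(j)$, i.e. $A_i(s,t)=\int_s^t\lambda_i(u)du$ with $\lambda_i(u)=\lambda_i(j)$ for $u\in[L(j),L(j+1))$. Initially $\mathbf r(0)=\mathbf 0$, $\boldsymbol\lambda(0)=\mathbf 1$, and for all $i$ $$r_i(j+1)=\big[r_i(j)+\alpha(j)(\lambda_i(j)-\widehat s_i(j))\big]_+,\qquad \lambda_i(j+1)=\arg\max_{y\in[0,1]}\big(\beta U_i(y)-r_i(j+1)y\big),$$ where $\widehat s_i(j)=\frac1{T(j)}\int_{L(j)}^{L(j+1)}\sigma_i(t)dt$ and $[x]_+=\max(x,0)$. *)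

(* Defs.v *)
(* MathComp-Analysis; the reals are an arbitrary [R : realType]. *)
From HB Require Import structures.
From mathcomp Require Import all_boot all_order all_algebra.
From mathcomp Require Import all_classical all_reals all_analysis.
From mathcomp Require Import measurable_realfun.
Set Implicit Arguments.
Unset Strict Implicit.
Unset Printing Implicit Defensive.
Import Order.TTheory GRing.Theory Num.Theory.
Import numFieldNormedType.Exports.
Local Open Scope classical_set_scope.
Local Open Scope ring_scope.

(* Nodes are 'I_n; a schedule rho is an element of {0,1}^n, rho i = true
   meaning that node i transmits. *)
Definition schedule (n : nat) := {ffun 'I_n -> bool}.

Definition indep_sets (n : nat) (e : rel 'I_n) : {set schedule n} :=
  [set rho : schedule n |
    [forall i, forall j, e i j ==> (rho i + rho j <= 1)%N]]%SET.

Section Capacity.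
Variables (R : realType) (n : nat) (e : rel 'I_n).

Definition capacity (gam : 'I_n -> R) : Prop :=
  exists w : schedule n -> R,
    [/\ forall rho, 0 <= w rho,
        \sum_(rho in indep_sets e) w rho = 1
      & forall i, gam i = \sum_(rho in indep_sets e) w rho * (rho i)%:R].

Definition rate_region (lam : 'I_n -> R) : Prop :=
  (forall i, 0 <= lam i) /\
  exists2 gam, capacity gam & forall i, lam i <= gam i.

Definition solves_utility_max (U : 'I_n -> R -> R) (lam : 'I_n -> R) : Prop :=
  rate_region lam /\
  forall lam', rate_region lam' -> \sum_i U i (lam' i) <= \sum_i U i (lam i).

End Capacity.

Section RealFunctions.
Variable R : realType.

Definition strictly_concave01 (f : R -> R) : Prop :=
  forall x y a : R, 0 <= x <= 1 -> 0 <= y <= 1 -> x != y -> 0 < a < 1 ->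
    a * f x + (1 - a) * f y < f (a * x + (1 - a) * y).

Definition increasing01 (f : R -> R) : Prop :=
  forall x y : R, 0 <= x -> x < y -> y <= 1 -> f x < f y.

Definition is_argmax01 (f : R -> R) (x : R) : Prop :=
  0 <= x <= 1 /\ forall y, 0 <= y <= 1 -> f y <= f x.

End RealFunctions.

Section Updates.
Variable R : realType.

Definition step_size (a0 : R) (j : nat) : R :=
  if j is 0%N then a0 else j%:R^-1.

Definition frame_length (T0 : R) (j : nat) : R :=
  if j is 0%N then T0 else expR (Num.sqrt j%:R).

Definition update_time (T0 : R) (j : nat) : R :=
  \sum_(k < j) frame_length T0 k.

(* The j such that L(j) <= t < L(j+1); it exists and is unique for t >= 0. *)
Definition frame_of (T0 t : R) : nat :=
  xget 0%N [set j : nat | update_time T0 j <= t < update_time T0 j.+1].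

End Updates.

Section Independence.
Variables (R : realType) (d : measure_display) (T : measurableType d).
Variable P : probability T R.

(* Mutual independence of a family of classes of events. *)
Definition mutually_independent (I : choiceType) (F : I -> set (set T)) : Prop :=
  forall (J : seq I) (A : I -> set T), uniq J ->
    (forall x, x \in J -> F x (A x)) ->
    P (\big[setI/setT]_(x <- J) A x) = (\prod_(x <- J) P (A x))%E.

Definition exponential_rv (rate : R) (X : {RV P >-> R}) : Prop :=
  forall A : set R, measurable A ->
    distribution P X A = exponential_prob rate A.

(* sigma(X), for a real-valued X *)
Definition generated_events (X : T -> R) : set (set T) :=
  [set X @^-1` B | B in [set B : set R | measurable B]].

(* The sources of randomness: the initial schedule X0, the waiting clocks W
   and the transmission durations S. *)
Definition primitive_events (n : nat) (X0 : T -> schedule n)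
    (W S : 'I_n -> nat -> T -> R)
    (x : unit + ('I_n * nat + 'I_n * nat)) : set (set T) :=
  match x with
  | inl _ => [set X0 @^-1` B | B in [set: set (schedule n)]]
  | inr (inl (i, k)) => generated_events (W i k)
  | inr (inr (i, k)) => generated_events (S i k)
  end.

End Independence.

Section Dynamics.
Variables (R : realType) (n : nat) (e : rel 'I_n).
Local Notation mu := (@lebesgue_measure R).

(* One sample path of the CSMA dynamics, with right-continuous schedule sigma
   and activation rates exp(r i t).  The activity of node i is a sequence of
   periods, the k-th one being [tau i k, tau i k.+1[; each is either a
   transmission, of duration S i k, or a waiting period, ended by a ring of the
   clock.  As a rate exp(r i t) varies with t, the ring takes place when the
   cumulated rate since the beginning of the period reaches W i k; for W i k
   exponential of mean 1 this is the clock of (stochastic) rate exp(r i t).  The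
   neighbours are looked at through the right-continuous schedule; the left
   limit differs only for simultaneous events, which have probability 0. *)
Definition csma_path (r : 'I_n -> R -> R) (W S : 'I_n -> nat -> R)
    (tau : 'I_n -> nat -> R) (sigma : R -> schedule n) : Prop :=
  sigma 0 \in indep_sets e /\
  forall i,
  [/\ tau i 0%N = 0,
      nondecreasing_seq (tau i),
      tau i k @[k --> \oo] --> +oo,
      forall k t, tau i k <= t < tau i k.+1 -> sigma t i = sigma (tau i k) i
    & forall k,
      if sigma (tau i k) i then
        tau i k.+1 = tau i k + S i k /\ sigma (tau i k.+1) i = false
      else
        \int[mu]_(u in `[tau i k, tau i k.+1]) expR (r i u) = W i k /\
        sigma (tau i k.+1) i = [forall j, e i j ==> ~~ sigma (tau i k.+1) j]].

Definition empirical_service (T0 : R) (sigma : R -> schedule n)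
    (i : 'I_n) (j : nat) : R :=
  (frame_length T0 j)^-1 *
  \int[mu]_(u in `[update_time T0 j, update_time T0 j.+1]) (sigma u i)%:R.

Definition congestion_control_path (U : 'I_n -> R -> R) (beta a0 T0 : R)
    (sigma : R -> schedule n) (r lam : nat -> 'I_n -> R) : Prop :=
  forall i,
  [/\ r 0%N i = 0, lam 0%N i = 1,
      forall j, r j.+1 i =
        Num.max (r j i + step_size a0 j *
                   (lam j i - empirical_service T0 sigma i j)) 0
    & forall j,
        is_argmax01 (fun y => beta * U i y - r j.+1 i * y) (lam j.+1 i)].

(* A queue Q fed by fluid at rate lam(t) and offered service at rate s(t),
     Q(t) = Q(s) - \int_s^t s(u) b(u) du + \int_s^t lam(u) du,
   where b is the fraction of the offered service that is used: b = 1 as long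
   as Q > 0.  On {Q = 0}, taking b = 0 gives the indicator of {Q > 0}, see
   [queue_path_indicator]; but with fluid arrivals and 0 < lam < 1 that equation
   has no solution once an empty queue is served (Q can neither leave 0 nor stay
   there), so b is left free on {Q = 0}.  Then Q is the usual reflected
   queue. *)
Definition queue_path (s lam Q : R -> R) : Prop :=
  [/\ Q 0 = 0,
      forall t : R, 0 <= t -> 0 <= Q t
    & exists b : R -> R,
      [/\ measurable_fun (`[0, +oo[ : set R) b,
          forall u : R, 0 <= u -> 0 <= b u <= 1,
          forall u : R, 0 <= u -> 0 < Q u -> b u = 1
        & forall x t : R, 0 <= x -> x < t ->
            Q t = Q x - \int[mu]_(u in `]x, t]) (s u * b u)
                      + \int[mu]_(u in `]x, t]) lam u]].

Lemma queue_path_indicator (s lam Q : R -> R) :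
  measurable_fun (`[0, +oo[ : set R) Q ->
  Q 0 = 0 -> (forall t : R, 0 <= t -> 0 <= Q t) ->
  (forall x t : R, 0 <= x -> x < t ->
     Q t = Q x - \int[mu]_(u in `]x, t]) (s u * (0 < Q u)%R%:R)
               + \int[mu]_(u in `]x, t]) lam u) ->
  queue_path s lam Q.
Proof.
move=> mQ Q0 Qge0 QE; split=> //; exists (fun u => (0 < Q u)%R%:R); split=> //.
- apply: (@measurableT_comp _ _ _ _ _ _ (fun c : bool => c%:R : R)) => //.
  exact: measurable_fun_ltr.
- by move=> u _; case: (0 < Q u); rewrite /= ?lexx ?ler01.
- by move=> u _ ->.
Qed.

End Dynamics.

(* The network under the algorithm, on the probability space (T, P).  W i k and
   S i k are only used by the k-th period of node i. *)
Record congestion_controlled_network (R : realType) (n : nat) (e : rel 'I_n)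
    (U : 'I_n -> R -> R) (beta a0 T0 : R)
    (d : measure_display) (T : measurableType d) (P : probability T R)
    (W S : 'I_n -> nat -> {RV P >-> R})
    (tau : T -> 'I_n -> nat -> R) (sigma : T -> R -> schedule n)
    (r lam : T -> nat -> 'I_n -> R) (Q : T -> 'I_n -> R -> R) : Prop := {
  waiting_exponential : forall i k, exponential_rv 1 (W i k);
  transmission_exponential : forall i k, exponential_rv 1 (S i k);
  clocks_independent :
    mutually_independent P
      (primitive_events (fun w => sigma w 0) (fun i k => W i k : T -> R)
                        (fun i k => S i k : T -> R));
  schedule_measurable :
    forall (t : R) (i : 'I_n), 0 <= t -> measurable_fun setT (fun w => sigma w t i);
  csma_dynamics :
    {ae P, forall w,
      csma_path e (fun i t => r w (frame_of T0 t) i)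
                (fun i k => W i k w) (fun i k => S i k w) (tau w) (sigma w)};
  control_dynamics :
    {ae P, forall w,
      congestion_control_path U beta a0 T0 (sigma w) (r w) (lam w)};
  queue_dynamics :
    {ae P, forall w, forall i : 'I_n,
      queue_path (fun t => (sigma w t i)%:R)
                 (fun t => lam w (frame_of T0 t) i) (Q w i)} }.

(* Main.v *)
(* The update of [r] is a noisy gradient descent for the dual function
   [D(r) = sum_i max_y (beta U_i(y) - r_i y) + ln Z(r)], with [Z(r)] the
   partition function of the Gibbs measure [exp(r . rho) / Z(r)] on the
   independent sets, which is the stationary law of the CSMA chain; the gradient
   of [ln Z] is the vector of stationary service rates.  At the minimizer [rs] of
   [D] these rates are the maximizers of [beta U_i(y) - rs_i y], and as [ln Z] is
   within [ln |I(G)|] of [max_rho r . rho] they are optimal up to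
   [ln |I(G)| / beta].

   To estimate the empirical service, a sample path is encoded by the list of its
   events.  For a node [i] and a schedule [eta], the number [N] of events of [i]
   in the state [eta] during a frame, where the clock has rate [c] and the chain
   spends the time [O], makes [exp(theta N - (exp theta - 1) c O)] a
   supermartingale, proved by resampling one clock at a time.  By Markov and
   Borel-Cantelli, [N = c O] up to nearly [sqrt T(j)] eventually.  The numbers of
   visits and departures of each schedule differ by at most 1, so the occupation
   frequencies nearly solve the balance equations, and the Dirichlet form shows
   that they are close to the Gibbs measure.  Since [r(j)] is at most
   [a0 + 2 ln j], rates and Gibbs weights are polynomial in [j], and the errors
   are at most [1/j^2].  So [r(j)] converges to [rs] and the arrival rates and
   empirical service rates have the same limits; as moreover [T(j) = o(L(j))],
   the queues are sublinear. *)
Require Import Defs.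
From HB Require Import structures.
From mathcomp Require Import all_boot all_order all_algebra.
From mathcomp Require Import all_classical all_reals all_analysis.
From mathcomp Require Import measurable_realfun ring lra zify.
Import Order.TTheory GRing.Theory Num.Theory.
Import numFieldNormedType.Exports.
Set Implicit Arguments.
Unset Strict Implicit.
Unset Printing Implicit Defensive.
Local Open Scope classical_set_scope.
Local Open Scope ring_scope.

(** * Gibbs measures on the independent sets *)

(** The parameters of a frame depend on the whole past, and a sample path is given only through
    relations between [tau], [sigma], [r] and the clocks, with no measurability of [tau], [r] or
    [lam]. Simulation removes this obstacle: along a fixed finite history the simulated state is an
    explicit measurable function of the clocks of the finished periods. Probabilities are then
    integrals of such functions, computed by integrating out one clock at a time, and expectations
    are sums over the finitely many histories of a given length. The exponents fit together as
    follows. Counts are off by a polynomial in [j] times [T(j)^(1/2)], so the balance equations hold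
    up to a polynomial times [T(j)^(-1/2)]. The Dirichlet form controls squares, so the distance to
    the Gibbs measure is a polynomial times [T(j)^(-1/4) = exp (- sqrt j / 4)], which beats every
    power of [j]. An error [1/j^2], multiplied by the step [1/j] and by a distance to [rs] crudely
    bounded by a multiple of [j], is still summable. *)

Section Gibbs.
Variables (R : realType) (n : nat) (e : rel 'I_n).
Implicit Types (r q : 'I_n -> R) (rho : schedule n).

Definition energy r rho : R := \sum_i r i * (rho i)%:R.

Definition partition_fun r : R := \sum_(rho in indep_sets e) expR (energy r rho).

Definition gibbs r rho : R := expR (energy r rho) / partition_fun r.

Definition service r i : R := \sum_(rho in indep_sets e) gibbs r rho * (rho i)%:R.

Definition idle : schedule n := [ffun => false].

Definition single (i : 'I_n) : schedule n := [ffun k => k == i].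

Lemma idle_indep : idle \in indep_sets e.
Proof.
by rewrite inE; apply/forallP => i; apply/forallP => j; rewrite !ffunE implybT.
Qed.

Lemma single_indep (e_irr : irreflexive e) i : single i \in indep_sets e.
Proof.
rewrite inE; apply/forallP => k; apply/forallP => j; rewrite !ffunE.
apply/implyP => ekj; case: eqP => [ki|_]; case: eqP => [ji|_] //.
by rewrite ki ji e_irr in ekj.
Qed.

Lemma energy_idle r : energy r idle = 0.
Proof. by rewrite /energy big1 // => i _; rewrite ffunE mulr0. Qed.

Lemma energy_single r i : energy r (single i) = r i.
Proof.
rewrite /energy (bigD1 i) //= ffunE eqxx mulr1 big1 ?addr0 // => k ki.
by rewrite ffunE (negbTE ki) mulr0.
Qed.

Lemma partition_gt0 r : 0 < partition_fun r.
Proof.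
rewrite /partition_fun (bigD1 idle) ?idle_indep //=.
by rewrite ltr_wpDr ?expR_gt0 // sumr_ge0 // => rho _; rewrite expR_ge0.
Qed.

Lemma gibbs_gt0 r rho : 0 < gibbs r rho.
Proof. by rewrite divr_gt0 ?expR_gt0 ?partition_gt0. Qed.

Lemma gibbs_sum r : \sum_(rho in indep_sets e) gibbs r rho = 1.
Proof. by rewrite /gibbs -mulr_suml divff // gt_eqF // partition_gt0. Qed.

Lemma gibbs_le1 r rho : rho \in indep_sets e -> gibbs r rho <= 1.
Proof.
move=> rhoI; rewrite -(gibbs_sum r) (bigD1 rho) //= lerDl.
by rewrite sumr_ge0 // => k _; rewrite ltW ?gibbs_gt0.
Qed.

Lemma ln_gibbs r rho : ln (gibbs r rho) = energy r rho - ln (partition_fun r).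
Proof. by rewrite ln_div ?expRK // posrE ?expR_gt0 ?partition_gt0. Qed.

Lemma energy_le_ln_partition r rho :
  rho \in indep_sets e -> energy r rho <= ln (partition_fun r).
Proof.
move=> rhoI; rewrite -subr_le0 -ln_gibbs ln_le0 //.
exact: gibbs_le1.
Qed.

Lemma service_ge0 r i : 0 <= service r i.
Proof. by rewrite sumr_ge0 // => rho _; rewrite mulr_ge0 // ltW ?gibbs_gt0. Qed.

Lemma service_lt1 r i : service r i < 1.
Proof.
rewrite -(gibbs_sum r) /service.
rewrite [ltLHS](bigD1 idle) ?idle_indep //= [ltRHS](bigD1 idle) ?idle_indep //=.
rewrite ffunE mulr0 ltr_leD ?gibbs_gt0 //.
by apply: ler_sum => rho _; rewrite ler_piMr ?(ltW (gibbs_gt0 _ _)) //; case: (rho i).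
Qed.

Lemma service_gt0 (e_irr : irreflexive e) r i : 0 < service r i.
Proof.
rewrite /service (bigD1 (single i)) ?single_indep //= ffunE eqxx mulr1.
rewrite ltr_wpDr ?gibbs_gt0 // sumr_ge0 // => rho _.
by rewrite mulr_ge0 // ltW ?gibbs_gt0.
Qed.

(** The slope of the logarithm is at least 1 on []0, 1]]; for [b <= a] this is
    [ln (b / a) <= b / a - 1]. *)
Lemma ler_norm_ln (a b : R) : 0 < a <= 1 -> 0 < b <= 1 ->
  (a - b) ^+ 2 <= (a - b) * (ln a - ln b).
Proof.
wlog ab : a b / b <= a.
  move=> H aP bP; case: (leP b a) => [ab|/ltW ab]; first exact: H.
  have := H b a ab bP aP; rewrite -[b - a]opprB sqrrN.
  by rewrite -[ln b - ln a]opprB mulrNN.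
move=> /andP[a0 a1] /andP[b0 b1].
rewrite expr2 ler_wpM2l ?subr_ge0 // -ln_div ?posrE //.
have ba : b / a = 1 + (b / a - 1) by ring.
have : ln (b / a) <= b / a - 1.
  by rewrite {1}ba le_ln1Dx // ltrBrDl subrr divr_gt0.
rewrite !ln_div ?posrE // => h.
have : (a - b) <= (a - b) / a by rewrite ler_peMr ?subr_ge0 // invf_ge1.
have -> : (a - b) / a = 1 - b / a by rewrite mulrBl divff ?gt_eqF.
lra.
Qed.

(** The right-hand side is the symmetrized relative entropy of the two Gibbs measures: energies are
    log-weights up to an additive constant, which cancels because both measures have mass 1. This is
    a quantitative form of the convexity of [ln Z]. *)
Lemma service_gap r q :
  \sum_(rho in indep_sets e) (gibbs r rho - gibbs q rho) ^+ 2 <=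
  \sum_i (r i - q i) * (service r i - service q i).
Proof.
have -> : \sum_i (r i - q i) * (service r i - service q i) =
    \sum_(rho in indep_sets e) (gibbs r rho - gibbs q rho) *
       (energy r rho - energy q rho).
  under eq_bigr => i _ do rewrite /service -sumrB mulr_sumr.
  rewrite exchange_big /=; apply: eq_bigr => rho _.
  rewrite /energy -sumrB mulr_sumr; apply: eq_bigr => i _.
  ring.
pose c := ln (partition_fun r) - ln (partition_fun q).
have -> : \sum_(rho in indep_sets e) (gibbs r rho - gibbs q rho) *
       (energy r rho - energy q rho) =
    \sum_(rho in indep_sets e) (gibbs r rho - gibbs q rho) *
       (ln (gibbs r rho) - ln (gibbs q rho)).
  have h0 : \sum_(rho in indep_sets e) (gibbs r rho - gibbs q rho) * c = 0.
    by rewrite -mulr_suml sumrB !gibbs_sum subrr mul0r.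
  rewrite -[RHS]addr0 -[X in _ = _ + X]h0 -big_split /=.
  by apply: eq_bigr => rho _; rewrite !ln_gibbs /c; ring.
apply: ler_sum => rho rhoI.
by apply: ler_norm_ln; rewrite gibbs_gt0 gibbs_le1.
Qed.

Lemma service_gap_ge0 r q : 0 <= \sum_i (r i - q i) * (service r i - service q i).
Proof. by apply: le_trans (service_gap r q); rewrite sumr_ge0 // => rho _; rewrite sqr_ge0. Qed.

Lemma gibbs_ratio (e_irr : irreflexive e) r i :
  r i = ln (gibbs r (single i)) - ln (gibbs r idle).
Proof. by rewrite !ln_gibbs energy_idle energy_single; ring. Qed.

(* The parameters are recovered from the Gibbs weights by [gibbs_ratio]. *)
Lemma service_gap_small (e_irr : irreflexive e) q (eps : R) : 0 < eps ->
  exists2 del, 0 < del & forall r,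
    \sum_i (r i - q i) * (service r i - service q i) < del ->
    forall i, `|r i - q i| < eps.
Proof.
move=> eps0.
have lnc rho : exists2 del : R, 0 < del & forall y : R, `|y - gibbs q rho| < del ->
    `|ln y - ln (gibbs q rho)| < eps / 2.
  have : {for gibbs q rho, continuous (@ln R)} by apply: continuous_ln; exact: gibbs_gt0.
  move/cvgrPdist_lt/(_ _ (divr_gt0 eps0 (ltr0Sn _ 1))) => /nbhs_ballP[del /= del0 H].
  by exists del => // y yd; rewrite distrC; apply: H; rewrite /ball /= distrC.
pose dl rho := projT1 (cid2 (lnc rho)).
have dl0 rho : 0 < dl rho by rewrite /dl; case: cid2.
have dlP rho y : `|y - gibbs q rho| < dl rho -> `|ln y - ln (gibbs q rho)| < eps / 2.
  by rewrite /dl; case: cid2 => /= ? ? ; apply.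
(* The least radius over all schedules; it is squared below because [service_gap] controls squared
   differences of weights. *)
pose del : R := \big[Num.min/1]_(rho : schedule n) dl rho.
have del0 : 0 < del by apply: lt_bigmin => // rho _.
exists (del ^+ 2) => [|r rdel]; first exact: exprn_gt0.
have close rho : rho \in indep_sets e -> `|gibbs r rho - gibbs q rho| < dl rho.
  move=> rhoI; apply: (@lt_le_trans _ _ del); last exact: bigmin_le_cond.
  rewrite -(ltr_pXn2r (n := 2)) ?nnegrE ?(ltW del0) //.
  rewrite real_normK ?num_real //; apply: le_lt_trans rdel.
  apply: le_trans (service_gap r q); rewrite (bigD1 rho) //= lerDl.
  by rewrite sumr_ge0 // => k _; rewrite sqr_ge0.
move=> i.
have h1 := dlP _ _ (close _ (single_indep e_irr i)).
have h2 := dlP _ _ (close _ idle_indep).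
rewrite (gibbs_ratio e_irr r i) (gibbs_ratio e_irr q i).
move: h1 h2; rewrite !ltr_norml => /andP[h1 h1'] /andP[h2 h2'].
by apply/andP; split; lra.
Qed.

(** The ratio of the two partition functions is the Gibbs mean of [expR (h * rho i)], and [rho i] is
    0 or 1. This one-sided bound takes the place of the derivative of [ln Z]. *)
Lemma ln_partition_shift r i (h : R) :
  ln (partition_fun (fun k => r k + h * (k == i)%:R)) <=
  ln (partition_fun r) + service r i * (expR h - 1).
Proof.
set q := fun k => _.
have Eq rho : energy q rho = energy r rho + h * (rho i)%:R.
  rewrite /energy /q; under eq_bigr => k _ do rewrite mulrDl.
  rewrite big_split /=; congr (_ + _); rewrite (bigD1 i) //= eqxx mulr1.
  by rewrite big1 ?addr0 // => k ki; rewrite (negbTE ki) mulr0 mul0r.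
have Zq : partition_fun q = partition_fun r * (1 + service r i * (expR h - 1)).
  have Z0 : partition_fun r != 0 by rewrite gt_eqF ?partition_gt0.
  rewrite -[X in X + service _ _ * _](gibbs_sum r) /service mulr_suml -big_split /=.
  rewrite mulr_sumr.
  apply: eq_bigr => rho _; rewrite Eq expRD /gibbs.
  move: (partition_fun r) Z0 => Z Z0.
  by case: (rho i); rewrite ?mulr1 ?mulr0 ?expR0 /=; field.
have x0 : 0 < 1 + service r i * (expR h - 1).
  by have := partition_gt0 q; rewrite Zq pmulr_rgt0 // partition_gt0.
rewrite Zq lnM ?posrE ?partition_gt0 // lerD2l le_ln1Dx //.
by move: x0; set z := _ * _; lra.
Qed.

(** The left-hand side is the Shannon entropy of the Gibbs measure. It is compared with that of the
    uniform measure by applying [ln x <= x - 1] at [x = 1 / (N * gibbs r rho)]. *)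
Lemma gibbs_entropy r :
  ln (partition_fun r) - \sum_i r i * service r i <= ln #|indep_sets e|%:R.
Proof.
have [N N0 NE] : exists2 N : R, 0 < N &
    \sum_(rho in indep_sets e) 1 = N /\ N = #|indep_sets e|%:R.
  exists #|indep_sets e|%:R; last by rewrite sumr_const.
  by rewrite ltr0n card_gt0; apply/set0Pn; exists idle; exact: idle_indep.
case: NE => NE <-.
have -> : \sum_i r i * service r i =
    \sum_(rho in indep_sets e) gibbs r rho * energy r rho.
  under eq_bigr => i _ do rewrite /service mulr_sumr.
  rewrite exchange_big /=; apply: eq_bigr => rho _.
  by rewrite /energy mulr_sumr; apply: eq_bigr => i _; ring.
rewrite -[X in X - _]mul1r -[X in X * _](gibbs_sum r) mulr_suml -sumrB.
rewrite -subr_le0 -[X in _ - X]mul1r -[X in _ - X * _](gibbs_sum r) mulr_suml -sumrB.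
apply: (@le_trans _ _ (\sum_(rho in indep_sets e) (N^-1 - gibbs r rho))); last first.
  rewrite sumrB gibbs_sum -[X in \sum_(_ in _) X]mulr1.
  under eq_bigr => rho _ do rewrite mulr1 -[N^-1]mul1r.
  by rewrite -mulr_suml NE divff ?subrr // gt_eqF.
apply: ler_sum => rho rhoI.
have g0 := gibbs_gt0 r rho.
have x0 : 0 < (N * gibbs r rho)^-1 by rewrite invr_gt0 mulr_gt0.
have := @le_ln1Dx R ((N * gibbs r rho)^-1 - 1).
have -> : 1 + ((N * gibbs r rho)^-1 - 1) = (N * gibbs r rho)^-1 by ring.
rewrite ltrBrDl subrr => /(_ x0).
have Ng0 : N * gibbs r rho \is Num.pos by rewrite posrE mulr_gt0.
rewrite (lnV Ng0) lnM ?posrE // ln_gibbs => h.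
have := ler_wpM2l (ltW g0) h.
rewrite mulrBr mulr1 invfM mulrCA divff ?gt_eqF // mulr1.
set x := gibbs r rho; set y := N^-1; set a := ln N; set b := ln (partition_fun r).
by have -> : x * b - x * energy r rho - x * a = x * - (a + (energy r rho - b)) by ring.
Qed.

End Gibbs.

(** * The dual of the utility maximization problem *)

Section ConcaveConjugate.
Variables (R : realType) (f : R -> R).
Hypotheses (f_concave : strictly_concave01 f) (f_incr : increasing01 f).

(** A supremum, not a maximum: a concave [f] may jump up just after 0, and then large [r] have no
    maximizer. *)
Definition conjugate (r : R) : R := sup [set f y - r * y | y in `[0, 1]].

Let f_le (y : R) : 0 <= y <= 1 -> f 0 <= f y <= f 1.
Proof.
move=> /andP[y0 y1]; apply/andP; split.
  by move: y0; rewrite le_eqVlt => /predU1P[<-//|y0]; rewrite ltW // f_incr.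
by move: y1; rewrite le_eqVlt => /predU1P[->//|y1]; rewrite ltW // f_incr.
Qed.

Let conjugate_has_sup r : has_sup [set f y - r * y | y in `[0, 1]].
Proof.
split; first by exists (f 0 - r * 0); exists 0; rewrite //= in_itv /= lexx ler01.
exists (f 1 + `|r|) => z [y /=]; rewrite in_itv /= => y01 <-.
have /andP[_ fy] := f_le y01; rewrite lerD //.
move: y01 => /andP[y0 y1]; apply: le_trans (ler_norm _) _.
by rewrite normrN normrM ler_piMr // ger0_norm.
Qed.

Lemma conjugate_ge r y : 0 <= y <= 1 -> f y - r * y <= conjugate r.
Proof.
move=> y01; apply: ub_le_sup; first by case: (conjugate_has_sup r).
by exists y; rewrite //= in_itv.
Qed.

Lemma conjugate_le r M : (forall y, 0 <= y <= 1 -> f y - r * y <= M) ->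
  conjugate r <= M.
Proof.
move=> H; apply: ge_sup; first by case: (conjugate_has_sup r).
by move=> z [y /=]; rewrite in_itv /= => y01 <-; exact: H.
Qed.

Lemma conjugate_convex r q (a : R) : 0 <= a <= 1 ->
  conjugate (a * r + (1 - a) * q) <= a * conjugate r + (1 - a) * conjugate q.
Proof.
move=> /andP[a0 a1]; apply: conjugate_le => y y01.
have -> : f y - (a * r + (1 - a) * q) * y =
  a * (f y - r * y) + (1 - a) * (f y - q * y) by ring.
by rewrite lerD // ler_wpM2l ?conjugate_ge // subr_ge0.
Qed.

Lemma conjugate_lipschitz r q : `|conjugate r - conjugate q| <= `|r - q|.
Proof.
wlog: r q / conjugate q <= conjugate r.
  by move=> H; case: (leP (conjugate q) (conjugate r)) => [|/ltW] /H //; rewrite distrC (distrC q).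
move=> qr; rewrite ger0_norm ?subr_ge0 // lerBlDr; apply: conjugate_le => y y01.
have -> : f y - r * y = (q - r) * y + (f y - q * y) by ring.
rewrite lerD ?conjugate_ge //; move: y01 => /andP[y0 y1].
by apply: le_trans (ler_norm _) _; rewrite normrM distrC ler_piMr // ger0_norm.
Qed.

(** Chord slopes of a concave function decrease, so each slope to the right of [s] is at most each
    slope to the left; [g] is the supremum of the right slopes. *)
Lemma supergradient (s : R) : 0 < s < 1 ->
  exists g, forall y, 0 <= y <= 1 -> f y <= f s + g * (y - s).
Proof.
move=> /andP[s0 s1].
have chord x y : 0 <= x -> x < s -> s < y -> y <= 1 ->
    (f y - f s) / (y - s) <= (f s - f x) / (s - x).
  move=> x0 xs sy y1.
  rewrite ler_pdivrMr ?subr_gt0 // mulrAC ler_pdivlMr ?subr_gt0 //.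
  have yx : 0 < y - x by rewrite subr_gt0 (lt_trans xs).
  have := @f_concave x y ((y - s) / (y - x)).
  have -> : (y - s) / (y - x) * x + (1 - (y - s) / (y - x)) * y = s.
    by field; rewrite gt_eqF.
  move=> H; have {H} : (y - s) / (y - x) * f x + (1 - (y - s) / (y - x)) * f y < f s.
    apply: H; first by rewrite x0 ltW // (lt_trans xs).
    - by rewrite y1 andbT ltW // (lt_trans s0).
    - by rewrite lt_eqF // (lt_trans xs).
    - rewrite ltr_pdivrMr // mul1r ltrD2l ltrN2 xs andbT.
      by rewrite divr_gt0 // subr_gt0.
  have -> : (y - s) / (y - x) * f x + (1 - (y - s) / (y - x)) * f y =
    ((y - s) * f x + (s - x) * f y) / (y - x) by field; rewrite gt_eqF.
  rewrite ltr_pdivrMr // => H; rewrite -subr_ge0.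
  by rewrite -subr_gt0 in H; apply: le_trans (ltW H) _; rewrite le_eqVlt; apply/orP; left; apply/eqP; ring.
pose A := [set (f y - f s) / (y - s) | y in [set y : R | s < y <= 1]].
have hA : has_sup A.
  split; first by exists ((f 1 - f s) / (1 - s)); exists 1; rewrite /= ?s1 ?lexx.
  exists ((f s - f 0) / (s - 0)) => _ [y /= /andP[sy y1] <-]; exact: chord.
exists (sup A) => y /andP[y0 y1]; case: (ltgtP y s) => [ys|sy|->].
- have : sup A <= (f s - f y) / (s - y).
    apply: ge_sup; first by case: hA.
    by move=> _ [z /= /andP[sz z1] <-]; exact: chord.
  by rewrite ler_pdivlMr ?subr_gt0 //; lra.
- have : (f y - f s) / (y - s) <= sup A.
    by apply: ub_le_sup; [case: hA|exists y => //=; rewrite sy].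
  by rewrite ler_pdivrMr ?subr_gt0 //; lra.
- by rewrite subrr mulr0 addr0.
Qed.

(** From [expR (- h) >= 1 - h], since [(1 + h + 2 h^2) (1 - h) = 1 + h^2 (1 - 2 h)] is at least
    1. *)
Lemma expR_le_quad (h : R) : h <= 2^-1 -> expR h <= 1 + h + 2 * h ^+ 2.
Proof.
move=> h2.
have := expR_ge1Dx (- h); rewrite expRN => H.
have h0 : 0 < 1 - h by lra.
have : expR h <= (1 - h)^-1.
  by rewrite -[expR h]invrK lef_pV2 ?posrE ?invr_gt0 ?expR_gt0.
move/le_trans; apply; rewrite -div1r ler_pdivrMr //.
have -> : (1 + h + 2 * h ^+ 2) * (1 - h) = 1 + h ^+ 2 * (1 - 2 * h) by ring.
by rewrite lerDl mulr_ge0 ?sqr_ge0 //; lra.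
Qed.

(* The hypothesis makes [- s] a subgradient of the conjugate at [r]. *)
Lemma argmax_of_conjugate (s r : R) : 0 < s < 1 ->
  (forall h, conjugate (r + h) >= conjugate r - s * (expR h - 1)) ->
  is_argmax01 (fun y => f y - r * y) s.
Proof.
move=> s01 H; have [g gP] := supergradient s01.
have s01' : 0 <= s <= 1 by case/andP: s01 => *; rewrite !ltW.
split=> // y y01; apply: le_trans (conjugate_ge r y01) _.
have cg : conjugate g <= f s - g * s.
  by apply: conjugate_le => z z01; have := gP z z01; lra.
(* At the supergradient [g] the supremum is attained at [s]. On the segment from [r] to [g],
   convexity bounds the conjugate above and the hypothesis bounds it below, up to an error quadratic
   in the parameter [t] of the segment. *)
apply: le_trans (_ : conjugate g + s * (g - r) <= _); last by lra.
apply/ler_addgt0Pr => eps eps0.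
set d := g - r.
(* Small enough that [expR_le_quad] applies to [t * d] and that the quadratic error is at most
   [t * eps]. *)
pose t : R := Num.min (Num.min 1 (2 * (`|d| + 1))^-1) (eps / (2 * d ^+ 2 + 1)).
have d1 : 0 < 2 * (`|d| + 1) by rewrite mulr_gt0 // ltr_wpDl.
have d2 : 0 < 2 * d ^+ 2 + 1 by rewrite ltr_wpDl // mulr_ge0 // sqr_ge0.
have t0 : 0 < t by rewrite !lt_min ltr01 invr_gt0 d1 divr_gt0.
have t1 : t <= 1 by rewrite !ge_min lexx.
have td : t * d <= 2^-1.
  apply: le_trans (_ : t * (`|d| + 1) <= _).
    by rewrite ler_pM2l // (le_trans (ler_norm _)) // lerDl.
  have : t <= (2 * (`|d| + 1))^-1 by rewrite !ge_min lexx orbT.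
  by rewrite -div1r ler_pdivlMr // => ?; lra.
have te : t * (2 * d ^+ 2) <= eps.
  apply: le_trans (_ : t * (2 * d ^+ 2 + 1) <= _); first by rewrite ler_pM2l // lerDl.
  have : t <= eps / (2 * d ^+ 2 + 1) by rewrite !ge_min lexx !orbT.
  by rewrite ler_pdivlMr.
have := H (t * d); have := @conjugate_convex g r t.
have -> : t * g + (1 - t) * r = r + t * d by rewrite /d; ring.
rewrite t1 (ltW t0) => /(_ isT) h1 h2.
have h3 := expR_le_quad td.
have h4 : s * (expR (t * d) - 1) <= s * (t * d) + t * eps.
  case/andP: s01 => s0 s1.
  apply: le_trans (_ : s * (t * d + 2 * (t * d) ^+ 2) <= _); first by rewrite ler_pM2l //; lra.
  rewrite mulrDr lerD2l; apply: le_trans (_ : 1 * (2 * (t * d) ^+ 2) <= _).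
    apply: ler_wpM2r; last exact: ltW.
    exact: mulr_ge0 (ler0n _ 2) (sqr_ge0 _).
  have -> : 1 * (2 * (t * d) ^+ 2) = t * (t * (2 * d ^+ 2)) by ring.
  by rewrite ler_pM2l.
have : t * conjugate r <= t * (conjugate g + s * d + eps).
  by lra.
by rewrite ler_pM2l.
Qed.

(** For [r <= 0] the function [f y - r * y] is increasing, and 1 would beat [s]. *)
Lemma argmax_slope_gt0 (s r : R) : s < 1 ->
  is_argmax01 (fun y => f y - r * y) s -> 0 < r.
Proof.
move=> s1 [/andP[s0 _] H]; rewrite ltNge; apply/negP => r0.
have := H 1; rewrite ler01 lexx => /(_ isT).
have := f_incr s0 s1 (lexx _); have : r * (1 - s) <= 0.
  by apply: mulr_le0_ge0 => //; rewrite subr_ge0 ltW.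
lra.
Qed.

End ConcaveConjugate.

(** * Existence of a minimizer of the dual function *)

Section DualOptimum.
Variables (R : realType) (n : nat) (e : rel 'I_n).
Hypothesis e_irr : irreflexive e.

Lemma ln_partition_lipschitz (r q : 'I_n -> R) :
  `|ln (partition_fun e r) - ln (partition_fun e q)| <= \sum_i `|r i - q i|.
Proof.
wlog: r q / ln (partition_fun e q) <= ln (partition_fun e r).
  move=> H; case: (leP (ln (partition_fun e q)) (ln (partition_fun e r))) => [|/ltW] /H //.
  by rewrite distrC; under eq_bigr => i _ do rewrite distrC.
move=> qr; rewrite ger0_norm ?subr_ge0 // lerBlDr.
rewrite -[X in X + _]expRK -lnM ?posrE ?expR_gt0 ?partition_gt0 //.
rewrite ler_ln ?posrE ?mulr_gt0 ?expR_gt0 ?partition_gt0 //.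
rewrite /partition_fun mulr_sumr; apply: ler_sum => rho _.
rewrite -expRD ler_expR /energy -big_split /=; apply: ler_sum => i _.
have := ler_norm (r i - q i); case: (rho i); rewrite ?mulr1 ?mulr0; last first.
  by rewrite addr0.
lra.
Qed.

Variable f : 'I_n -> R -> R.
Hypotheses (f_concave : forall i, strictly_concave01 (f i))
           (f_incr : forall i, increasing01 (f i)).

Let D (r : 'I_n -> R) := \sum_i conjugate (f i) (r i) + ln (partition_fun e r).

Let D_lipschitz r q : `|D r - D q| <= 2 * \sum_i `|r i - q i|.
Proof.
rewrite /D opprD addrACA (le_trans (ler_normD _ _)) //.
rewrite mulr2n mulrDl mul1r lerD ?ln_partition_lipschitz //.
rewrite -sumrB (le_trans (ler_norm_sum _ _ _)) //.
by apply: ler_sum => i _; exact: conjugate_lipschitz.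
Qed.

Let D_continuous : continuous (fun v : 'rV[R]_n => D (v ord0)).
Proof.
move=> v; apply/(@cvgrPdist_lt _ _ _ _ (nbhs_filter v)) => eps eps0.
pose c : R := eps / (2 * n.+1%:R).
have c0 : 0 < c by rewrite divr_gt0 // mulr_gt0.
have : nbhs v [set w : 'rV[R]_n | forall i, `|v ord0 i - w ord0 i| < c].
  exists (fun i j => ball (v i j) c); first by move=> i j; exact: nbhsx_ballx.
  by move=> w H i; exact: (H ord0 i).
apply: (@filterS _ _ (nbhs_filter v)) => w H; apply: le_lt_trans (D_lipschitz _ _) _.
apply: le_lt_trans (_ : 2 * (\sum_(i < n) c) < _).
  by rewrite ler_pM2l //; apply: ler_sum => i _; exact: ltW.
rewrite sumr_const card_ord -(mulr_natr c n).
have <- : c * (2 * n.+1%:R) = eps by rewrite divfK // mulf_neq0 ?pnatr_eq0.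
by rewrite mulrCA ltr_pM2l // ltr_pM2l // ltr_nat.
Qed.

(** Coercivity: [ln Z] is at least 0 and at least each [r i], as the idle and the one-node schedules
    are independent sets, and each conjugate is at least [f 0] and [f 0 - r]. Hence [D r - K]
    dominates each [|r i|], and a minimum over a large cube is global. *)
Let D_min : exists c, forall r, D c <= D r.
Proof.
pose K := \sum_i f i 0.
have DK r i : `|r i| <= D r - K.
  have l0 : 0 <= ln (partition_fun e r).
    by rewrite -(energy_idle r) energy_le_ln_partition // idle_indep.
  have li : r i <= ln (partition_fun e r).
    by rewrite -(energy_single r i) energy_le_ln_partition // single_indep.
  have k0 k : f k 0 <= conjugate (f k) (r k).
    have := @conjugate_ge _ _ (@f_incr k) (r k) 0.
    by rewrite mulr0 subr0 lexx ler01; apply.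
  have k1 : f i 0 - r i <= conjugate (f i) (r i).
    have := @conjugate_ge _ _ (@f_incr i) (r i) 1.
    rewrite lexx ler01 mulr1 => /(_ isT); apply: le_trans.
    by rewrite lerD2r ltW // f_incr.
  rewrite /D /K (bigD1 i) //= [X in _ - X](bigD1 i) //=.
  have s0 : \sum_(k < n | k != i) f k 0 <= \sum_(k < n | k != i) conjugate (f k) (r k).
    by apply: ler_sum.
  have := k0 i; rewrite ler_norml; move=> ?; apply/andP; split; lra.
pose M : R := `|D (fun=> 0) - K|.
pose A := [set v : 'rV[R]_n | forall i, `[- M, M]%classic (v ord0 i)].
have cA : compact A.
  by apply: (@rV_compact _ _ (fun=> `[- M, M]%classic)) => i; exact: segment_compact.
have A0 : A 0.
  by move=> i; rewrite /= mxE in_itv /= oppr_le0 !normr_ge0.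
have [c cAin cmin] := EVT_min_rV (ex_intro _ _ A0) cA (continuous_subspaceT D_continuous).
exists (c ord0) => r.
have [rM|] := pselect (forall i, `|r i| <= M).
  have := cmin (\row_i r i).
  have -> : D ((\row_i r i) ord0) = D r by congr D; apply/funext => i; rewrite mxE.
  by apply; rewrite inE => i; rewrite /= mxE in_itv /= -ler_norml.
move/existsNP => [i /negP]; rewrite -ltNge => Mr.
have DM : D (fun=> 0) <= K + M by have := ler_norm (D (fun=> 0) - K); rewrite -/M; lra.
have : D (c ord0) <= D (fun=> 0).
  have := cmin 0; have -> : D ((0 : 'rV[R]_n) ord0) = D (fun=> 0).
    by congr D; apply/funext => k; rewrite mxE.
  by apply; rewrite inE.
have := DK r i; lra.
Qed.

(** At a minimizer, moving one coordinate by [h] cannot decrease [D], while [ln Z] grows by at most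
    [service * (expR h - 1)]: this is the hypothesis of [argmax_of_conjugate]. Positivity follows
    from [service < 1]. *)
Lemma dual_optimum : exists rs : 'I_n -> R,
  (forall i, 0 < rs i) /\
  forall i, is_argmax01 (fun y => f i y - rs i * y) (service e rs i).
Proof.
have [rs rs_min] := D_min; exists rs.
have am i : is_argmax01 (fun y => f i y - rs i * y) (service e rs i).
  apply: argmax_of_conjugate; rewrite ?service_gt0 ?service_lt1 // => h.
  have := rs_min (fun k => rs k + h * (k == i)%:R).
  rewrite /D (bigD1 i) //= [X in _ <= X + _](bigD1 i) //= eqxx mulr1.
  have -> : \sum_(k < n | k != i) conjugate (f k) (rs k + h * (k == i)%:R) =
    \sum_(k < n | k != i) conjugate (f k) (rs k).
    by apply: eq_bigr => k /negbTE ->; rewrite mulr0 addr0.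
  have := ln_partition_shift e rs i h; lra.
by split=> // i; apply: argmax_slope_gt0 (am i) => //; exact: service_lt1.
Qed.

End DualOptimum.

(** Testing maximality at [lam i], and replacing [lam] by the larger [gam] since [rs >= 0], bounds
    [beta] times the loss by [rs . gam - rs . service]. As [gam] is a mixture of independent sets,
    [rs . gam <= ln Z], and what remains is the entropy. *)
Lemma utility_gap (R : realType) (n : nat) (e : rel 'I_n) (U : 'I_n -> R -> R)
    (beta : R) (rs lam : 'I_n -> R) :
  0 < beta -> (forall i, 0 <= rs i) ->
  (forall i, is_argmax01 (fun y => beta * U i y - rs i * y) (service e rs i)) ->
  rate_region e lam ->
  \sum_i U i (lam i) - ln (#|indep_sets e|%:R) / beta <=
  \sum_i U i (service e rs i).
Proof.
move=> b0 rs0 am [lam0 [gam [w [w0 w1 gamE]] lamgam]].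
have gam1 i : gam i <= 1.
  rewrite gamE -[leRHS]w1; apply: ler_sum => rho _.
  by case: (rho i); rewrite ?mulr1 ?mulr0.
have h1 : beta * (\sum_i U i (lam i) - \sum_i U i (service e rs i)) <=
    \sum_i rs i * gam i - \sum_i rs i * service e rs i.
  rewrite -!sumrB mulr_sumr; apply: ler_sum => i _.
  have := (am i).2 (lam i); rewrite lam0 (le_trans (lamgam i) (gam1 i)) => /(_ isT).
  have := ler_wpM2l (rs0 i) (lamgam i); lra.
have h2 : \sum_i rs i * gam i <= ln (partition_fun e rs).
  under eq_bigr => i _ do rewrite gamE mulr_sumr.
  rewrite exchange_big /= -[leRHS]mul1r -[X in _ <= X * _]w1 mulr_suml.
  apply: ler_sum => rho rhoI.
  have -> : \sum_(i < n) rs i * (w rho * (rho i)%:R) = w rho * energy rs rho.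
    by rewrite /energy mulr_sumr; apply: eq_bigr => i _; ring.
  by rewrite ler_wpM2l // energy_le_ln_partition.
have := gibbs_entropy e rs; move: h1 h2.
set N := ln #|_|%:R => h1 h2 h3.
rewrite lerBlDl -lerBlDr ler_pdivlMr // mulrC.
lra.
Qed.


(** * Convergence of the dual iteration *)

Section Argmax.
Variables (R : realType) (f : R -> R).

(** The sum of the two optimality inequalities, each tested at the other maximizer. *)
Lemma argmax_antitone (r q y z : R) :
  is_argmax01 (fun x => f x - r * x) y -> is_argmax01 (fun x => f x - q * x) z ->
  (r - q) * (y - z) <= 0.
Proof. by move=> [y01 Hy] [z01 Hz]; have := Hy _ z01; have := Hz _ y01; lra. Qed.

Hypothesis f_concave : strictly_concave01 f.

Lemma argmax_unique (r y z : R) :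
  is_argmax01 (fun x => f x - r * x) y -> is_argmax01 (fun x => f x - r * x) z ->
  y = z.
Proof.
move=> [y01 Hy] [z01 Hz]; apply/eqP/negPn/negP => yz.
have h01 : 0 < (2^-1 : R) < 1 by apply/andP; split; lra.
have fm := f_concave y01 z01 yz h01.
have m01 : 0 <= 2^-1 * y + (1 - 2^-1) * z <= 1.
  by move: y01 z01 => /andP[? ?] /andP[? ?]; apply/andP; split; lra.
by have := Hy _ m01; have := Hy _ z01; have := Hz _ y01; lra.
Qed.

(** Concavity does the work of continuity. Write drop for the loss in [F] relative to [s]. If [y] is
    at distance at least [eps] from [s], the point of the segment at distance [eps] has drop at most
    [eps / |y - s|] times that of [y], which is at most [|r - r0| * |y - s|] by optimality of [y].
    The drops at [s + eps] and [s - eps] are fixed positive numbers. *)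
Lemma argmax_perturb (r0 s eps : R) : 0 < eps ->
  is_argmax01 (fun x => f x - r0 * x) s ->
  exists2 del, 0 < del & forall r y, `|r - r0| < del ->
    is_argmax01 (fun x => f x - r * x) y -> `|y - s| < eps.
Proof.
move=> eps0 smax; have [s01 Hs] := smax.
pose F x := f x - r0 * x.
(* The witness 1 is a placeholder when [p] is outside [[0, 1]] or equal to [s]. *)
have side (p : R) : exists2 del, 0 < del & 0 <= p <= 1 -> p != s -> F p <= F s - del.
  have [p01|p01] := boolP (0 <= p <= 1); last by exists 1.
  have [->|ps] := eqVneq p s; first by exists 1.
  have : F p != F s.
    apply: contra_neq ps => FE; apply: argmax_unique _ smax; split=> // y y01.
    by have := Hs y y01; rewrite -/(F p) FE.
  rewrite neq_lt => /orP[Fps|]; last by rewrite ltNge Hs.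
  by exists (F s - F p); rewrite ?subr_gt0 // => _ _; rewrite subKr.
have [d1 d10 D1] := side (s + eps); have [d2 d20 D2] := side (s - eps).
have dm : 0 < Num.min d1 d2 by rewrite lt_min d10.
exists (Num.min d1 d2 / eps) => [|r y rd [y01 Hy]]; first exact: divr_gt0.
rewrite ltNge; apply/negP => ys.
have h1 : F s - F y <= `|r - r0| * `|y - s|.
  have h := Hy _ s01; rewrite -normrM.
  apply: (@le_trans _ _ (- ((r - r0) * (y - s)))); first by rewrite /F; lra.
  by rewrite -normrN ler_norm.
(* The weight of [y] in the point of the segment that lies at distance [eps] from [s]. *)
pose th := eps / `|y - s|.
have ys0 : 0 < `|y - s| by apply: lt_le_trans ys.
have th0 : 0 < th by rewrite divr_gt0.
have th1 : th <= 1 by rewrite ler_pdivrMr // mul1r.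
have chord p : p = th * y + (1 - th) * s -> th * F y + (1 - th) * F s <= F p.
  move=> ->; have [->|th1'] := eqVneq th 1; first by rewrite subrr !mul0r !addr0 !mul1r.
  have yneq : y != s by rewrite -subr_eq0 -normr_gt0.
  have := @f_concave y s th y01 s01 yneq; rewrite th0 lt_neqAle th1' th1 => /(_ isT).
  by rewrite /F; lra.
have range p : p = th * y + (1 - th) * s -> 0 <= p <= 1.
  move=> ->; move: y01 s01 => /andP[y0 y1] /andP[s0 s1].
  have h0 := mulr_ge0 (ltW th0) y0; have th1' : 0 <= 1 - th by rewrite subr_ge0.
  have h2 := mulr_ge0 th1' s0.
  have h3 := ler_wpM2l (ltW th0) y1; have h4 := ler_wpM2l th1' s1.
  by apply/andP; split; lra.
have : th * (F s - F y) >= Num.min d1 d2.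
  have [ylt|ygt] := ltP y s.
    have pE : s - eps = th * y + (1 - th) * s.
      rewrite /th ltr0_norm ?subr_lt0 //; field; rewrite -opprB oppr_eq0 subr_eq0.
      by rewrite gt_eqF.
    have := chord _ pE; have := D2 (range _ pE); rewrite -subr_eq0 => H.
    have /H : s - eps - s != 0 by rewrite addrAC subrr sub0r oppr_eq0 gt_eqF.
    have : Num.min d1 d2 <= d2 by rewrite ge_min lexx orbT.
    lra.
  have pE : s + eps = th * y + (1 - th) * s.
    have ys1 : s < y by rewrite lt_neqAle ygt andbT eq_sym -subr_eq0 -normr_gt0.
    rewrite /th gtr0_norm ?subr_gt0 //; field; rewrite subr_eq0.
    by rewrite gt_eqF.
  have := chord _ pE; have := D1 (range _ pE); rewrite -subr_eq0 => H.
  have /H : s + eps - s != 0 by rewrite addrAC subrr add0r gt_eqF.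
  have : Num.min d1 d2 <= d1 by rewrite ge_min lexx.
  lra.
have := ler_wpM2l (ltW th0) h1.
have -> : th * (`|r - r0| * `|y - s|) = `|r - r0| * eps.
  by rewrite /th; field; rewrite gt_eqF.
rewrite ltr_pdivlMr // in rd.
lra.
Qed.

End Argmax.

(** As service rates differ by at most 1, [service_gap] bounds the squared differences of weights by
    the l1-distance of the parameters; hence the square root. *)
Lemma service_modulus (R : realType) (n : nat) (e : rel 'I_n) (r q : 'I_n -> R) i :
  `|service e r i - service e q i| <=
  (\sum_(rho in indep_sets e) 1) * Num.sqrt (\sum_k `|r k - q k|).
Proof.
have srv01 (p : 'I_n -> R) k : 0 <= service e p k <= 1.
  by rewrite service_ge0 ltW // service_lt1.
rewrite /service -sumrB mulr_suml (le_trans (ler_norm_sum _ _ _)) //.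
apply: ler_sum => rho rhoI; rewrite mul1r -mulrBl normrM.
apply: le_trans (_ : `|gibbs e r rho - gibbs e q rho| <= _).
  by rewrite ler_piMr //; case: (rho i); rewrite ?normr1 ?normr0.
rewrite -sqrtr_sqr ler_wsqrtr //.
apply: le_trans (_ : \sum_i (r i - q i) * (service e r i - service e q i) <= _).
  apply: le_trans (service_gap e r q); rewrite (bigD1 rho) //= lerDl.
  by rewrite sumr_ge0 // => k _; rewrite sqr_ge0.
apply: ler_sum => k _; apply: le_trans (ler_norm _) _; rewrite normrM ler_piMr //.
have /andP[a0 a1] := srv01 r k; have /andP[b0 b1] := srv01 q k.
by rewrite ler_norml; apply/andP; split; lra.
Qed.

(** * A Lyapunov function for the noisy dual descent *)

Section DualIteration.
Variables (R : realType) (n : nat) (e : rel 'I_n) (f : 'I_n -> R -> R) (a0 : R).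
Variables (r lam shat : nat -> 'I_n -> R) (rs : 'I_n -> R) (j0 : nat).
Hypothesis e_irr : irreflexive e.
Hypothesis f_concave : forall i, strictly_concave01 (f i).
Hypothesis a0_gt0 : 0 < a0.
Hypothesis r0 : forall i, r 0%N i = 0.
Hypothesis rS : forall j i,
  r j.+1 i = Num.max (r j i + step_size a0 j * (lam j i - shat j i)) 0.
Hypothesis lam01 : forall j i, 0 <= lam j i <= 1.
Hypothesis shat01 : forall j i, 0 <= shat j i <= 1.
Hypothesis lam_argmax : forall j i,
  is_argmax01 (fun y => f i y - r j.+1 i * y) (lam j.+1 i).

Lemma dual_ge0 j i : 0 <= r j i.
Proof. by case: j => [|j]; rewrite ?r0 // rS le_max lexx orbT. Qed.

(** A step adds at most [1/k], with [k = j + 1], and [ln (k + 1) - ln k >= 1/(k + 1) >= 1/(2 k)];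
    hence the factor 2. *)
Lemma dual_bound j i : r j.+1 i <= a0 + 2 * ln j.+1%:R.
Proof.
have dl k : lam k i - shat k i <= 1.
  by have /andP[_ l1] := lam01 k i; have /andP[s0 _] := shat01 k i; lra.
elim: j => [|j IH]; rewrite rS ge_max; apply/andP; split.
- by rewrite r0 add0r ln1 mulr0 addr0 /= ler_piMr // ltW.
- by rewrite ln1 mulr0 addr0 ltW.
- apply: le_trans (_ : r j.+1 i + j.+1%:R^-1 <= _).
    by rewrite lerD2l /= ler_piMr.
  have : j.+1%:R^-1 <= 2 * (ln j.+2%:R - ln j.+1%:R) :> R.
    rewrite -ler_pdivrMl // -[X in _ <= X]opprK lerNr opprB -ln_div ?posrE //.
    have -> : j.+1%:R / j.+2%:R = 1 + (- j.+2%:R^-1) :> R.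
      have J2 : j.+2%:R != 0 :> R by rewrite pnatr_eq0.
      by rewrite -[j.+1%:R](addrK 1) natr1 mulrBl divff // mul1r.
    apply: (le_trans (le_ln1Dx _)).
      by rewrite ltrN2 invf_lt1 // ltr1n.
    rewrite lerN2 -invfM lef_pV2 ?posrE ?mulr_gt0 // -natrM ler_nat; lia.
  by move: IH; move: (ln j.+1%:R) (ln j.+2%:R) (j.+1%:R^-1 : R) => *; lra.
- by rewrite addr_ge0 ?(ltW a0_gt0) // mulr_ge0 // ln_ge0 // ler1n.
Qed.

Hypothesis rs_gt0 : forall i, 0 < rs i.
Hypothesis rs_argmax :
  forall i, is_argmax01 (fun y => f i y - rs i * y) (service e rs i).
Hypothesis shat_near : forall j i, (j0 <= j)%N ->
  `|shat j i - service e (r j) i| <= (j%:R ^+ 2)^-1.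

Let V j := \sum_i (r j i - rs i) ^+ 2.

Let g j := \sum_i (r j i - rs i) * (service e (r j) i - service e rs i).

Let K : R := \sum_(i < n) (1 + 2 * (a0 + 2 + rs i)).

Let K_ge0 : 0 <= K.
Proof.
by apply: sumr_ge0 => i _; have := rs_gt0 i; move: a0_gt0; lra.
Qed.

(** The cross term of the expanded square has three parts: the deviation of the arrival rate from
    [service e rs], of favourable sign by [argmax_antitone]; the estimation error of the service;
    and the drift [- g]. The error is at most a constant over [j] even after multiplication by
    [|r - rs|]. *)
Let V_step j : (0 < j)%N -> (j0 <= j)%N ->
  V j.+1 <= V j - 2 * j%:R^-1 * g j + K * (j%:R ^+ 2)^-1.
Proof.
case: j => // j _ jj0; rewrite /V /g /K mulr_sumr mulr_suml -sumrB -big_split /=.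
apply: ler_sum => i _.
set x := r j.+1 i; set l := lam j.+1 i; set s := shat j.+1 i; set J : R := j.+1%:R.
have J0 : 0 < J by rewrite /J ltr0n.
have J1 : 1 <= J by rewrite /J ler1n.
have /andP[l0 l1] := lam01 j.+1 i; have /andP[s0 s1] := shat01 j.+1 i.
(* Truncation at 0 only brings the parameter closer to the positive [rs i]. *)
have step : (r j.+2 i - rs i) ^+ 2 <= (x + J^-1 * (l - s) - rs i) ^+ 2.
  rewrite rS /= -/x -/l -/s -/J; set z := x + _.
  have [z0|z0] := leP 0 z; first by [].
  rewrite sub0r sqrrN -[leRHS]sqrrN opprB.
  by rewrite ler_pXn2r ?nnegrE //; have := rs_gt0 i; lra.
apply: le_trans step _.
(* Bounding the logarithm by [J] is crude but enough, because the service error is [1/J^2]. *)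
have xr : `|x - rs i| <= (a0 + 2 + rs i) * J.
  have xb := dual_bound j i; have x0 := dual_ge0 j.+1 i.
  have lnJ : ln J <= J by rewrite ltW // ln_sublinear.
  have aJ : a0 <= a0 * J by rewrite ler_peMr // ltW.
  have rJ : rs i <= rs i * J by rewrite ler_peMr // ltW.
  have := rs_gt0 i; rewrite -/x -/J in xb x0 *; move: a0_gt0 => ? ?.
  by rewrite ler_norml; apply/andP; split; lra.
have h1 := argmax_antitone (lam_argmax j i) (rs_argmax i); rewrite -/x -/l in h1.
have near := shat_near i jj0; rewrite -/s -/J in near.
have h2 : (x - rs i) * (service e (r j.+1) i - s) <= (a0 + 2 + rs i) * J^-1.
  apply: le_trans (ler_norm _) _; rewrite normrM [X in _ * X]distrC.
  have -> : (a0 + 2 + rs i) * J^-1 = (a0 + 2 + rs i) * J * (J ^+ 2)^-1.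
    by field; rewrite gt_eqF.
  exact: ler_pM.
have h3 : (J^-1 * (l - s)) ^+ 2 <= (J ^+ 2)^-1.
  rewrite exprMn -exprVn ler_piMr ?sqr_ge0 //.
  have : 0 <= (1 - (l - s)) * (1 + (l - s)) by rewrite mulr_ge0 //; rewrite /l /s; lra.
  lra.
have h4 : 2 * J^-1 * ((x - rs i) * (l - service e rs i)) <= 0.
  by rewrite mulr_ge0_le0 // mulr_ge0 // invr_ge0 ltW.
have h5 : 2 * J^-1 * ((x - rs i) * (service e (r j.+1) i - s)) <=
    2 * (a0 + 2 + rs i) * (J ^+ 2)^-1.
  have -> : 2 * (a0 + 2 + rs i) * (J ^+ 2)^-1 = 2 * J^-1 * ((a0 + 2 + rs i) * J^-1).
    by field; rewrite gt_eqF.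
  by apply: ler_wpM2l => //; rewrite mulr_ge0 // invr_ge0 ltW.
have -> : (x + J^-1 * (l - s) - rs i) ^+ 2 =
  (x - rs i) ^+ 2 + 2 * J^-1 * ((x - rs i) * (l - service e rs i))
  + 2 * J^-1 * ((x - rs i) * (service e (r j.+1) i - s)) + (J^-1 * (l - s)) ^+ 2
  - 2 * J^-1 * ((x - rs i) * (service e (r j.+1) i - service e rs i)) by ring.
rewrite -/x [(1 + 2 * _) * _]mulrDl mul1r; move: h3 h4 h5.
move: (2 * J^-1 * _) (2 * J^-1 * _) (2 * J^-1 * _) ((J^-1 * (l - s)) ^+ 2).
have aux (a b c d y u v : R) : d <= u -> c <= 0 -> b <= v ->
  y + c + b + d - a <= y - a + (u + v) by lra.
by move=> *; exact: aux.
Qed.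

(** The added term absorbs the errors of [V_step], since [1/j^2 <= 2 (1/j - 1/(j+1))] for
    [j >= 1]. *)
Let W j := V j + 2 * K * j%:R^-1.

Let V_ge0 j : 0 <= V j.
Proof. by apply: sumr_ge0 => i _; exact: sqr_ge0. Qed.

Let W_step j : (0 < j)%N -> (j0 <= j)%N -> W j.+1 <= W j - 2 * j%:R^-1 * g j.
Proof.
case: j => // j _ jj0; have := V_step (ltn0Sn j) jj0; rewrite /W.
have : K * (j.+1%:R ^+ 2)^-1 <= 2 * K * j.+1%:R^-1 - 2 * K * j.+2%:R^-1.
  have -> : 2 * K / j.+1%:R - 2 * K / j.+2%:R = K * (2 * (j.+1%:R^-1 - j.+2%:R^-1)) by ring.
  apply: ler_wpM2l => //; rewrite -[j.+2%:R]natr1; set J : R := j.+1%:R.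
  have J1 : 1 <= J by rewrite /J ler1n.
  have J0 : 0 < J by rewrite /J ltr0n.
  rewrite -subr_ge0.
  have -> : 2 * (J^-1 - (J + 1)^-1) - (J ^+ 2)^-1 = (J - 1) / (J ^+ 2 * (J + 1)).
    by field; rewrite !gt_eqF // ltr_wpDl // ltW.
  by rewrite divr_ge0 ?subr_ge0 // mulr_ge0 ?sqr_ge0 // addr_ge0 // ltW.
move: (V j.+2) (V j.+1) (g j.+1) (j.+1%:R^-1 : R) (j.+2%:R^-1 : R).
move: ((j.+1%:R ^+ 2)^-1 : R) => *; lra.
Qed.

Let W_ge0 j : 0 <= W j.
Proof. by rewrite addr_ge0 // !mulr_ge0 // invr_ge0. Qed.

Let W_mono j k : (0 < j)%N -> (j0 <= j)%N -> (j <= k)%N -> W k <= W j.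
Proof.
move=> jp jj0; elim: k => [|k IH]; first by rewrite leqn0 => /eqP->.
rewrite leq_eqVlt => /predU1P[->//|]; rewrite ltnS => jk.
apply: le_trans (IH jk); apply: le_trans (W_step _ _) _.
- exact: leq_trans jk.
- exact: leq_trans jk.
by rewrite gerBl mulr_ge0 ?service_gap_ge0 // mulr_ge0 // invr_ge0.
Qed.

(** Otherwise the nonnegative [W] would lose at least [2 del / j] at each late step, and the
    harmonic series would converge. *)
Let g_small_often (del : R) (J : nat) : 0 < del ->
  exists2 j, (J <= j)%N & g j < del.
Proof.
move=> del0; apply/not_exists2P => H.
pose M := maxn J (maxn 1 j0).
have gM j : (M <= j)%N -> del <= g j.
  move=> Mj; rewrite leNgt; apply/negP => gj; case: (H j) => //.
  by apply; rewrite (leq_trans _ Mj) // leq_maxl.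
have M1 j : (M <= j)%N -> (0 < j)%N.
  by move=> Mj; rewrite (leq_trans _ Mj) // !leq_max ltnSn orbT.
have M2 j : (M <= j)%N -> (j0 <= j)%N.
  by move=> Mj; rewrite (leq_trans _ Mj) // !leq_max leqnn !orbT.
have sumW m : 2 * del * \sum_(M <= k < M + m) k%:R^-1 <= W M - W (M + m).
  elim: m => [|m IH]; first by rewrite addn0 big_geq // mulr0 subrr.
  have Mm : (M <= M + m)%N by rewrite leq_addr.
  rewrite addnS big_nat_recr //= mulrDr.
  have := W_step (M1 _ Mm) (M2 _ Mm).
  have : 2 * del * (M + m)%:R^-1 <= 2 * (M + m)%:R^-1 * g (M + m).
    by rewrite mulrAC ler_wpM2l ?gM // mulr_ge0 // invr_ge0.
  lra.
have := @dvg_harmonic R; apply.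
apply: nondecreasing_is_cvgn.
  by apply/nondecreasing_seqP => k; rewrite seriesS lerDr harmonic_ge0.
exists (series harmonic M + W M / (2 * del)) => _ [k _ <-].
have [kM|/ltnW Mk] := leqP k M.
  apply: (@le_trans _ _ (series harmonic M)); last first.
    by rewrite lerDl divr_ge0 // mulr_ge0 // ltW.
  apply: (@homo_leq _ _ (fun x y : R => x <= y)) kM => // [y x z|m]; first exact: le_trans.
  by rewrite seriesS lerDr harmonic_ge0.
rewrite -(subnKC Mk); set m := (k - M)%N.
rewrite /series /= (big_cat_nat _ (n := M)) ?leq_addr //= lerD2l.
rewrite ler_pdivlMr ?mulr_gt0 // mulrC.
apply: le_trans (_ : 2 * del * \sum_(M <= k < M + m) k%:R^-1 <= _); last first.
  by apply: le_trans (sumW m) _; rewrite gerBl.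
(* The term of index [l] of [harmonic] is [1/(l+1)], below the [1/l] of the drift. *)
rewrite ler_wpM2l ?mulr_ge0 ?(ltW del0) // ler_sum_nat // => l /andP[Ml _].
by rewrite lef_pV2 ?posrE ?ltr0n ?ler_nat // M1.
Qed.

(** A late index where [g] is small puts [r] near [rs], hence [W] below [eps^2]; as [W] no longer
    increases, [r] stays within [eps]. *)
Lemma dual_iteration_cvg i : r j i @[j --> \oo] --> rs i.
Proof.
apply/cvgrPdist_lt => eps eps0.
pose eta : R := eps ^+ 2 / 2.
have eta0 : 0 < eta by rewrite divr_gt0 // exprn_gt0.
(* At most 1, so that [ep^2 <= ep]; dividing by [n.+1] also covers [n = 0]. *)
pose ep : R := Num.min 1 (eta / n.+1%:R).
have ep0 : 0 < ep by rewrite lt_min ltr01 divr_gt0.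
have [del del0 gP] := service_gap_small e_irr rs ep0.
have [J0 J0P] : exists J0, forall j, (J0 <= j)%N -> 2 * K * j%:R^-1 < eta.
  have x0 : 0 <= 2 * K / eta by rewrite divr_ge0 ?mulr_ge0 // ltW.
  exists (Num.bound (2 * K / eta)).+1 => j bj.
  have jp : 0 < j%:R :> R by rewrite ltr0n (leq_trans _ bj).
  rewrite ltr_pdivrMr // [eta * _]mulrC -ltr_pdivrMr //.
  by rewrite (lt_le_trans (archi_boundP x0)) // ler_nat ltnW.
have [j jJ gj] := g_small_often (maxn J0 (maxn 1 j0)) del0.
have [jJ0 j1 jj0] : [/\ (J0 <= j)%N, (0 < j)%N & (j0 <= j)%N].
  by move: jJ; rewrite !geq_max => /andP[-> /andP[-> ->]].
have Wj : W j < 2 * eta.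
  have := J0P _ jJ0; suff : V j <= eta by rewrite /W; lra.
  apply: (@le_trans _ _ (\sum_(k < n) ep)).
    apply: ler_sum => k _; rewrite -real_normK ?num_real // expr2.
    have rk := gP _ gj k; apply: (@le_trans _ _ (ep * 1)); last by rewrite mulr1.
    by apply: ler_pM => //; [exact: ltW|rewrite (le_trans (ltW rk)) // ge_min lexx].
  rewrite sumr_const card_ord -(mulr_natr ep n).
  apply: (@le_trans _ _ (ep * n.+1%:R)); first by rewrite ler_pM2l // ler_nat.
  by rewrite -ler_pdivlMr // ge_min lexx orbT.
exists j => // k /= jk; rewrite distrC.
have Wk := le_lt_trans (W_mono j1 jj0 jk) Wj.
rewrite -(ltr_pXn2r (n := 2)) ?nnegrE ?(ltW eps0) // real_normK ?num_real //.
apply: le_lt_trans (_ : W k < _); last by move: Wk; rewrite /eta; lra.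
apply: (@le_trans _ _ (V k)); last by rewrite /W lerDl !mulr_ge0 // invr_ge0.
rewrite /V (bigD1 i) //= lerDl.
by apply: sumr_ge0 => l _; exact: sqr_ge0.
Qed.

Lemma rate_iteration_cvg i : lam j i @[j --> \oo] --> service e rs i.
Proof.
apply/cvgrPdist_lt => eps eps0.
have [del del0 H] := argmax_perturb (@f_concave i) eps0 (rs_argmax i).
have /cvgrPdist_lt/(_ _ del0)[N _ NP] := @dual_iteration_cvg i.
exists N.+1 => // -[//|j] /= Nj; rewrite distrC.
by apply: H (lam_argmax j i); rewrite distrC; apply: NP; exact: ltnW.
Qed.

Lemma service_iteration_cvg i : service e (r j) i @[j --> \oo] --> service e rs i.
Proof.
pose N : R := \sum_(rho in indep_sets e) 1.
have N0 : 0 <= N by apply: sumr_ge0.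
have sq : Num.sqrt (\sum_k `|r j k - rs k|) @[j --> \oo] --> (0 : R).
  rewrite -[X in _ --> X](@sqrtr0 R); apply: continuous_cvg; first exact: sqrt_continuous.
  rewrite -[X in _ --> X](_ : \sum_(k < n) `|rs k - rs k| = 0); last first.
    by rewrite big1 // => k _; rewrite subrr normr0.
  apply: cvg_big => [|k _]; first exact: add_continuous.
  by apply: cvg_norm; apply: cvgB; [exact: dual_iteration_cvg|exact: cvg_cst].
apply/cvgrPdist_lt => eps eps0.
have c0 : 0 < eps / (N + 1) by rewrite divr_gt0 // ltr_wpDl.
move/cvgrPdist_lt: sq => /(_ _ c0); apply: filterS => j.
rewrite sub0r normrN ger0_norm ?sqrtr_ge0 // => sj.
rewrite distrC; apply: (le_lt_trans (service_modulus e (r j) rs i)); rewrite -/N.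
move: sj; rewrite ltr_pdivlMr ?ltr_wpDl //; have := sqrtr_ge0 (\sum_k `|r j k - rs k|).
by lra.
Qed.

End DualIteration.


(** * Occupation measures of nearly balanced flows *)

Section Flip.
Variables (n : nat) (e : rel 'I_n).
Implicit Types (rho : schedule n) (i : 'I_n).

Definition flip i rho : schedule n :=
  [ffun k => if k == i then ~~ rho k else rho k].

Lemma flipK i : involutive (flip i).
Proof. by move=> rho; apply/ffunP => k; rewrite !ffunE; case: eqP => // _; rewrite negbK. Qed.

Lemma flip_self i rho : flip i rho i = ~~ rho i.
Proof. by rewrite ffunE eqxx. Qed.

Lemma flip_other i k rho : k != i -> flip i rho k = rho k.
Proof. by move=> ki; rewrite ffunE (negbTE ki). Qed.

Lemma indep_setsP rho :
  reflect (forall i j, e i j -> ~~ (rho i && rho j)) (rho \in indep_sets e).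
Proof.
rewrite inE; apply: (iffP forallP) => [H i j eij|H i].
  by have /forallP/(_ j) := H i; rewrite eij /=; case: (rho i); case: (rho j).
by apply/forallP => j; apply/implyP => /H; case: (rho i); case: (rho j).
Qed.

Lemma flip_off_indep i rho :
  rho i -> rho \in indep_sets e -> flip i rho \in indep_sets e.
Proof.
move=> rhoi /indep_setsP H; apply/indep_setsP => k j /H; rewrite !ffunE.
by do 2![case: eqP => [->|_]]; rewrite ?rhoi ?andbF.
Qed.

Lemma flip_on_indep (e_sym : symmetric e) (e_irr : irreflexive e) i rho :
  ~~ rho i -> rho \in indep_sets e ->
  (flip i rho \in indep_sets e) = [forall j, e i j ==> ~~ rho j].
Proof.
move=> rhoi rhoI; apply/indep_setsP/forallP => [H j|H k j ekj].
  apply/implyP => eij; have := H i j eij; rewrite flip_self rhoi /=.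
  by rewrite flip_other //; apply: contraTneq eij => ->; rewrite e_irr.
have [ki|ki] := eqVneq k i.
  have ji : j != i by apply: contraTneq ekj => ->; rewrite ki e_irr.
  by rewrite (flip_other _ ji) negb_and; have := H j; rewrite -ki ekj => /= ->; rewrite orbT.
have [ji|ji] := eqVneq j i.
  by rewrite (flip_other _ ki); have := H k; rewrite e_sym -ji ekj => /= /negbTE->.
by rewrite !flip_other //; exact: (indep_setsP _ rhoI).
Qed.

End Flip.

Section Occupation.
Variables (R : realType) (n : nat) (e : rel 'I_n) (r : 'I_n -> R).
Implicit Types (rho : schedule n) (i : 'I_n).

Definition clock_rate (q : 'I_n -> R) rho i : R := if rho i then 1 else expR (q i).

Lemma clock_rate_gt0 q rho i : 0 < clock_rate q rho i.
Proof. by rewrite /clock_rate; case: ifP => // _; rewrite expR_gt0. Qed.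

Hypothesis r_ge0 : forall i, 0 <= r i.

Lemma clock_rate_ge1 rho i : 1 <= clock_rate r rho i.
Proof. by rewrite /clock_rate; case: ifP => // _; rewrite -expR0 ler_expR. Qed.

Lemma energy_flip rho i :
  energy r (flip i rho) = if rho i then energy r rho - r i else energy r rho + r i.
Proof.
rewrite /energy (bigD1 i) //= [in RHS](bigD1 i) //= flip_self.
have -> : \sum_(k < n | k != i) r k * (flip i rho k)%:R =
          \sum_(k < n | k != i) r k * (rho k)%:R.
  by apply: eq_bigr => k ki; rewrite flip_other.
by case: (rho i); rewrite /= ?mulr0 ?mulr1; ring.
Qed.

Lemma detailed_balance rho i :
  gibbs e r (flip i rho) * clock_rate r (flip i rho) i =
  gibbs e r rho * clock_rate r rho i.
Proof.
rewrite /gibbs mulrAC [RHS]mulrAC; congr (_ / _).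
rewrite /clock_rate flip_self energy_flip; case: (rho i) => /=.
  by rewrite -expRD subrK mulr1.
by rewrite mulr1 expRD.
Qed.

Variables (m M T delta : R) (O : schedule n -> R) (N : schedule n -> 'I_n -> R).
Hypotheses (m_gt0 : 0 < m) (T_gt0 : 0 < T) (delta_ge0 : 0 <= delta).
Hypothesis M_card : M = \sum_(rho in indep_sets e) 1.
Hypothesis gibbs_ge : forall rho, rho \in indep_sets e -> m <= gibbs e r rho.
Hypothesis O_ge0 : forall rho, 0 <= O rho.
Hypothesis O_sum : \sum_(rho in indep_sets e) O rho = T.
Hypothesis N_near : forall rho i, rho \in indep_sets e ->
  `|N rho i - clock_rate r rho i * O rho| <= delta.
Hypothesis N_flow : forall rho, rho \in indep_sets e ->
  `|\sum_(i | flip i rho \in indep_sets e) (N (flip i rho) i - N rho i)| <= 1.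

(** The density of the occupation measure with respect to the Gibbs measure. *)
Let h rho := O rho / T / gibbs e r rho.

(** The conductance of the edge from [rho] to [flip i rho], symmetric by [detailed_balance]. *)
Let kappa rho i := gibbs e r rho * clock_rate r rho i.

Let h_ge0 rho : 0 <= h rho.
Proof. exact: divr_ge0 (divr_ge0 (O_ge0 _) (ltW T_gt0)) (ltW (gibbs_gt0 _ _ _)). Qed.

Let O_h rho i : clock_rate r rho i * O rho / T = kappa rho i * h rho.
Proof. by rewrite /kappa /h; field; rewrite !gt_eqF ?gibbs_gt0. Qed.

Let h_le rho : rho \in indep_sets e -> h rho <= m^-1.
Proof.
move=> rhoI; rewrite /h; apply: (@le_trans _ _ (1 / m)); last by rewrite div1r.
apply: ler_pM; rewrite ?divr_ge0 ?invr_ge0 //; try exact: ltW.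
- by rewrite ltW // gibbs_gt0.
- rewrite ler_pdivrMr // mul1r -O_sum (bigD1 rho) //= lerDl.
  exact: sumr_ge0.
- by rewrite lef_pV2 ?posrE ?gibbs_gt0 // gibbs_ge.
Qed.

Let ep := (1 + n%:R * (2 * delta)) / T.

(** Multiplied by [T], the sum is the net flow into [rho] predicted by the rates. The actual net
    flow is at most 1, and for each of at most [n] flips two counts are each off by at most
    [delta]. *)
Let flow_h rho : rho \in indep_sets e ->
  `|\sum_(i | flip i rho \in indep_sets e) kappa rho i * (h (flip i rho) - h rho)| <= ep.
Proof.
move=> rhoI; rewrite /ep ler_pdivlMr // -[X in _ * X](gtr0_norm T_gt0) -normrM mulr_suml.
have -> : \sum_(i | flip i rho \in indep_sets e) kappa rho i * (h (flip i rho) - h rho) * T =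
  \sum_(i | flip i rho \in indep_sets e) (N (flip i rho) i - N rho i)
  + \sum_(i | flip i rho \in indep_sets e)
     ((N rho i - clock_rate r rho i * O rho) -
      (N (flip i rho) i - clock_rate r (flip i rho) i * O (flip i rho))).
  rewrite -big_split /=; apply: eq_bigr => i _.
  have kf : kappa (flip i rho) i = kappa rho i := detailed_balance rho i.
  rewrite mulrBr -{1}kf -!O_h mulrBl !divfK ?gt_eqF //; ring.
apply: le_trans (ler_normD _ _) _; apply: lerD; first exact: N_flow.
apply: le_trans (ler_norm_sum _ _ _) _.
apply: (@le_trans _ _ (\sum_(i < n) (2 * delta))); last first.
  by rewrite sumr_const card_ord -[leLHS]mulr_natl.
rewrite [leLHS]big_mkcond /=; apply: ler_sum => i _.
case: ifP => [fI|_]; last by rewrite mulr_ge0.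
apply: le_trans (ler_normB _ _) _.
by have := N_near i rhoI; have := N_near i fI; lra.
Qed.

(** Summation by parts: exchanging [rho] and [flip i rho] turns the form into [-2] times the sum of
    [h] against its generator, where [h <= 1/m] and the generator is at most [ep] in absolute
    value. *)
Let dirichlet : \sum_(rho in indep_sets e)
    \sum_(i | flip i rho \in indep_sets e) kappa rho i * (h (flip i rho) - h rho) ^+ 2
  <= 2 * M * (m^-1 * ep).
Proof.
pose A F := \sum_(rho in indep_sets e) \sum_(i | flip i rho \in indep_sets e) F rho i : R.
have Aflip F : A F = A (fun rho i => F (flip i rho) i).
  rewrite /A (exchange_big_dep xpredT) //= [RHS](exchange_big_dep xpredT) //=.
  apply: eq_bigr => i _; rewrite (reindex_inj (inv_inj (@flipK n i))) /=.
  by apply: eq_bigl => rho; rewrite flipK andbC.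
have -> : \sum_(rho in indep_sets e)
    \sum_(i | flip i rho \in indep_sets e) kappa rho i * (h (flip i rho) - h rho) ^+ 2 =
  A (fun rho i => h (flip i rho) * (kappa rho i * (h (flip i rho) - h rho))) -
  A (fun rho i => h rho * (kappa rho i * (h (flip i rho) - h rho))).
  rewrite /A -sumrB; apply: eq_bigr => rho _; rewrite -sumrB; apply: eq_bigr => i _.
  ring.
rewrite Aflip.
have -> : A (fun rho i => h (flip i (flip i rho)) *
     (kappa (flip i rho) i * (h (flip i (flip i rho)) - h (flip i rho)))) =
   - A (fun rho i => h rho * (kappa rho i * (h (flip i rho) - h rho))).
  rewrite /A -sumrN; apply: eq_bigr => rho _; rewrite -sumrN; apply: eq_bigr => i _.
  by rewrite flipK [kappa (flip i rho) i]detailed_balance -/(kappa rho i); ring.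
rewrite -opprD -mulr2n -mulNrn -[X in X <= _]mulr_natl -mulrA ler_pM2l //.
rewrite /A -sumrN M_card mulr_suml; apply: ler_sum => rho rhoI; rewrite mul1r.
rewrite -mulr_sumr; apply: le_trans (ler_norm _) _; rewrite normrN normrM.
by apply: ler_pM => //; [rewrite (ger0_norm (h_ge0 rho)); exact: h_le|exact: flow_h].
Qed.

Let zeta := Num.sqrt (2 * M * ep) / m.

Let zeta_ge0 : 0 <= zeta.
Proof. by rewrite divr_ge0 ?sqrtr_ge0 // ltW. Qed.

(** A single term of the Dirichlet form; its conductance is at least [m] because nonnegative
    parameters make all rates at least 1. *)
Let h_flip rho i : rho \in indep_sets e -> flip i rho \in indep_sets e ->
  `|h (flip i rho) - h rho| <= zeta.
Proof.
move=> rhoI fI; rewrite /zeta ler_pdivlMr // -[X in _ * X](gtr0_norm m_gt0) -normrM.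
rewrite -sqrtr_sqr ler_wsqrtr //.
apply: (@le_trans _ _ (m * (2 * M * (m^-1 * ep)))); last first.
  by rewrite -subr_ge0 le_eqVlt; apply/orP; left; apply/eqP; field; rewrite gt_eqF.
have -> : ((h (flip i rho) - h rho) * m) ^+ 2 =
  m * (m * (h (flip i rho) - h rho) ^+ 2) by ring.
apply: ler_wpM2l; first exact: ltW.
apply: le_trans dirichlet; rewrite (bigD1 rho) //= (bigD1 i) //=.
rewrite -addrA ler_wpDr //; last first.
  rewrite ler_wpM2r ?sqr_ge0 //.
  apply: le_trans (gibbs_ge rhoI) _.
  by rewrite /kappa ler_peMr ?clock_rate_ge1 // ltW // gibbs_gt0.
rewrite addr_ge0 //; first apply: sumr_ge0 => k _; last apply: sumr_ge0 => k _.
  by rewrite mulr_ge0 ?sqr_ge0 // mulr_ge0 // ltW ?gibbs_gt0 // clock_rate_gt0.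
apply: sumr_ge0 => l _.
by rewrite mulr_ge0 ?sqr_ge0 // mulr_ge0 // ltW ?gibbs_gt0 // clock_rate_gt0.
Qed.

(** Switching off the active nodes one by one leads to the idle schedule through independent sets in
    at most [n] flips. *)
Let h_idle rho : rho \in indep_sets e -> `|h rho - h (idle n)| <= n%:R * zeta.
Proof.
move=> rhoI; apply: (@le_trans _ _ (#|[set i | rho i]%SET|%:R * zeta)); last first.
  rewrite ler_wpM2r // ler_nat; apply: leq_trans (max_card _) _.
  by rewrite card_ord.
have [k] := ubnP #|[set i | rho i]%SET|; elim: k => // k IH in rho rhoI *.
have [/existsP[i rhoi]|/existsPn rho0] := boolP [exists i, rho i]; last first.
  have -> : rho = idle n by apply/ffunP => i; rewrite ffunE; exact: negbTE.
  by rewrite subrr normr0 mulr_ge0.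
have fI := flip_off_indep rhoi rhoI.
have cE : #|[set i | rho i]%SET| = #|[set k | flip i rho k]%SET|.+1.
  rewrite (cardsD1 i) inE rhoi add1n; congr _.+1; apply: eq_card => l.
  by rewrite !inE ffunE; case: eqP => [->|]; rewrite ?rhoi.
rewrite cE ltnS => ck; have := IH _ fI ck; have := h_flip rhoI fI.
rewrite -natr1 mulrDl mul1r => h1 h2.
have -> : h rho - h (idle n) = - (h (flip i rho) - h rho) + (h (flip i rho) - h (idle n)) by ring.
by apply: le_trans (ler_normD _ _) _; rewrite normrN addrC lerD.
Qed.

(** The density [h] is nearly constant and has Gibbs mean 1, so it is near 1. *)
Lemma occupation_gibbs rho : rho \in indep_sets e ->
  `|O rho / T - gibbs e r rho| <= 2 * n%:R * zeta.
Proof.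
move=> rhoI.
have h1 : `|1 - h (idle n)| <= n%:R * zeta.
  have -> : 1 - h (idle n) = \sum_(k in indep_sets e) gibbs e r k * (h k - h (idle n)).
    under eq_bigr => k _ do rewrite mulrBr.
    rewrite sumrB -mulr_suml gibbs_sum mul1r; congr (_ - _).
    rewrite -(divff (lt0r_neq0 T_gt0)) -{1}O_sum mulr_suml; apply: eq_bigr => k _.
    by rewrite /h [RHS]mulrC divfK // gt_eqF // gibbs_gt0.
  apply: le_trans (ler_norm_sum _ _ _) _.
  rewrite -[leRHS]mul1r -[X in _ <= X * _](gibbs_sum e r) mulr_suml.
  apply: ler_sum => k kI.
  have g0 := ltW (gibbs_gt0 e r k).
  by rewrite normrM (ger0_norm g0) ler_wpM2l // h_idle.
have h2 := h_idle rhoI; have g0 := gibbs_gt0 e r rho.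
have -> : O rho / T - gibbs e r rho =
   gibbs e r rho * ((h rho - h (idle n)) - (1 - h (idle n))).
  rewrite opprB addrA subrK mulrBr mulr1; congr (_ - _).
  by rewrite /h [RHS]mulrC divfK // gt_eqF.
rewrite normrM (gtr0_norm g0); apply: (@le_trans _ _ (1 * (2 * n%:R * zeta))); last by rewrite mul1r.
apply: ler_pM => //; [exact: ltW|exact: gibbs_le1|].
by apply: le_trans (ler_normB _ _) _; lra.
Qed.

Lemma occupation_service i :
  `|(\sum_(rho in indep_sets e) (rho i)%:R * O rho) / T - service e r i| <=
  M * (2 * n%:R * (Num.sqrt (2 * M * ((1 + n%:R * (2 * delta)) / T)) / m)).
Proof.
rewrite /service mulr_suml -sumrB M_card mulr_suml -/ep.
apply: le_trans (ler_norm_sum _ _ _) _; apply: ler_sum => rho rhoI; rewrite mul1r.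
rewrite -M_card -mulrA [X in _ - X]mulrC -mulrBr normrM.
apply: le_trans (occupation_gibbs rhoI).
by rewrite ler_piMl //; case: (rho i); rewrite ?normr1 ?normr0.
Qed.

End Occupation.

Lemma gibbs_lower_bound (R : realType) (n : nat) (e : rel 'I_n) (r : 'I_n -> R)
    (M B : R) rho :
  (forall i, 0 <= r i <= B) -> M = \sum_(rho in indep_sets e) 1 ->
  (M * expR B ^+ n)^-1 <= gibbs e r rho.
Proof.
move=> r0B ME; rewrite /gibbs -[X in X <= _]mul1r.
have e0 (k : schedule n) : 0 <= energy r k <= n%:R * B.
  apply/andP; split.
    by apply: sumr_ge0 => i _; rewrite mulr_ge0 //; case/andP: (r0B i).
  apply: (@le_trans _ _ (\sum_(i < n) B)); last by rewrite sumr_const card_ord mulr_natl.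
  apply: ler_sum => i _; case/andP: (r0B i) => ri0 riB.
  by apply: le_trans riB; rewrite ler_piMr //; case: (k i).
have Z0 := partition_gt0 e r.
have Zle : partition_fun e r <= M * expR B ^+ n.
  rewrite /partition_fun ME mulr_suml; apply: ler_sum => k _.
  by rewrite mul1r -expRM_natl ler_expR; case/andP: (e0 k).
apply: ler_pM => //.
- by rewrite invr_ge0 (le_trans (ltW Z0)).
- by rewrite -expR0 ler_expR; case/andP: (e0 rho).
- by rewrite lef_pV2 ?posrE // (lt_le_trans Z0).
Qed.

(** * Resampling one clock of an independent family *)

Section Density.
Local Open Scope ereal_scope.
Import HBNNSimple.
Context d1 d2 (T1 : measurableType d1) (T2 : measurableType d2) (R : realType).
Variables (phi : T1 -> T2) (mu : {measure set T1 -> \bar R}).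
Variables (nu : {measure set T2 -> \bar R}) (p : T1 -> R).
Hypothesis mphi : measurable_fun setT phi.
Hypothesis mp : measurable_fun setT p.
Hypothesis p_ge0 : forall x, (0 <= p x)%R.
Hypothesis nuE : forall A, measurable A -> nu A = \int[mu]_(x in phi @^-1` A) (p x)%:E.

Let mpE : measurable_fun setT (EFin \o p).
Proof. exact/measurable_EFinP. Qed.

Let mindic (E : set T2) : measurable E ->
  measurable_fun setT (fun x => (\1_E (phi x))%:E : \bar R).
Proof.
move=> mE; apply/measurable_EFinP.
exact: (@measurableT_comp _ _ _ _ _ _ (\1_E : T2 -> R)).
Qed.

Let density_indic (E : set T2) : measurable E ->
  \int[nu]_x (\1_E x)%:E = \int[mu]_x ((\1_E (phi x))%:E * (p x)%:E).
Proof.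
move=> mE; rewrite integral_indic// setIT nuE// [LHS]integral_mkcond/=.
apply: eq_integral => x _; rewrite patchE indicE.
have -> : (x \in phi @^-1` E) = (phi x \in E) by [].
by case: ifPn => xE; rewrite ?mul1e ?mul0e.
Qed.

Let density_nnsfun (f : {nnsfun T2 >-> R}) :
  \int[nu]_x (f x)%:E = \int[mu]_x ((f (phi x))%:E * (p x)%:E).
Proof.
under [LHS]eq_integral do rewrite fimfunE -fsumEFin//.
rewrite [LHS]ge0_integral_fsum//; last 2 first.
- by move=> r; exact/measurable_EFinP/measurableT_comp.
- by move=> n x _; rewrite EFinM nnfun_muleindic_ge0.
under [RHS]eq_integral.
  move=> x xD; rewrite fimfunE -fsumEFin// muleC ge0_mule_fsumr; last first.
    by move=> r; rewrite EFinM nnfun_muleindic_ge0.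
  over.
rewrite [RHS]ge0_integral_fsum//; last 2 first.
- move=> r; apply: emeasurable_funM => //.
  rewrite (_ : (fun x => _) = (fun x => r%:E * (\1_(f @^-1` [set r]) (phi x))%:E)); last first.
    by apply/funext => x; rewrite EFinM.
  by apply: emeasurable_funM => //; exact: mindic.
- move=> r x _; rewrite mule_ge0 ?lee_fin // -lee_fin EFinM.
  exact: nnfun_muleindic_ge0.
apply: eq_fsbigr => r; rewrite inE/= => -[y _ fyr]; have r0 : (0 <= r)%R.
  by rewrite -fyr.
rewrite [in LHS](_ : (fun x => _) = (fun x => r%:E * (\1_(f @^-1` [set r]) x)%:E)); last first.
  by apply/funext => x; rewrite EFinM.
rewrite [in RHS](_ : (fun x => _) =
    (fun x => r%:E * ((\1_(f @^-1` [set r]) (phi x))%:E * (p x)%:E))); last first.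
  by apply/funext => x; rewrite EFinM muleC muleA.
rewrite !ge0_integralZl//; first by rewrite density_indic.
- exact/measurable_EFinP/measurable_indic.
- by apply: emeasurable_funM => //; exact: mindic.
- by move=> x _; rewrite mule_ge0 // lee_fin.
Qed.

(** By indicators, simple functions and monotone limits. The map [phi] serves to pass between two
    instances of the measurable real line, where it is the identity. *)
Lemma ge0_integral_density (f : T2 -> \bar R) :
  measurable_fun setT f -> (forall x, 0 <= f x) ->
  \int[nu]_x f x = \int[mu]_x (f (phi x) * (p x)%:E).
Proof.
move=> mf f0.
pose f_ := nnsfun_approx measurableT mf.
have f_cvg x : (f_ n x)%:E @[n --> \oo] --> f x by exact: cvg_nnsfun_approx.
have f_mono x m n : (m <= n)%N -> (f_ m x)%:E <= (f_ n x)%:E.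
  by move=> mn; rewrite lee_fin; exact/lefP/nd_nnsfun_approx.
transitivity (lim (\int[nu]_x (f_ n x)%:E @[n --> \oo])).
  rewrite -monotone_convergence//=.
  - by apply: eq_integral => x _; apply/esym/cvg_lim.
  - by move=> n; exact/measurable_EFinP/measurable_funTS.
  - by move=> n x _; rewrite lee_fin.
  - by move=> x _ m n; exact: f_mono.
rewrite [LHS](_ : _ = lim (\int[mu]_x ((f_ n (phi x))%:E * (p x)%:E) @[n --> \oo])); last first.
  by apply: congr_lim; apply/funext => n; rewrite /= density_nnsfun.
rewrite -monotone_convergence//=.
- apply: eq_integral => x _; apply/cvg_lim => //.
  exact: cvgeMr.
- move=> n; apply: emeasurable_funM => //; apply/measurable_EFinP.
  by apply: measurableT_comp => //; exact: measurable_funTS.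
- by move=> n x _; rewrite mule_ge0 // lee_fin.
- by move=> x _ m n mn; apply: lee_wpmul2r; rewrite ?lee_fin //; exact: f_mono.
Qed.

End Density.

Section IndependentPair.
Local Open Scope ereal_scope.
Context d d1 d2 (T : measurableType d) (T1 : measurableType d1) (T2 : measurableType d2).
Context (R : realType) (P : probability T R).
Variables (X : {RV P >-> T1}) (Y : {RV P >-> T2}).
Hypothesis XY_indep : forall A B, measurable A -> measurable B ->
  P (X @^-1` A `&` Y @^-1` B) = P (X @^-1` A) * P (Y @^-1` B).

(** The joint law is the product of the marginals by uniqueness on rectangles; then Tonelli. *)
Lemma ge0_integral_indep (F : T1 * T2 -> \bar R) :
  measurable_fun setT F -> (forall z, 0 <= F z) ->
  \int[P]_w F (X w, Y w) = \int[P]_w \int[distribution P X]_x F (x, Y w).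
Proof.
move=> mF F0.
have mXY : measurable_fun setT (fun w => (X w, Y w)).
  by apply/measurable_fun_pairP; split => /=; exact: measurable_funP.
pose XY : {RV P >-> (T1 * T2)%type} := HB.pack (fun w => (X w, Y w))
  (isMeasurableFun.Build _ _ _ _ _ mXY).
transitivity (\int[distribution P XY]_z F z).
  by rewrite ge0_integral_distribution.
transitivity (\int[distribution P X \x distribution P Y]_z F z).
  apply: eq_measure_integral => A mA _; apply/esym.
  by apply: product_measure_unique => // B C mB mC; rewrite /= -XY_indep.
rewrite fubini_tonelli2 //= ge0_integral_distribution //.
- exact: measurable_fun_fubini_tonelli_G.
- by move=> y; apply: integral_ge0.
Qed.

End IndependentPair.

Section Functionals.
Variables (R : realType) (K : choiceType).

(* Measurability in the coordinates, for any choice of measurable coordinates;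
   this avoids a sigma-algebra on [K -> R]. *)
Definition mfunctional d2 (U : measurableType d2) (F : (K -> R) -> U) : Prop :=
  forall d1 (S : measurableType d1) (Y : K -> S -> R),
    (forall b, measurable_fun setT (Y b)) ->
    measurable_fun setT (fun w => F (fun b => Y b w)).

Definition update (x : K -> R) (c : K) (y : R) : K -> R :=
  fun b => if b == c then y else x b.

End Functionals.

Section Resample.
Local Open Scope ereal_scope.
Context d (T : measurableType d) (R : realType) (P : probability T R) (K : choiceType).
Local Notation mu := (@lebesgue_measure R).
Variable X : K -> {RV P >-> R}.
Hypothesis X_indep : forall (J : seq K) (B : K -> set R), uniq J ->
  (forall b, measurable (B b)) ->
  P (\big[setI/setT]_(b <- J) (X b @^-1` B b)) = \prod_(b <- J) P (X b @^-1` B b).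
Hypothesis X_exp : forall b, exponential_rv 1 (X b).

Let cylinder (J : seq K) (B : K -> set R) := \big[setI/setT]_(b <- J) (X b @^-1` B b).

Let cylinder_mem J B w : cylinder J B w <-> forall b, b \in J -> B b (X b w).
Proof.
rewrite /cylinder; elim: J => [|a J IH]; first by rewrite big_nil; split.
rewrite big_cons; split => [[Ba /IH H] b|H].
  by rewrite inE => /predU1P[->//|]; exact: H.
by split; [apply: H; rewrite mem_head|apply/IH => b bJ; apply: H; rewrite inE bJ orbT].
Qed.

Variable c : K.

(** Cylinders over clocks other than [c]: a pi-system generating the information carried by those
    clocks. *)
Let G : set (set T) := [set A | exists J B,
  [/\ uniq J, c \notin J, forall b, measurable (B b) & A = cylinder J B]].

Let G_measurable : G `<=` @measurable _ T.
Proof.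
move=> _ [J [B [_ _ mB ->]]]; rewrite /cylinder; apply: bigsetI_measurable => b _.
exact: measurable_funPTI.
Qed.

Let G_setI : setI_closed G.
Proof.
move=> _ _ [J1 [B1 [u1 c1 m1 ->]]] [J2 [B2 [u2 c2 m2 ->]]].
exists (undup (J1 ++ J2)), (fun b => (if b \in J1 then B1 b else setT) `&`
                                     (if b \in J2 then B2 b else setT)).
split.
- exact: undup_uniq.
- by rewrite mem_undup mem_cat negb_or c1.
- by move=> b; apply: measurableI; case: ifP.
apply/seteqP; split => w.
  case=> /cylinder_mem H1 /cylinder_mem H2; apply/cylinder_mem => b _.
  by split; case: ifP => // bJ; [exact: H1|exact: H2].
move/cylinder_mem => H; split; apply/cylinder_mem => b bJ.
  by have [] := H b; rewrite ?mem_undup ?mem_cat bJ.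
by have [] := H b; rewrite ?mem_undup ?mem_cat bJ ?orbT.
Qed.

(** For fixed [A] both sides are finite measures in [B] that agree on the pi-system [G]. *)
Let indep_G (A : set R) (B : set T) : measurable A -> <<s G >> B ->
  P (X c @^-1` A `&` B) = P (X c @^-1` A) * P B.
Proof.
move=> mA sGB; have mXA : measurable (X c @^-1` A) by exact: measurable_funPTI.
have PXA : P (X c @^-1` A) \is a fin_num by exact: fin_num_measure.
pose a : {nonneg R} := NngNum (fine_ge0 (measure_ge0 P (X c @^-1` A))).
rewrite setIC -(fineK PXA).
apply: (@g_sigma_algebra_measure_unique _ _ _ G G_measurable (fun=> setT) _ _
  (mrestr P mXA) (mscale a P)) => //.
- move=> _; exists [::], (fun=> setT); split; [by []|by []|by move=> b; exact: measurableT|].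
  by rewrite /cylinder big_nil.
- by rewrite bigcup_const //; exists 0%N.
- move=> _ [J [B' [uJ cJ mB' ->]]]; rewrite /= /mrestr /mscale /= fineK //.
  have := @X_indep (c :: J) (fun b => if b == c then A else B' b).
  rewrite /= cJ uJ => /(_ isT) => H; rewrite setIC.
  have Jc : {in J, forall b, (b == c) = false}.
    by move=> b bJ; apply: contraNF cJ => /eqP <-.
  rewrite big_cons eqxx in H.
  have bigE : \big[setI/setT]_(b <- J) (X b @^-1` (if b == c then A else B' b)) = cylinder J B'.
    by apply: eq_big_seq => b bJ; rewrite (Jc b bJ).
  rewrite bigE in H; rewrite H; last by move=> b; case: ifP.
  rewrite big_cons eqxx; congr (_ * _).
  rewrite /cylinder X_indep //; apply: eq_big_seq => b bJ.
  by rewrite (Jc b bJ).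
- move=> _; rewrite /= /mrestr.
  by rewrite (le_lt_trans (probability_le1 _ _)) ?ltry //; exact: measurableI.
Qed.

(** The sample space with the coarser sigma-algebra of the other clocks. The identity into it is a
    random variable independent of [X c], which avoids a sigma-algebra on families of clocks. *)
Let S := g_sigma_algebraType G.

Let id_measurable : @measurable_fun _ _ T S setT id.
Proof.
move=> _ A mA; rewrite setTI /=; apply: (@smallest_sub _ _ G _ _ _ A mA) => //.
exact: sigma_algebra_measurable.
Qed.

Let Y : {RV P >-> S} := HB.pack (id : T -> S)
  (isMeasurableFun.Build _ _ T S (id : T -> S) id_measurable).

Lemma resample (F : (K -> R) -> \bar R) : mfunctional F -> (forall x, 0 <= F x) ->
  \int[P]_w F (fun b => X b w) =
  \int[P]_w \int[mu]_(x in `[0%R, +oo[)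
     (F (update (fun b => X b w) c x) * (expR (- x))%:E).
Proof.
move=> mF F0.
have mX b : b != c -> @measurable_fun _ _ S R setT (X b).
  move=> bc _ A mA; rewrite setTI; apply: sub_sigma_algebra.
  exists [:: b], (fun=> A); split => //; first by rewrite inE eq_sym.
  by rewrite /cylinder big_seq1.
have mG : measurable_fun setT (fun z : R * S => F (update (fun b => X b z.2) c z.1)).
  apply: (mF _ _ (fun b (z : R * S) => if b == c then z.1 else X b z.2)) => b.
  have [_|bc] := eqVneq b c; first exact: measurable_fst.
  exact: (measurableT_comp (mX b bc) measurable_snd).
have upd w : update (fun b => X b w) c (X c w) = fun b => X b w.
  by apply/funext => b; rewrite /update; case: eqP => // ->.
transitivity (\int[P]_w F (update (fun b => X b (Y w)) c (X c w))).
  by apply: eq_integral => w _; rewrite upd.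
have XY A B : measurable A -> measurable B ->
    P (X c @^-1` A `&` Y @^-1` B) = P (X c @^-1` A) * P (Y @^-1` B).
  by move=> mA mB; rewrite indep_G.
rewrite (ge0_integral_indep XY mG) //.
apply: eq_integral => w _ /=.
have mFw : measurable_fun setT (fun x : R => F (update (fun b => X b w) c x)).
  apply: (mF _ _ (fun b (x : R) => if b == c then x else X b w)) => b.
  by have [_|_] := eqVneq b c; [exact: measurable_id|exact: measurable_cst].
rewrite (@ge0_integral_density _ _ (measurableTypeR R) R R (id : measurableTypeR R -> R) mu
  (distribution P (X c)) (exponential_pdf 1)) //.
- rewrite [RHS]integral_mkcond; apply: eq_integral => x _.
  rewrite patchE /= /exponential_pdf patchE; case: ifP => _; last by rewrite mule0.
  by rewrite mul1r mulN1r.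
- exact: measurable_exponential_pdf.
- by move=> x; rewrite exponential_pdf_ge0.
- by move=> A mA; exact: X_exp.
Qed.

Lemma measurable_resample (F : (K -> R) -> \bar R) :
  mfunctional F -> (forall x, 0 <= F x) ->
  measurable_fun setT (fun w => \int[mu]_(x in `[0%R, +oo[)
     (F (update (fun b => X b w) c x) * (expR (- x))%:E)).
Proof.
move=> mF F0.
pose f (z : T * measurableTypeR R) := F (update (fun b => X b z.1) c z.2) *
  ((0 <= z.2)%R%:R * expR (- (z.2 : R)))%R%:E.
have m2 : measurable_fun setT (fun z : T * measurableTypeR R => z.2 : R).
  exact: measurable_snd.
have mf : measurable_fun setT f.
  apply: emeasurable_funM.
    apply: (mF _ _ (fun b (z : T * measurableTypeR R) => if b == c then (z.2 : R) else X b z.1)) => b.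
    have [_|_] := eqVneq b c; first exact: m2.
    by apply: measurableT_comp => //; exact: measurable_fst.
  apply/measurable_EFinP; apply: measurable_funM.
    apply: (@measurableT_comp _ _ _ _ _ _ (fun b : bool => b%:R : R)) => //.
    exact: measurable_fun_ler.
  by apply: measurableT_comp => //; exact: measurableT_comp.
have f0 z : 0 <= f z by rewrite mule_ge0 // lee_fin mulr_ge0 ?expR_ge0.
rewrite (_ : (fun w => _) = (fun w => \int[mu]_x f (w, x))).
  exact: (@measurable_fun_fubini_tonelli_F _ _ T (measurableTypeR R) R mu f mf f0).
apply/funext => w; rewrite integral_mkcond; apply: eq_integral => x _.
rewrite patchE mem_setE in_itv /= andbT /f /=.
by case: ifP => _; rewrite ?mul1r // mul0r mule0.
Qed.

End Resample.

(** * Simulation of the network along a history of events *)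

(* An event is the end of the current period of a node, or [None] for the end
   of the current frame; the last event of a history is its head. *)
Notation history n := (seq (option 'I_n)).

(* [(i, k, b)] is the clock of the [k]-th period of node [i] if that period is
   a transmission ([b = true]) or a waiting period ([b = false]). *)
Notation clock n := ('I_n * nat * bool)%type.

(* [age i] is the part of the current clock of [i] that has elapsed, [par] the
   current parameters, and [occ eta] the time spent in the state [eta] since the
   beginning of the frame. *)
Record sim_state (R : realType) (n : nat) := SimState {
  age : 'I_n -> R;
  par : 'I_n -> R;
  occ : schedule n -> R }.

Section Simulation.
Variables (R : realType) (n : nat) (e : rel 'I_n) (eta0 : schedule n) (T0 : R).
Variable F : nat -> ('I_n -> R) -> (schedule n -> R) -> 'I_n -> R.
Hypothesis T0_gt0 : 0 < T0.
Implicit Types (h : history n) (l : option 'I_n) (x y : clock n -> R) (i m : 'I_n).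

(** A ring blocked by a neighbour leaves the schedule unchanged; it still starts a new period of the
    node. *)
Definition after i (eta : schedule n) : schedule n :=
  if flip i eta \in indep_sets e then flip i eta else eta.

Fixpoint sched h : schedule n :=
  match h with
  | [::] => eta0
  | Some i :: h' => after i (sched h')
  | None :: h' => sched h'
  end.

Fixpoint period h m : nat :=
  match h with
  | [::] => 0%N
  | Some i :: h' => if m == i then (period h' m).+1 else period h' m
  | None :: h' => period h' m
  end.

Fixpoint frame h : nat :=
  match h with
  | [::] => 0%N
  | Some _ :: h' => frame h'
  | None :: h' => (frame h').+1
  end.

Definition current h i : clock n := (i, period h i, sched h i).

Definition rate (s : sim_state R n) h i : R := clock_rate (par s) (sched h) i.

(* The time from the last event of [h] to the event [l]. *)
Definition delay (s : sim_state R n) x h l : R :=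
  if l is Some i then (x (current h i) - age s i) / rate s h i
  else frame_length T0 (frame h) - \sum_eta occ s eta.

(** Ages are cumulated rates, not elapsed times, so they are kept at the end of a frame although the
    rates change there. *)
Definition advance (s : sim_state R n) h l (t : R) : sim_state R n :=
  let ages := fun m => if l == Some m then 0 else age s m + rate s h m * t in
  let occs := fun eta => occ s eta + t *+ (eta == sched h) in
  if l is Some _ then SimState ages (par s) occs
  else SimState ages (F (frame h) (par s) occs) (fun=> 0).

Fixpoint sim x h : sim_state R n :=
  if h is l :: h' then advance (sim x h') h' l (delay (sim x h') x h' l)
  else SimState (fun=> 0) (fun=> 0) (fun=> 0).

Definition wait x h l : R := delay (sim x h) x h l.
Arguments wait : simpl never.

(* Only tests the clocks that have rung in [h]; the others may ring too early. *)
Fixpoint ok x h : bool :=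
  if h is l :: h' then
    [&& ok x h', 0 < wait x h' l & (l == None) || (wait x h' l < wait x h' None)]
  else true.

(* [h] is the sequence of the first events of the network with clocks [x]. *)
Definition live x h : bool :=
  ok x h && [forall i, age (sim x h) i < x (current h i)].

Lemma frame_length_gt0 j : 0 < frame_length T0 j.
Proof. by case: j => //= j; rewrite expR_gt0. Qed.

Lemma rate_gt0 s h i : 0 < rate s h i.
Proof. exact: clock_rate_gt0. Qed.

(** The clock of a period is read only when the period ends. The current clocks are thus free to be
    resampled without altering the past. *)
Lemma sim_ext x y h :
  (forall i k b, (k < period h i)%N -> x (i, k, b) = y (i, k, b)) ->
  sim x h = sim y h.
Proof.
elim: h => // l h IH xy /=.
have -> : sim x h = sim y h.
  apply: IH => i k b kp; apply: xy; case: l => //= m.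
  by case: eqP => // _; exact: leqW.
case: l xy => //= i xy; congr (advance _ h (Some i) _); rewrite /delay /current.
by rewrite xy //= eqxx.
Qed.

Lemma ok_ext x y h :
  (forall i k b, (k < period h i)%N -> x (i, k, b) = y (i, k, b)) ->
  ok x h = ok y h.
Proof.
elim: h => // l h IH xy /=.
have xy' i k b : (k < period h i)%N -> x (i, k, b) = y (i, k, b).
  by move=> kp; apply: xy; case: l => //= m; case: eqP => // _; exact: leqW.
rewrite (IH xy') /wait (sim_ext xy'); case: l xy => //= i xy.
by rewrite /current xy //= eqxx.
Qed.

Lemma update_current x h i (v : R) j k b : (k < period h j)%N ->
  update x (current h i) v (j, k, b) = x (j, k, b).
Proof.
move=> kp; rewrite /update; case: eqP => // -[ji kp' _].
by move: kp; rewrite kp' ji ltnn.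
Qed.

Lemma age_cons x l h m : age (sim x (l :: h)) m =
  if l == Some m then 0 else age (sim x h) m + rate (sim x h) h m * wait x h l.
Proof. by case: l. Qed.

Lemma par_Some x i h : par (sim x (Some i :: h)) = par (sim x h).
Proof. by []. Qed.

Lemma par_None x h : par (sim x (None :: h)) = F (frame h) (par (sim x h))
  (fun eta => occ (sim x h) eta + wait x h None *+ (eta == sched h)).
Proof. by []. Qed.

Lemma occ_Some x i h eta : occ (sim x (Some i :: h)) eta =
  occ (sim x h) eta + wait x h (Some i) *+ (eta == sched h).
Proof. by []. Qed.

Lemma occ_None x h eta : occ (sim x (None :: h)) eta = 0.
Proof. by []. Qed.

Lemma wait_SomeE x h i :
  wait x h (Some i) = (x (current h i) - age (sim x h) i) / rate (sim x h) h i.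
Proof. by []. Qed.

Lemma wait_NoneE x h :
  wait x h None = frame_length T0 (frame h) - \sum_eta occ (sim x h) eta.
Proof. by []. Qed.

Lemma currentE h i : current h i = (i, period h i, sched h i).
Proof. by []. Qed.

Lemma rateE s h i : rate s h i = if sched h i then 1 else expR (par s i).
Proof. by []. Qed.

Lemma sim_update x h i v : sim (update x (current h i) v) h = sim x h.
Proof. by apply: sim_ext => j k b; exact: update_current. Qed.

Lemma ok_update x h i v : ok (update x (current h i) v) h = ok x h.
Proof. by apply: ok_ext => j k b; exact: update_current. Qed.

Lemma current_inj h : injective (current h).
Proof. by move=> i j []. Qed.

Lemma wait_ext x y h l :
  (forall i k b, (k < period (l :: h) i)%N -> x (i, k, b) = y (i, k, b)) ->
  wait x h l = wait y h l.
Proof.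
move=> xy; have -> : wait x h l = delay (sim y h) x h l.
  rewrite /wait (@sim_ext x y) // => i k b kp; apply: xy.
  by case: l => //= m; case: eqP => // _; exact: leqW.
by case: l xy => //= i xy; rewrite /wait /delay /current xy //= eqxx.
Qed.

Lemma wait_update_Some x h i v :
  wait (update x (current h i) v) h (Some i) =
  (v - age (sim x h) i) / rate (sim x h) h i.
Proof. by rewrite /wait sim_update /delay /update eqxx. Qed.

Lemma wait_update_None x h i v :
  wait (update x (current h i) v) h None = wait x h None.
Proof. by apply: wait_ext => j k b; exact: update_current. Qed.

Lemma wait_update_neq x h i v l : l != Some i ->
  wait (update x (current h i) v) h l = wait x h l.
Proof.
case: l => [m|] mi; last by rewrite wait_update_None.
rewrite /wait sim_update /delay {1}/update (inj_eq (@current_inj h)).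
by have -> : (m == i) = false by apply: contraNF mi => /eqP ->.
Qed.

Lemma ok_bounds x h : ok x h ->
  [/\ forall i, 0 <= age (sim x h) i, forall eta, 0 <= occ (sim x h) eta
    & 0 < wait x h None].
Proof.
elim: h => [_|l h IH /= /and3P[okh t0 tl]].
  by split => //; rewrite /wait /= big1 // subr0.
have [IHa IHo IHw] := IH okh; rewrite /wait /= -/(wait x h l); split.
- move=> m; have am : 0 <= age (sim x h) m + rate (sim x h) h m * wait x h l.
    by rewrite addr_ge0 // mulr_ge0 // ltW // rate_gt0.
  by case: l {t0 tl} am => [i|] am //=; case: (Some i == Some m).
- case: l t0 tl => [i|] t0 tl eta //=; by rewrite addr_ge0 // mulrn_wge0 // ltW.
case: l t0 tl => [i|] t0 /= tl; last first.
  by rewrite /wait /= big1 ?subr0 ?expR_gt0.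
rewrite /wait /= big_split /=.
have -> : \sum_(eta : schedule n) wait x h (Some i) *+ (eta == sched h) = wait x h (Some i).
  rewrite (bigD1 (sched h)) //= eqxx big1 ?addr0 // => eta.
  by move=> /negbTE ->.
by rewrite opprD addrA subr_gt0.
Qed.

Section Measurability.

Hypothesis F_measurable : forall j d (S : measurableType d)
    (r : 'I_n -> S -> R) (o : schedule n -> S -> R),
  (forall i, measurable_fun setT (r i)) ->
  (forall eta, measurable_fun setT (o eta)) ->
  forall i, measurable_fun setT (fun w => F j (fun k => r k w) (fun eta => o eta w) i).

Context d (S : measurableType d) (X : clock n -> S -> R).
Hypothesis X_measurable : forall c, measurable_fun setT (X c).
Let x w : clock n -> R := fun c => X c w.

Let sim_measurable h :
  [/\ forall i, measurable_fun setT (fun w => age (sim (x w) h) i),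
      forall i, measurable_fun setT (fun w => par (sim (x w) h) i),
      forall eta, measurable_fun setT (fun w => occ (sim (x w) h) eta)
    & forall l, measurable_fun setT (fun w => wait (x w) h l)].
Proof.
have rate_m h' : (forall i, measurable_fun setT (fun w => par (sim (x w) h') i)) ->
    forall i, measurable_fun setT (fun w => rate (sim (x w) h') h' i).
  move=> mp i; rewrite /rate /clock_rate; case: (sched h' i) => //.
  exact: measurableT_comp.
have wait_m h' : (forall i, measurable_fun setT (fun w => age (sim (x w) h') i)) ->
    (forall i, measurable_fun setT (fun w => par (sim (x w) h') i)) ->
    (forall eta, measurable_fun setT (fun w => occ (sim (x w) h') eta)) ->
    forall l, measurable_fun setT (fun w => wait (x w) h' l).
  move=> ma mp mo [i|]; rewrite /wait /=.
    apply: measurable_funM; first by apply: measurable_funB; [exact: X_measurable|exact: ma].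
    rewrite /rate /clock_rate; case: (sched h' i); first exact: measurable_cst.
    rewrite (_ : (fun w => _) = (fun w => expR (- par (sim (x w) h') i))); last first.
      by apply/funext => w; rewrite expRN.
    by apply: measurableT_comp => //; exact: measurableT_comp.
  by apply: measurable_funB => //; apply: measurable_sum.
elim: h => [|l h [ma mp mo mw]] /=; first by split => //; apply: wait_m.
have ages m : measurable_fun setT (fun w => if l == Some m then 0
    else age (sim (x w) h) m + rate (sim (x w) h) h m * wait (x w) h l).
  case: (l == Some m) => //; apply: measurable_funD => //.
  by apply: measurable_funM => //; exact: rate_m.
have occs eta : measurable_fun setT
    (fun w => occ (sim (x w) h) eta + wait (x w) h l *+ (eta == sched h)).
  apply: measurable_funD => //; case: (eta == sched h); first exact: mw.
  exact: measurable_cst.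
suff [ma' mp' mo'] :
  [/\ forall i, measurable_fun setT (fun w => age (sim (x w) (l :: h)) i),
      forall i, measurable_fun setT (fun w => par (sim (x w) (l :: h)) i)
    & forall eta, measurable_fun setT (fun w => occ (sim (x w) (l :: h)) eta)].
  by split => //; exact: (@wait_m (l :: h)).
by case: l mw ages occs => [i|] mw ages occs; split => //=; exact: F_measurable.
Qed.

Lemma measurable_age h i : measurable_fun setT (fun w => age (sim (x w) h) i).
Proof. by case: (sim_measurable h). Qed.

Lemma measurable_par h i : measurable_fun setT (fun w => par (sim (x w) h) i).
Proof. by case: (sim_measurable h). Qed.

Lemma measurable_wait h l : measurable_fun setT (fun w => wait (x w) h l).
Proof. by case: (sim_measurable h). Qed.

Lemma measurable_rate h i : measurable_fun setT (fun w => rate (sim (x w) h) h i).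
Proof.
rewrite /rate /clock_rate; case: (sched h i) => //.
by apply: measurableT_comp => //; exact: measurable_par.
Qed.

Lemma measurable_ok h : measurable_fun setT (fun w => ok (x w) h).
Proof.
elim: h => [|l h IH] //=; apply: measurable_and => //; apply: measurable_and.
  by apply: measurable_fun_ltr => //; exact: measurable_wait.
case: (l == None) => //=.
by apply: measurable_fun_ltr; exact: measurable_wait.
Qed.

End Measurability.

End Simulation.
Arguments wait : simpl never.
Arguments sim : simpl never.

(** * The exponential supermartingale of the event counts *)

Section ExponentialIntegrals.
Variable R : realType.
Local Notation mu := (@lebesgue_measure R).

Let is_derive_exp (q a v : R) :
  is_derive v 1 (fun v => expR (- q * (v - a))) (- q * expR (- q * (v - a))).
Proof. by apply: is_derive_eq; rewrite subr0 /GRing.scale /= mulr1 mulrC. Qed.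

Let exp_continuous (q a : R) : continuous (fun v => expR (- q * (v - a))).
Proof.
move=> v; apply/differentiable_continuous/derivable1_diffP.
by have := is_derive_exp q a v; case.
Qed.

Let is_derive_primitive (q a v : R) : q != 0 ->
  is_derive v 1 (fun v => - q^-1 * expR (- q * (v - a))) (expR (- q * (v - a))).
Proof.
move=> q0; apply: is_derive_eq.
by rewrite subr0 /GRing.scale /=; field.
Qed.

Lemma integral_exp_itv (q a b : R) : 0 < q -> a < b ->
  (\int[mu]_(v in `[a, b]) (expR (- q * (v - a)))%:E =
   ((1 - expR (- q * (b - a))) / q)%:E)%E.
Proof.
move=> q0 ab; have q0' : q != 0 by rewrite gt_eqF.
pose G v := - q^-1 * expR (- q * (v - a)).
have dG (v : R) : is_derive v (1 : R) G (expR (- q * (v - a))) by exact: is_derive_primitive.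
have cG : continuous G.
  move=> v; apply/differentiable_continuous/derivable1_diffP.
  by have := dG v; case.
rewrite (@continuous_FTC2 _ _ G) //.
- by rewrite -EFinB /G subrr mulr0 expR0; congr _%:E; field.
- exact/continuous_subspaceT/exp_continuous.
- split.
  + by move=> v _; have := dG v; case.
  + exact: (cvg_at_right_filter (cG a)).
  + exact: (cvg_at_left_filter (cG b)).
- by move=> v _; rewrite derive1E; have := dG v; case.
Qed.

Lemma integral_exp_tail (a : R) :
  (\int[mu]_(v in `[a, +oo[) (expR (- v))%:E = (expR (- a))%:E)%E.
Proof.
have e1 v : expR (- v) = expR (- 1 * (v - 0)) :> R by rewrite subr0 mulN1r.
pose G v : R := - 1^-1 * expR (- 1 * (v - 0)).
have dG (v : R) : is_derive v (1 : R) G (expR (- 1 * (v - 0))).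
  by apply: is_derive_primitive; rewrite oner_eq0.
have cG : continuous G.
  move=> v; apply/differentiable_continuous/derivable1_diffP.
  by have := dG v; case.
have GE : G = fun v => - expR (- v).
  by apply/funext => v; rewrite /G invr1 !mulN1r subr0.
under eq_integral => v _ do rewrite e1.
rewrite (@ge0_continuous_FTC2y _ _ G _ 0) //.
- by rewrite GE -EFinB sub0r opprK.
- exact/continuous_subspaceT/exp_continuous.
- by rewrite GE -oppr0; apply: cvgN; exact: cvgr_expR.
- exact: (cvg_at_right_filter (cG a)).
- by move=> v _; rewrite derive1E; have := dG v; case.
Qed.

Lemma integral_exp_after (a : R) : 0 <= a ->
  (\int[mu]_(v in `[0%R, +oo[) ((a < v)%R%:R * expR (- v))%R%:E = (expR (- a))%:E)%E.
Proof.
move=> a0; rewrite -integral_exp_tail -integral_itv_obnd_cbnd; last first.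
  apply: measurable_funTS; apply/measurable_EFinP.
  by apply: measurableT_comp => //; exact: measurableT_comp.
rewrite [LHS]integral_mkcond [RHS]integral_mkcond; apply: eq_integral => v _.
rewrite !patchE !mem_setE !in_itv /= !andbT.
have [av|va] := ltP a v; first by rewrite (le_trans a0 (ltW av)) mul1r.
by case: ifP => // _; rewrite mul0r.
Qed.

(** In the time variable [t = (v - a) / c] this is [c] times the integral of [expR (- kappa * t)]
    over [0 < t < B]: a clock of age [a] running at rate [c] rings within [B]. *)
Lemma integral_exp_window (a c B kappa : R) : 0 <= a -> 0 < c -> 0 < B -> 0 < kappa ->
  (\int[mu]_(v in `[0%R, +oo[)
     ((0 < (v - a) / c < B)%R%:R * expR (- kappa * ((v - a) / c)))%R%:E =
   (c * ((1 - expR (- kappa * B)) / kappa))%:E)%E.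
Proof.
move=> a0 c0 B0 k0; have q0 : 0 < kappa / c by rewrite divr_gt0.
have ab : a < a + c * B by rewrite ltrDl mulr_gt0.
have -> : c * ((1 - expR (- kappa * B)) / kappa) =
  (1 - expR (- (kappa / c) * (a + c * B - a))) / (kappa / c).
  have -> : - (kappa / c) * (a + c * B - a) = - kappa * B by field; rewrite gt_eqF.
  by field; rewrite !gt_eqF.
rewrite -(integral_exp_itv q0 ab) integral_itv_bndoo; last first.
  by apply: measurable_funTS; apply/measurable_EFinP; exact: continuous_measurable_fun.
rewrite [LHS]integral_mkcond [RHS]integral_mkcond; apply: eq_integral => v _.
rewrite !patchE !mem_setE !in_itv /= !andbT.
have -> : ((v - a) / c < B) = (v < a + c * B).
  by rewrite ltr_pdivrMr // ltrBlDl mulrC.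
rewrite pmulr_lgt0 ?invr_gt0 // subr_gt0.
have [av|va] := ltP a v; last by rewrite mul0r if_same.
rewrite (le_trans a0 (ltW av)) /=; case: ifP => _; rewrite ?mul0r ?mul1r //.
by congr (expR _)%:E; field; rewrite gt_eqF.
Qed.

End ExponentialIntegrals.

Section Weight.
Variables (R : realType) (n : nat) (e : rel 'I_n) (eta0 : schedule n) (T0 : R).
Variable F : nat -> ('I_n -> R) -> (schedule n -> R) -> 'I_n -> R.
Hypothesis T0_gt0 : 0 < T0.
Variables (eta : schedule n) (i0 : 'I_n) (j0 : nat) (theta : R).
Implicit Types (h : history n) (l : option 'I_n) (x : clock n -> R) (i : 'I_n).

Local Notation sched := (sched e eta0).
Local Notation current := (current e eta0).
Local Notation sim := (sim e eta0 T0 F).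
Local Notation wait := (wait e eta0 T0 F).
Local Notation ok := (ok e eta0 T0 F).
Local Notation rate := (rate e eta0).

Definition hit h : bool := (sched h == eta) && (frame h == j0).

Lemma hitE h : hit h = (sched h == eta) && (frame h == j0).
Proof. by []. Qed.

(* [logZ] is [theta] times the number of events of [i0] in the state [eta]
   during the frame [j0], compensated so that its exponential is a martingale. *)
Fixpoint logZ x h : R :=
  if h is l :: h' then
    logZ x h' + (theta *+ (l == Some i0)
       - (expR theta - 1) * rate (sim x h') h' i0 * wait x h' l) *+ hit h'
  else 0.

(** The factor [expR (- age)] is the probability that a clock not yet read exceeds its age. The
    weight is thus the conditional mean of [expR (logZ x h)] on [live x h], and reads only the
    clocks of finished periods. *)
Definition weight x h : R :=
  if ok x h then expR (logZ x h - \sum_i age (sim x h) i) else 0.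

(** Under the exponential change of measure the clock of [i0] runs [expR theta] times faster in the
    state [eta] during the frame [j0]; the compensator in [logZ] is the resulting excess of [total]
    over the sum of the rates. *)
Let tilt h i : R := if hit h && (i == i0) then expR theta else 1.

Let tilt_gt0 h i : 0 < tilt h i.
Proof. by rewrite /tilt; case: ifP => // _; rewrite expR_gt0. Qed.

Let total x h : R := \sum_i rate (sim x h) h i * tilt h i.

Let totalE x h : total x h =
  \sum_i rate (sim x h) h i + ((expR theta - 1) * rate (sim x h) h i0) *+ hit h.
Proof.
rewrite /total (bigD1 i0) //= [in RHS](bigD1 i0) //= {1}/tilt eqxx andbT.
have -> : \sum_(i < n | i != i0) rate (sim x h) h i * tilt h i =
          \sum_(i < n | i != i0) rate (sim x h) h i.
  by apply: eq_bigr => i ii0; rewrite /tilt (negbTE ii0) andbF mulr1.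
by case: (hit h); rewrite ?mulr1n ?mulr0n; ring.
Qed.

Lemma logZ_ext x y h :
  (forall i k b, (k < period h i)%N -> x (i, k, b) = y (i, k, b)) ->
  logZ x h = logZ y h.
Proof.
elim: h => // l h IH xy /=.
have xy' i k b : (k < period h i)%N -> x (i, k, b) = y (i, k, b).
  by move=> kp; apply: xy; case: l => //= m; case: eqP => // _; exact: leqW.
by rewrite (IH xy') (sim_ext e eta0 T0 F xy') (wait_ext e eta0 T0 F xy).
Qed.

Lemma logZ_update x h i v : logZ (update x (current h i) v) h = logZ x h.
Proof. by apply: logZ_ext => j k b; exact: update_current. Qed.

Lemma weight_ge0 x h : 0 <= weight x h.
Proof. by rewrite /weight; case: ifP => // _; rewrite expR_ge0. Qed.

Let weight_None x h : weight x (None :: h) <=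
  weight x h * expR (- total x h * wait x h None).
Proof.
rewrite /weight; under eq_bigr => i _ do rewrite age_cons /=.
rewrite /=; case: (ok x h) => /=; last by rewrite mul0r.
case: ifP => _; last by rewrite mulr_ge0 // expR_ge0.
rewrite -expRD ler_expR totalE.
rewrite big_split /= -mulr_suml.
by case: (hit h); rewrite ?mulr1n ?mulr0n; lra.
Qed.

(** With [D] the delay, [v = age + rate * D]: the ages grow by their rates times [D], and resetting
    the age of [i] removes exactly [v] from the sum, which cancels the density [expR (- v)]. *)
Let weight_Some x h i v : ok x h ->
  weight (update x (current h i) v) (Some i :: h) * expR (- v) =
  weight x h * tilt h i *
  ((0 < (v - age (sim x h) i) / rate (sim x h) h i < wait x h None)%R%:R *
   expR (- total x h * ((v - age (sim x h) i) / rate (sim x h) h i))).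
Proof.
move=> okx; rewrite /weight.
under eq_bigr => m _ do rewrite age_cons sim_update wait_update_Some.
rewrite /= ok_update okx /= logZ_update.
rewrite wait_update_Some wait_update_None sim_update.
set a := age (sim x h) i; set c := rate (sim x h) h i.
set D := (v - a) / c.
case: ifP => _; last by rewrite !(mul0r, mulr0).
rewrite mul1r -!expRD /tilt.
have c0 : c != 0 by rewrite gt_eqF // rate_gt0.
have vE : v = a + c * D by rewrite /D mulrCA divff // mulr1 addrC subrK.
have -> : \sum_(m < n) (if Some i == Some m then 0 else age (sim x h) m + rate (sim x h) h m * D) =
   \sum_m age (sim x h) m + (\sum_m rate (sim x h) h m) * D - v.
  rewrite mulr_suml -big_split /= (bigD1 i) //= eqxx add0r.
  rewrite [in RHS](bigD1 i) //= -/a -/c -vE addrAC subrr add0r.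
  apply: eq_bigr => m mi; case: eqP => // -[im].
  by rewrite im eqxx in mi.
rewrite totalE; case: (hit h) => /=; rewrite ?mulr1n ?mulr0n ?addr0.
  have -> : (Some i == Some i0) = (i == i0) by [].
  by case: eqP => _; rewrite ?mulr1n ?mulr0n ?mulr1 -?expRD; congr expR; ring.
by rewrite mulr1 -expRD; congr expR; ring.
Qed.

Let total_gt0 x h : 0 < total x h.
Proof.
rewrite /total (bigD1 i0) //= ltr_wpDr ?mulr_gt0 ?rate_gt0 //.
by apply: sumr_ge0 => i _; rewrite ltW // mulr_gt0 ?rate_gt0.
Qed.

Local Notation mu := (@lebesgue_measure R).

(** A race of exponential clocks with total rate [total]: the ring of node [i] wins with a share
    proportional to [rate * tilt], the shares add up to [1 - expR (- total * B)] for [B] the time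
    left in the frame, and the end of the frame takes at most the rest. *)
Let weight_step x h :
  ((weight x (None :: h))%:E + \sum_(i < n) \int[mu]_(v in `[0%R, +oo[)
     ((weight (update x (current h i) v) (Some i :: h))%:E * (expR (- v))%:E)
   <= (weight x h)%:E)%E.
Proof.
have [okx|okx] := boolP (ok x h); last first.
  rewrite [X in (X%:E + _)%E]/weight /= (negbTE okx) add0e big1 ?lee_fin ?weight_ge0 //.
  move=> i _; rewrite integral0_eq // => v _.
  by rewrite /weight /= ok_update (negbTE okx) mul0e.
have [a0 _ B0] := ok_bounds T0_gt0 okx.
set p := (1 - expR (- total x h * wait x h None)) / total x h.
have -> : (\sum_(i < n) \int[mu]_(v in `[0%R, +oo[)
     ((weight (update x (current h i) v) (Some i :: h))%:E * (expR (- v))%:E) =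
   \sum_(i < n) (weight x h * tilt h i * (rate (sim x h) h i * p))%:E)%E.
  apply: eq_bigr => i _.
  have c0 : 0 < rate (sim x h) h i by exact: rate_gt0.
  rewrite EFinM -(integral_exp_window (a0 i) c0 B0 (total_gt0 x h)) -ge0_integralZl_EFin //.
  - by apply: eq_integral => v _; rewrite -!EFinM weight_Some.
  - apply: measurable_funTS; apply/measurable_EFinP; apply: measurable_funM.
      apply: (@measurableT_comp _ _ _ _ _ _ (fun b : bool => b%:R : R)) => //.
      apply: measurable_and; apply: measurable_fun_ltr => //.
        by apply: measurable_funM => //; exact: measurable_funB.
      by apply: measurable_funM => //; exact: measurable_funB.
    apply: measurableT_comp => //; apply: measurable_funM => //.
    by apply: measurable_funM => //; exact: measurable_funB.
  - by rewrite mulr_ge0 ?weight_ge0 // ltW.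
rewrite sumEFin -EFinD lee_fin.
have -> : \sum_(i < n) weight x h * tilt h i * (rate (sim x h) h i * p) =
   weight x h * (1 - expR (- total x h * wait x h None)).
  transitivity (weight x h * (p * total x h)); last first.
    by rewrite /p divfK // gt_eqF.
  by rewrite /total !mulr_sumr; apply: eq_bigr => i _; ring.
by rewrite mulrBr mulr1; have := weight_None x h; lra.
Qed.

Section ExpectedWeight.

Hypothesis F_measurable : forall j d (S : measurableType d)
    (r : 'I_n -> S -> R) (o : schedule n -> S -> R),
  (forall i, measurable_fun setT (r i)) ->
  (forall eta, measurable_fun setT (o eta)) ->
  forall i, measurable_fun setT (fun w => F j (fun k => r k w) (fun eta => o eta w) i).

Lemma measurable_logZ d (S : measurableType d) (Y : clock n -> S -> R) h :
  (forall c, measurable_fun setT (Y c)) ->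
  measurable_fun setT (fun w => logZ (fun c => Y c w) h).
Proof.
move=> mY; elim: h => [|l h IH] //=; apply: measurable_funD => //.
case: (hit h); last by rewrite /=; under eq_fun do rewrite mulr0n; exact: measurable_cst.
apply: measurable_funB => //; apply: measurable_funM.
  by apply: measurable_funM => //; exact: measurable_rate.
exact: measurable_wait.
Qed.

Let weight_measurable h : mfunctional (fun x => (weight x h)%:E).
Proof.
move=> d S Y mY; apply/measurable_EFinP; apply: measurable_fun_ifT => //.
  exact: measurable_ok.
apply: measurableT_comp => //; apply: measurable_funB; first exact: measurable_logZ.
by apply: measurable_sum => i; exact: measurable_age.
Qed.

Context d (T : measurableType d) (P : probability T R).
Variable X : clock n -> {RV P >-> R}.
Hypothesis X_indep : forall (J : seq (clock n)) (B : clock n -> set R), uniq J ->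
  (forall b, measurable (B b)) ->
  P (\big[setI/setT]_(b <- J) (X b @^-1` B b)) = (\prod_(b <- J) P (X b @^-1` B b))%E.
Hypothesis X_exp : forall b, exponential_rv 1 (X b).

Let XX w : clock n -> R := fun c => X c w.

Let expected_step h :
  (\int[P]_w (weight (XX w) (None :: h))%:E +
   \sum_(i < n) \int[P]_w (weight (XX w) (Some i :: h))%:E
   <= \int[P]_w (weight (XX w) h)%:E)%E.
Proof.
have mw h' : measurable_fun setT (fun w => (weight (XX w) h')%:E).
  by apply: weight_measurable.
have w0 h' x : (0 <= (weight x h')%:E)%E by rewrite lee_fin weight_ge0.
pose J i w := (\int[mu]_(v in `[0%R, +oo[)
     ((weight (update (XX w) (current h i) v) (Some i :: h))%:E * (expR (- v))%:E))%E.
have mr i : measurable_fun setT (J i).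
  exact: (measurable_resample X (current h i) (weight_measurable (Some i :: h)) (w0 _)).
have r0 i w : (0 <= J i w)%E.
  by apply: integral_ge0 => v _; rewrite mule_ge0 // lee_fin expR_ge0.
have -> : (\sum_(i < n) \int[P]_w (weight (XX w) (Some i :: h))%:E =
    \int[P]_w \sum_(i < n) J i w)%E.
  rewrite ge0_integral_sum //; apply: eq_bigr => i _.
  exact: (resample X_indep X_exp (current h i) (weight_measurable (Some i :: h)) (w0 _)).
rewrite -ge0_integralD //.
- apply: ge0_le_integral => //.
  + by move=> w _; rewrite adde_ge0 // sume_ge0.
  + by apply: emeasurable_funD => //; apply: emeasurable_sum => i _; exact: mr.

- by move=> w _; rewrite sume_ge0.
- by apply: emeasurable_sum => i _; exact: mr.
Qed.

Let events : seq (option 'I_n) := None :: [seq Some i | i <- enum 'I_n].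

Fixpoint histories (m : nat) : seq (history n) :=
  if m is m'.+1 then [seq l :: h | h <- histories m', l <- events] else [:: [::]].

Lemma mem_histories h : h \in histories (size h).
Proof.
elim: h => [|l h IH]; first by rewrite mem_seq1.
apply: (allpairs_f (fun h l => l :: h)) => //; case: l => [i|]; last exact: mem_head.
by rewrite inE; apply/orP; right; apply: map_f; rewrite mem_enum.
Qed.

Lemma expected_weight m :
  (\sum_(h <- histories m) \int[P]_w (weight (XX w) h)%:E <= 1)%E.
Proof.
elim: m => [|m IH].
  rewrite big_seq1 /weight /= big1 // subr0 expR0 integral_cst // mul1e.
  exact: probability_le1.
rewrite -[histories m.+1]/[seq l :: h | h <- histories m, l <- events].
apply: le_trans IH; rewrite big_allpairs_dep /=; apply: lee_sum => h _.
by rewrite /events big_cons big_map big_enum; exact: expected_step.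
Qed.

(** Interpolates between [live], when [s] contains all nodes, and [weight], when [s] is empty. *)
Let partial_live (s : seq 'I_n) x h : R :=
  (ok x h)%:R * expR (logZ x h) *
  \prod_i (if i \in s then (age (sim x h) i < x (current h i))%R%:R
           else expR (- age (sim x h) i)).

Let partial_live_ge0 s x h : 0 <= partial_live s x h.
Proof.
rewrite mulr_ge0 ?mulr_ge0 ?expR_ge0 //; apply: prodr_ge0 => i _.
by case: ifP => // _; rewrite expR_ge0.
Qed.

Let partial_live_measurable s h : mfunctional (fun x => (partial_live s x h)%:E).
Proof.
have mb d' (S : measurableType d') (b : S -> bool) : measurable_fun setT b ->
    measurable_fun setT (fun w => (b w)%:R : R).
  by move=> mb; exact: (@measurableT_comp _ _ _ _ _ _ (fun b : bool => b%:R : R)).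
move=> d' S Y mY; apply/measurable_EFinP; apply: measurable_funM.
  apply: measurable_funM; first by apply: mb; exact: measurable_ok.
  by apply: measurableT_comp => //; exact: measurable_logZ.
apply: measurable_prod => i _; case: (i \in s).
  by apply: mb; apply: measurable_fun_ltr => //; exact: measurable_age.
by apply: measurableT_comp => //; apply: measurableT_comp => //; exact: measurable_age.
Qed.

(* The conditional probability that a clock has not rung at age [a] is [exp (- a)]. *)
Let peel s i h : i \notin s ->
  (\int[P]_w (partial_live (i :: s) (XX w) h)%:E =
   \int[P]_w (partial_live s (XX w) h)%:E)%E.
Proof.
move=> si; rewrite (resample X_indep X_exp (current h i)
  (partial_live_measurable (i :: s) h)); last by move=> x; rewrite lee_fin.
apply: eq_integral => w _.
set x := fun b => X b w; pose q := (ok x h)%:R * expR (logZ x h) *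
  \prod_(k < n | k != i) (if k \in s then (age (sim x h) k < x (current h k))%R%:R
           else expR (- age (sim x h) k)).
have qs : partial_live s x h = q * expR (- age (sim x h) i).
  by rewrite /partial_live (bigD1 i) //= (negbTE si) /q; ring.
have [okx|okx] := boolP (ok x h); last first.
  rewrite /partial_live (negbTE okx) !mul0r integral0_eq // => v _.
  by rewrite ok_update (negbTE okx) !mul0r mul0e.
have [a0 _ _] := ok_bounds T0_gt0 okx.
have q0 : 0 <= q.
  rewrite mulr_ge0 ?mulr_ge0 ?expR_ge0 //; apply: prodr_ge0 => k _.
  by case: ifP => // _; rewrite expR_ge0.
rewrite -[XX w]/x qs EFinM -integral_exp_after // -ge0_integralZl_EFin //; last first.
  apply: measurable_funTS; apply/measurable_EFinP; apply: measurable_funM.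
    apply: (@measurableT_comp _ _ _ _ _ _ (fun b : bool => b%:R : R)) => //.
    exact: measurable_fun_ltr.
  by apply: measurableT_comp => //; exact: measurableT_comp.
apply: eq_integral => v _; rewrite -!EFinM; congr _%:E.
rewrite /partial_live ok_update sim_update logZ_update (bigD1 i) //= mem_head.
have -> : update x (current h i) v (current h i) = v by rewrite /update eqxx.
rewrite /q.
have -> : \prod_(k < n | k != i)
    (if k \in i :: s then (age (sim x h) k < update x (current h i) v (current h k))%R%:R
     else expR (- age (sim x h) k)) =
  \prod_(k < n | k != i) (if k \in s then (age (sim x h) k < x (current h k))%R%:R
           else expR (- age (sim x h) k)).
  apply: eq_bigr => k ki; rewrite inE (negbTE ki) /= /update.
  by rewrite (inj_eq (@current_inj _ e eta0 h)) (negbTE ki).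
ring.
Qed.

Lemma live_weight h :
  (\int[P]_w ((live e eta0 T0 F (XX w) h)%:R * expR (logZ (XX w) h))%:E =
   \int[P]_w (weight (XX w) h)%:E)%E.
Proof.
transitivity (\int[P]_w (partial_live (enum 'I_n) (XX w) h)%:E)%E.
  apply: eq_integral => w _; congr _%:E; rewrite /partial_live /live.
  case: (ok (XX w) h); rewrite ?mul0r //= mul1r.
  have [/forallP al|/forallPn[i ai]] :=
      boolP [forall i, age (sim (XX w) h) i < XX w (current h i)].
    by rewrite big1 ?mulr1 ?mul1r // => i _; rewrite mem_enum al.
  by rewrite mul0r (bigD1 i) //= mem_enum (negbTE ai) mul0r mulr0.
transitivity (\int[P]_w (partial_live [::] (XX w) h)%:E)%E.
  have: uniq (enum 'I_n) by exact: enum_uniq.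
  elim: (enum 'I_n) => //= i s IH /andP[si us].
  by rewrite peel // IH.
apply: eq_integral => w _; congr _%:E; rewrite /partial_live /weight /=.
case: (ok (XX w) h); rewrite ?mul0r // mul1r expRD -sumrN expR_sum.
by congr (_ * _).
Qed.

End ExpectedWeight.

End Weight.

(** * Almost sure properties of the histories *)

Section AlmostEverywhere.
Context d (T : measurableType d) (R : realType) (mu : {measure set T -> \bar R}).

Lemma ae_countable (I : countType) (Q : I -> T -> Prop) :
  (forall i, {ae mu, forall w, Q i w}) -> {ae mu, forall w, forall i, Q i w}.
Proof.
move=> H; have : {ae mu, forall w, forall k : nat,
    if unpickle k is Some i then Q i w else True}.
  by apply: ae_foralln => k; case: (unpickle k) => [i|]; [exact: H|exact: aeW].
by apply: filterS => w Hw i; have := Hw (pickle i); rewrite pickleK.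
Qed.

End AlmostEverywhere.

Section Histories.
Variables (R : realType) (n : nat) (e : rel 'I_n) (eta0 : schedule n) (T0 : R).
Variable F : nat -> ('I_n -> R) -> (schedule n -> R) -> 'I_n -> R.
Hypothesis T0_gt0 : 0 < T0.
Hypothesis F_measurable : forall j d (S : measurableType d)
    (r : 'I_n -> S -> R) (o : schedule n -> S -> R),
  (forall i, measurable_fun setT (r i)) ->
  (forall eta, measurable_fun setT (o eta)) ->
  forall i, measurable_fun setT (fun w => F j (fun k => r k w) (fun eta => o eta w) i).
Implicit Types (h : history n) (l : option 'I_n) (x : clock n -> R) (i : 'I_n).

Local Notation mu := (@lebesgue_measure R).
Local Notation wait := (wait e eta0 T0 F).
Local Notation ok := (ok e eta0 T0 F).
Local Notation live := (live e eta0 T0 F).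
Local Notation current := (current e eta0).

Context d (T : measurableType d) (P : probability T R).
Variable X : clock n -> {RV P >-> R}.
Hypothesis X_indep : forall (J : seq (clock n)) (B : clock n -> set R), uniq J ->
  (forall b, measurable (B b)) ->
  P (\big[setI/setT]_(b <- J) (X b @^-1` B b)) = (\prod_(b <- J) P (X b @^-1` B b))%E.
Hypothesis X_exp : forall b, exponential_rv 1 (X b).

Let XX w : clock n -> R := fun c => X c w.

Let clock_gt0 c : {ae P, forall w, 0 < X c w}.
Proof.
exists (X c @^-1` `]-oo, 0%R]); split.
- exact: measurable_funPTI.
- have := X_exp c; rewrite /exponential_rv => /(_ `]-oo, 0%R]%classic) /=.
  rewrite /distribution /pushforward => ->; last exact: measurable_itv.
  rewrite /exponential_prob -integral_itv_bndo_bndc; last first.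
    by apply: measurable_funTS; apply/measurable_EFinP; exact: measurable_exponential_pdf.
  rewrite integral0_eq // => v /=; rewrite in_itv /= => v0.
  by rewrite lt0_exponential_pdf.
- by move=> w /= /negP; rewrite -leNgt in_itv.
Qed.

Let tie h i l w := ok (XX w) h && (wait (XX w) h (Some i) == wait (XX w) h l).

(** When all other clocks are fixed, a single value [v0] of the current clock of [i] produces the
    tie, and a point is null for the exponential law. *)
Let no_tie h i l : l != Some i -> {ae P, forall w, ~~ tie h i l w}.
Proof.
move=> li; pose G x : \bar R := ((ok x h && (wait x h (Some i) == wait x h l))%:R : R)%:E.
have mb d' (S : measurableType d') (Y : clock n -> S -> R) :
    (forall c, measurable_fun setT (Y c)) -> measurable_fun setT (fun w =>
      ok (fun c => Y c w) h && (wait (fun c => Y c w) h (Some i) == wait (fun c => Y c w) h l)).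
  move=> mY; apply: measurable_and; first exact: measurable_ok.
  by apply: measurable_fun_eqr; exact: measurable_wait.
have mG : mfunctional G.
  move=> d' S Y mY; apply/measurable_EFinP.
  apply: (@measurableT_comp _ _ _ _ _ _ (fun b : bool => b%:R : R)) => //.
  exact: mb.
have G0 x : (0 <= G x)%E by rewrite lee_fin.
have mt : measurable [set w | tie h i l w].
  have := mb _ T (fun c => X c : T -> R) (fun c => measurable_funP (X c)).
  by move/(_ measurableT [set true]); rewrite setTI; exact.
exists [set w | tie h i l w]; split => //; last by move=> w /= /negP; rewrite negbK.
rewrite -[X in P X]setIT -integral_indic //.
transitivity (\int[P]_w G (XX w))%E.
  apply: eq_integral => w _; rewrite indicE /G /XX; congr (_%:R)%:E.
  congr nat_of_bool.
  by apply/idP/idP => [/set_mem//|t]; exact/mem_set.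
rewrite (resample X_indep X_exp (current h i) mG G0) integral0_eq // => w _.
set x := fun b => X b w.
pose v0 := age (sim e eta0 T0 F x h) i + rate e eta0 (sim e eta0 T0 F x h) h i * wait x h l.
have c0 := rate_gt0 e eta0 (sim e eta0 T0 F x h) h i.
have GE v : (G (update x (current h i) v) * (expR (- v))%:E =
    ((ok x h)%:R * expR (- v0))%:E * (\1_[set v0] v)%:E)%E.
  rewrite /G ok_update wait_update_Some wait_update_neq // -!EFinM indicE.
  have -> : ((v - age (sim e eta0 T0 F x h) i) / rate e eta0 (sim e eta0 T0 F x h) h i ==
     wait x h l) = (v == v0).
    rewrite /v0; apply/eqP/eqP => [<-|->].
      by rewrite [_ * (_ / _)]mulrC divfK ?gt_eqF // addrC subrK.
    by rewrite addrAC subrr add0r mulrAC divff ?gt_eqF // mul1r.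
  have -> : (v \in [set v0]) = (v == v0) by apply/idP/eqP; rewrite inE.
  case: eqP => [->|_]; last by rewrite andbF mulr0 mul0r.
  by rewrite andbT mulr1.
under eq_integral => v _ do rewrite GE.
rewrite ge0_integralZl_EFin ?mulr_ge0 ?expR_ge0 //; last first.
  by apply/measurable_EFinP; exact: measurable_indic.
rewrite integral_indic // (@subset_measure0 _ _ _ mu _ [set v0]) ?mule0 //.
- exact: measurableI.
- exact: lebesgue_measure_set1.
Qed.

Lemma extendable_ae : {ae P, forall w, (forall c, 0 < X c w) /\
  forall h i l, ok (XX w) h -> l != Some i ->
    wait (XX w) h (Some i) != wait (XX w) h l}.
Proof.
have H1 := ae_countable clock_gt0.
have H2 : {ae P, forall w, forall z : history n * 'I_n * option 'I_n,
    z.2 != Some z.1.2 -> ~~ tie z.1.1 z.1.2 z.2 w}.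
  apply: ae_countable => -[[h i] l] /=; have [li|li] := boolP (l != Some i).
    by apply: filterS (no_tie h li).
  exact: aeW.
apply: filterS2 H1 H2 => w H1 H2; split => // h i l okh li.
by have := H2 (h, i, l) li; rewrite /tie /= okh.
Qed.

Section Deviation.
Variables (eta : schedule n) (i0 : 'I_n) (j0 : nat) (theta L : R).
Hypothesis L_gt0 : 0 < L.

Local Notation logZ := (logZ e eta0 T0 F eta i0 j0 theta).

Let large h w : bool := live (XX w) h && (L <= expR (logZ (XX w) h)).

Let bad m : set T := \big[setU/set0]_(h <- histories n m) [set w | large h w].

Let live_measurable h : measurable_fun setT (fun w => live (XX w) h).
Proof.
have mX c : measurable_fun setT (X c : T -> R) by exact: measurable_funP.
apply: measurable_and; first exact: measurable_ok.
have -> : (fun w => [forall i, age (sim e eta0 T0 F (XX w) h) i < XX w (current h i)]) =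
    (fun w => \big[andb/true]_i (age (sim e eta0 T0 F (XX w) h) i < XX w (current h i))).
    by apply/funext => w; rewrite big_andE.
elim: (index_enum _) => [|i s IH]; first by under eq_fun do rewrite big_nil; exact: measurable_cst.
under eq_fun do rewrite big_cons; apply: measurable_and => //.
by apply: measurable_fun_ltr; [exact: measurable_age|exact: mX].
Qed.

Let large_measurable h : measurable [set w | large h w].
Proof.
have mX c : measurable_fun setT (X c : T -> R) by exact: measurable_funP.
have mlarge : measurable_fun setT (large h).
  apply: measurable_and; first exact: live_measurable.
  apply: measurable_fun_ler => //.
  by apply: measurableT_comp => //; exact: measurable_logZ.
by have := mlarge measurableT [set true]; rewrite setTI; exact.
Qed.

(** Markov's inequality: [L] times the indicator of [bad m] is at most the sum over the histories of
    length [m] of [expR logZ] on [live], whose mean is at most 1. *)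
Let bad_le m : (P (bad m) <= (L^-1)%:E)%E.
Proof.
have mb : measurable (bad m) by apply: bigsetU_measurable => h _; exact: large_measurable.
have mX c : measurable_fun setT (X c : T -> R) by exact: measurable_funP.
have L0 : (0 < L%:E)%E by rewrite lte_fin.
rewrite -(lee_pmul2l _ L0) ?fin_num_fun // -EFinM divff ?gt_eqF //.
have EW := expected_weight e eta0 T0_gt0 eta i0 j0 theta F_measurable X_indep X_exp m.
apply: le_trans EW.
under [leRHS]eq_bigr => h _ do rewrite -(live_weight e eta0 T0_gt0 eta i0 j0 theta F_measurable X_indep X_exp).
rewrite -ge0_integral_sum //; last first.
  move=> h; apply/measurable_EFinP; apply: measurable_funM; last first.
    by apply: measurableT_comp => //; exact: measurable_logZ.
  by apply: (@measurableT_comp _ _ _ _ _ _ (fun b : bool => b%:R : R)).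
rewrite -(setIT (bad m)) -integral_indic // -ge0_integralZl_EFin //; last 2 first.
- by apply/measurable_EFinP; exact: measurable_indic.
- exact: ltW.
have t0 h w : (0 <= ((live (XX w) h)%:R * expR (logZ (XX w) h))%:E)%E.
  by rewrite lee_fin mulr_ge0 ?expR_ge0.
apply: ge0_le_integral => //.
- by move=> w _; rewrite mule_ge0 // lee_fin ltW.
- apply: emeasurable_funM => //; apply/measurable_EFinP; exact: measurable_indic.
- apply: emeasurable_sum => h; apply/measurable_EFinP; apply: measurable_funM; last first.
    by apply: measurableT_comp => //; exact: measurable_logZ.
  by apply: (@measurableT_comp _ _ _ _ _ _ (fun b : bool => b%:R : R)).
move=> w _; rewrite indicE.
have [|_] := boolP (w \in bad m); last by rewrite mule0 sume_ge0.
rewrite inE mule1 /bad; elim: (histories n m) => [|h s IH]; first by rewrite big_nil.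
rewrite !big_cons => -[/= /andP[lh Lh]|/IH H].
  by rewrite (le_trans _ (leeDl _ _)) ?sume_ge0 // lh mul1r lee_fin.
by rewrite (le_trans H) // leeDr.
Qed.

(* If the weight is still large after every sufficiently long history, then it
   was large at the end of the frame, after which it is constant. *)
Lemma deviation_bound : exists2 B : set T, measurable B /\ (P B <= (L^-1)%:E)%E &
  forall w, (exists m0, forall m, (m0 <= m)%N -> exists h,
     [/\ size h = m, live (XX w) h & L <= expR (logZ (XX w) h)]) -> B w.
Proof.
(* The event is the lower limit of the sets [bad m], an increasing union of sets of probability at
   most [1/L]. *)
pose C m0 := \bigcap_(m in [set m | (m0 <= m)%N]) bad m.
have mbad m : measurable (bad m) by apply: bigsetU_measurable => h _; exact: large_measurable.
have mC m0 : measurable (C m0) by apply: bigcap_measurable => //; exists m0 => /=.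
have mB : measurable (\bigcup_m0 C m0) by exact: bigcupT_measurable.
exists (\bigcup_m0 C m0); first split => //.
  have CC : nondecreasing_seq C.
    move=> a b ab; apply/subsetPset => w Cw m /= bm; apply: Cw => /=.
    exact: leq_trans bm.
  have cvgC := nondecreasing_cvg_mu (mu := P) mC mB CC.
  rewrite -(cvg_lim _ cvgC) //; apply: lime_le; first by apply/cvg_ex; exists (P (\bigcup_m0 C m0)).
  apply: nearW => m0 /=; apply: le_trans (bad_le m0).
  by apply: le_measure; rewrite ?inE // => w Cw; apply: Cw => /=.
move=> w [m0 H]; exists m0 => // m /= /H[h [hm lh Lh]].
rewrite /bad; have : h \in histories n m by rewrite -hm mem_histories.
elim: (histories n m) => // k s IH; rewrite inE big_cons => /predU1P[<-|hs].
  by left; rewrite /= /large lh.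
by right; exact: IH.
Qed.

End Deviation.

End Histories.

(** * Integrals of step functions on the half line *)

Section TameFunctions.
Variable R : realType.
Local Notation mu := (@lebesgue_measure R).
Implicit Types f g : R -> R.

(** Local boundedness and measurability give integrability on every bounded interval of the half
    line, and both are stable under linear combinations. *)
Definition tame f : Prop :=
  measurable_fun (`[0, +oo[ : set R) f /\
  forall b, exists M, forall u, 0 <= u <= b -> `|f u| <= M.

Lemma tame_integrable f (a b : R) (l r : bool) : tame f -> 0 <= a ->
  mu.-integrable [set` Interval (BSide l a) (BSide r b)] (EFin \o f).
Proof.
move=> [mf bf] a0; have [M fM] := bf b.
have sub : [set` Interval (BSide l a) (BSide r b)] `<=` `[a, b]%classic.
  move=> u /=; rewrite !in_itv /= => /andP[h1 h2]; apply/andP; split.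
    by move: h1; case: l => //; exact: ltW.
  by move: h2; case: r => //; exact: ltW.
apply: measurable_bounded_integrable => //.
- have ab : (mu `[a, b]%classic < +oo)%E.
    by rewrite lebesgue_measure_itv /=; case: ifP => _; rewrite ?ltry.
  by apply: le_lt_trans ab; apply: le_measure => //; rewrite inE; exact: measurable_itv.
- apply: measurable_funS mf => //; apply: subset_trans sub _ => u /=.
  by rewrite !in_itv /= andbT => /andP[au _]; exact: le_trans au.
- exists M; split; first exact: num_real.
  move=> y My u /sub /=; rewrite in_itv /= => /andP[au ub].
  by rewrite (le_trans _ (ltW My)) // fM // ub andbT (le_trans a0).
Qed.

Lemma tame_split f (a b c : R) : tame f -> 0 <= a -> a <= b -> b <= c ->
  \int[mu]_(u in `[a, c]) f u =
  \int[mu]_(u in `[a, b]) f u + \int[mu]_(u in `[b, c]) f u.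
Proof.
move=> tf a0 ab bc.
have -> : `[a, c]%classic = `[a, b]%classic `|` `]b, c]%classic.
  by rewrite (@itv_bndbnd_setU _ _ _ (BRight b)) // bnd_simp.
have b0 := le_trans a0 ab.
rewrite Rintegral_setU //.
- by congr (_ + _); apply: Rintegral_itv_obnd_cbnd; exact: tame_integrable.
- have -> : `[a, b]%classic `|` `]b, c]%classic = `[a, c]%classic.
    by rewrite [RHS](@itv_bndbnd_setU _ _ _ (BRight b)) // bnd_simp.
  exact: tame_integrable.
- rewrite disj_set2E; apply/eqP; rewrite -subset0 => u [/=].
  by rewrite !in_itv /= => /andP[_ ub] /andP[bu _]; move: ub; rewrite leNgt bu.
Qed.

Lemma tame_const f (a b c : R) : tame f -> 0 <= a -> a <= b ->
  (forall u, a <= u < b -> f u = c) ->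
  \int[mu]_(u in `[a, b]) f u = c * (b - a).
Proof.
move=> tf a0 ab fc; rewrite -Rintegral_itv_bndo_bndc; last exact: tame_integrable.
rewrite (@eq_Rintegral _ _ _ mu `[a, b[%classic (fun=> c) f); last first.
  by move=> u; rewrite inE /= in_itv /=; exact: fc.
transitivity (c * fine (mu (`[a, b[%classic : set R))); first exact: Rintegral_cst.
rewrite lebesgue_measure_itv /= lte_fin.
case: ltP => [//|ba]; suff -> : b = a by rewrite subrr.
by apply/eqP; rewrite eq_le ba.
Qed.

Lemma tame_ge0 f (a b : R) : (forall u, 0 <= f u) ->
  0 <= \int[mu]_(u in `[a, b]) f u.
Proof. by move=> f0; apply: Rintegral_ge0. Qed.

Section StepFunctions.
Variable s : nat -> R.
Hypotheses (s0 : s 0%N = 0) (s_mono : nondecreasing_seq s).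
Hypothesis s_cvg : s k @[k --> \oo] --> +oo.

Lemma step_ex (u : R) : 0 <= u -> exists k, s k <= u < s k.+1.
Proof.
move=> u0; have [K _ HK] : \forall k \near \oo, u < s k.
  by move/cvgryPgt: s_cvg => /(_ u).
have : exists k, u < s k by exists K; apply: HK => /=.
move=> ex; have := ex_minnP ex; case=> -[|k] uk kmin.
  by move: uk; rewrite s0 ltNge u0.
exists k; rewrite uk andbT leNgt; apply/negP => /kmin.
by rewrite ltnn.
Qed.

Lemma step_measurable d (T : measurableType d) (f : R -> T) :
  (forall k u, s k <= u < s k.+1 -> f u = f (s k)) ->
  measurable_fun (`[0, +oo[ : set R) f.
Proof.
move=> fs _ Y mY.
have -> : `[0, +oo[%classic `&` f @^-1` Y =
    \bigcup_(k in [set k | Y (f (s k))]) `[s k, s k.+1[%classic.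
  apply/seteqP; split => u /=.
    rewrite in_itv /= andbT => -[u0 Yfu]; have [k sk] := step_ex u0.
    by exists k; rewrite /= ?in_itv // -(fs k u sk).
  case=> k /= Yk; rewrite in_itv /= => sk; rewrite in_itv /= andbT (fs k u sk).
  split => //; case/andP: sk => sk _; apply: le_trans sk.
  by rewrite -s0; exact: s_mono.
by apply: bigcup_measurable => k _; exact: measurable_itv.
Qed.

Lemma step_uniq (u : R) j k : s j <= u < s j.+1 -> s k <= u < s k.+1 -> j = k.
Proof.
move=> /andP[j1 j2] /andP[k1 k2]; apply/eqP; rewrite eqn_leq; apply/andP; split.
  by rewrite leqNgt; apply/negP => kj; have := s_mono kj; rewrite leNgt (le_lt_trans j1).
by rewrite leqNgt; apply/negP => jk; have := s_mono jk; rewrite leNgt (le_lt_trans k1).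
Qed.

Lemma step_bounded (f : R -> R) :
  (forall k u, s k <= u < s k.+1 -> f u = f (s k)) ->
  forall b, exists M, forall u, 0 <= u <= b -> `|f u| <= M.
Proof.
move=> fs b; have [K _ HK] : \forall k \near \oo, b < s k.
  by move/cvgryPgt: s_cvg => /(_ b).
exists (\sum_(k < K) `|f (s k)|) => u /andP[u0 ub].
have [k sk] := step_ex u0.
have kK : (k < K)%N.
  rewrite ltnNge; apply/negP => /s_mono Kk; have := HK K (leqnn K).
  by case/andP: sk => sk _; rewrite ltNge (le_trans Kk) // (le_trans sk).
rewrite (fs k u sk) (bigD1 (Ordinal kK)) //= lerDl.
exact: sumr_ge0.
Qed.

End StepFunctions.

End TameFunctions.

Section Frames.
Variables (R : realType) (T0 : R).
Hypothesis T0_gt0 : 0 < T0.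
Local Notation update_time := (update_time T0).

Lemma update_time0 : update_time 0 = 0.
Proof. by rewrite /Defs.update_time big_ord0. Qed.

Lemma update_timeS j : update_time j.+1 = update_time j + frame_length T0 j.
Proof. by rewrite /Defs.update_time big_ord_recr. Qed.

Lemma update_time_mono : nondecreasing_seq update_time.
Proof.
apply/nondecreasing_seqP => j.
by rewrite update_timeS lerDl ltW // frame_length_gt0.
Qed.

Lemma frame_length_ge1 j : 1 <= frame_length T0 j.+1.
Proof. by rewrite /= -expR0 ler_expR sqrtr_ge0. Qed.

Lemma update_time_ge j : j%:R <= update_time j.+1.
Proof.
elim: j => [|j IH]; first by rewrite update_timeS update_time0 add0r ltW // frame_length_gt0.
by rewrite update_timeS -natr1 lerD // frame_length_ge1.
Qed.

Lemma update_time_cvg : update_time j @[j --> \oo] --> +oo.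
Proof.
apply/cvgryPge => A; exists (Num.bound `|A|).+1 => // -[//|j] /= Aj.
apply: le_trans (update_time_ge j); apply: le_trans (ler_norm A) _.
apply/ltW; apply: lt_le_trans (archi_boundP (normr_ge0 A)) _.
by rewrite ler_nat.
Qed.

Lemma frame_ofP (u : R) j : update_time j <= u < update_time j.+1 ->
  frame_of T0 u = j.
Proof.
move=> uj; rewrite /frame_of; case: xgetP => [k _ /= uk|/(_ j)//].
exact: (step_uniq update_time_mono uk uj).
Qed.

Lemma frame_of_tame (g : nat -> R) : tame (fun u => g (frame_of T0 u)).
Proof.
have fs k u : update_time k <= u < update_time k.+1 ->
    g (frame_of T0 u) = g (frame_of T0 (update_time k)).
  move=> uk; rewrite (frame_ofP uk) (@frame_ofP (update_time k) k) //.
  by rewrite lexx update_timeS ltrDl frame_length_gt0.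
split.
  by apply: step_measurable fs; [exact: update_time0|exact: update_time_mono|exact: update_time_cvg].
by apply: step_bounded fs; [exact: update_time0|exact: update_time_mono|exact: update_time_cvg].
Qed.

End Frames.

(** * Sample paths follow histories *)

Section Path.
Variables (R : realType) (n : nat) (e : rel 'I_n) (T0 : R).
Hypotheses (e_sym : symmetric e) (e_irr : irreflexive e) (T0_gt0 : 0 < T0).
Local Notation mu := (@lebesgue_measure R).
Variable F : nat -> ('I_n -> R) -> (schedule n -> R) -> 'I_n -> R.
Variables (x : clock n -> R) (tau : 'I_n -> nat -> R) (sigma : R -> schedule n).
Variable r : nat -> 'I_n -> R.

Local Notation update_time := (update_time T0).
Local Notation sched := (sched e (sigma 0)).
Local Notation current := (current e (sigma 0)).
Local Notation rate := (rate e (sigma 0)).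
Local Notation sim := (sim e (sigma 0) T0 F).
Local Notation wait := (wait e (sigma 0) T0 F).
Local Notation ok := (ok e (sigma 0) T0 F).
Local Notation live := (live e (sigma 0) T0 F).

Definition time_in (eta : schedule n) (a b : R) : R :=
  \int[mu]_(u in `[a, b]) (sigma u == eta)%:R.

Hypothesis path : csma_path e (fun i t => r (frame_of T0 t) i)
  (fun i k => x (i, k, false)) (fun i k => x (i, k, true)) tau sigma.
Hypothesis r0 : r 0%N = fun=> 0.
Hypothesis rS : forall j,
  r j.+1 = F j (r j) (fun eta => time_in eta (update_time j) (update_time j.+1)).
Hypothesis x_gt0 : forall c, 0 < x c.
Hypothesis no_tie : forall h i l, ok x h -> l != Some i ->
  wait x h (Some i) != wait x h l.

Let tau0 i : tau i 0%N = 0. Proof. by case: (path.2 i). Qed.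

Let tau_mono i : nondecreasing_seq (tau i). Proof. by case: (path.2 i). Qed.

Let tau_cvg i : tau i k @[k --> \oo] --> +oo. Proof. by case: (path.2 i). Qed.

Let tau_const i k t : tau i k <= t < tau i k.+1 -> sigma t i = sigma (tau i k) i.
Proof. by case: (path.2 i) => _ _ _ H _; exact: H. Qed.

Let tau_transmit i k : sigma (tau i k) i ->
  tau i k.+1 = tau i k + x (i, k, true) /\ sigma (tau i k.+1) i = false.
Proof. by case: (path.2 i) => _ _ _ _ /(_ k); case: ifP. Qed.

Let tau_waiting i k : ~~ sigma (tau i k) i ->
  \int[mu]_(u in `[tau i k, tau i k.+1]) expR (r (frame_of T0 u) i) = x (i, k, false) /\
  sigma (tau i k.+1) i = [forall j, e i j ==> ~~ sigma (tau i k.+1) j].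
Proof. by case: (path.2 i) => _ _ _ _ /(_ k); case: ifP. Qed.

Let tau_ge0 i k : 0 <= tau i k.
Proof. by rewrite -(tau0 i); exact: tau_mono. Qed.

Lemma measurable_node i : measurable_fun (`[0, +oo[ : set R) (fun u => sigma u i).
Proof.
apply: (step_measurable (tau0 i) (@tau_mono i) (@tau_cvg i)) => k u.
exact: tau_const.
Qed.

Lemma tame_bool (b : R -> bool) : measurable_fun (`[0, +oo[ : set R) b ->
  tame (fun u => (b u)%:R : R).
Proof.
move=> mb; split.
  exact: (@measurableT_comp _ _ _ _ _ _ (fun b : bool => b%:R : R)).
by move=> M; exists 1 => u _; case: (b u); rewrite ?normr1 ?normr0.
Qed.

Lemma tame_service i : tame (fun u => (sigma u i)%:R : R).
Proof. by apply: tame_bool; exact: measurable_node. Qed.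

Lemma tame_state eta : tame (fun u => (sigma u == eta)%:R : R).
Proof.
apply: tame_bool.
have -> : (fun u => sigma u == eta) = (fun u => \big[andb/true]_i (sigma u i == eta i)).
  apply/funext => u; rewrite big_andE; apply/eqP/forallP => [-> i|H]; first by rewrite eqxx.
  by apply/ffunP => i; exact/eqP/H.
elim: (index_enum _) => [|i s IH].
  have -> : (fun u => \big[andb/true]_(i <- [::]) (sigma u i == eta i)) = cst true.
    by apply/funext => u; rewrite big_nil.
  exact: measurable_cst.
have -> : (fun u => \big[andb/true]_(j <- i :: s) (sigma u j == eta j)) =
    (fun u => (sigma u i == eta i) && \big[andb/true]_(j <- s) (sigma u j == eta j)).
  by apply/funext => u; rewrite big_cons.
apply: measurable_and => //.
have mi := measurable_node i.
have -> : (fun u => sigma u i == eta i) = if eta i then (fun u => sigma u i)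
    else (fun u => ~~ sigma u i).
  by apply/funext => u; case: (eta i); case: (sigma u i).
by case: (eta i) => //; exact: measurable_neg.
Qed.

Lemma tame_rate i : tame (fun u => expR (r (frame_of T0 u) i)).
Proof. exact: (frame_of_tame T0_gt0 (fun j => expR (r j i))). Qed.

Let tau_lt i k : tau i k < tau i k.+1.
Proof.
have [si|si] := boolP (sigma (tau i k) i).
  by have [-> _] := tau_transmit si; rewrite ltrDl.
have [Ex _] := tau_waiting si; rewrite lt_neqAle tau_mono // andbT.
apply: contraTneq (x_gt0 (i, k, false)) => E; rewrite -Ex -E -leNgt.
rewrite (tame_const (c := 0) (tame_rate i)) ?subrr ?mulr0 //.
by move=> u /andP[h1 h2]; move: h2; rewrite ltNge h1.
Qed.

Definition now h : R := update_time (frame h) + \sum_eta occ (sim x h) eta.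

(** The invariant tying the sample path to the simulation at the time of the last event of [h]. The
    age of a transmission is its elapsed time, that of a waiting period its cumulated activation
    rate. *)
Record matches h : Prop := {
  matches_live : live x h;
  matches_sched : sigma (now h) = sched h;
  matches_indep : sched h \in indep_sets e;
  matches_par : par (sim x h) = r (frame h);
  matches_occ : forall eta, occ (sim x h) eta = time_in eta (update_time (frame h)) (now h);
  matches_tau : forall i, tau i (period h i) <= now h < tau i (period h i).+1;
  matches_age : forall i, age (sim x h) i =
    if sched h i then now h - tau i (period h i)
    else \int[mu]_(u in `[tau i (period h i), now h]) expR (r (frame_of T0 u) i) }.

Lemma now_cons l h : now (l :: h) = now h + wait x h l.
Proof.
case: l => [i|]; rewrite /now.
  rewrite [\sum_eta occ (sim x (Some i :: h)) eta](eq_bigr (fun eta =>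
    occ (sim x h) eta + wait x h (Some i) *+ (eta == sched h))) //.
  rewrite big_split /= [\sum_(eta : schedule n) _ *+ _](bigD1 (sched h)) //= eqxx.
  by rewrite [\sum_(_ | _ != _) _]big1 ?addr0 ?addrA // => eta /negbTE ->.
rewrite [\sum_eta occ (sim x (None :: h)) eta]big1 // addr0 update_timeS.
by rewrite -addrA; congr (_ + _); rewrite wait_NoneE addrC subrK.
Qed.

Lemma sched_cons_other l h m : l != Some m -> sched (l :: h) m = sched h m.
Proof.
case: l => [i|] //= im; rewrite /after; case: ifP => // _.
by rewrite flip_other //; apply: contraNneq im => ->.
Qed.

Lemma period_cons_other l (h : history n) m : l != Some m -> period (l :: h) m = period h m.
Proof. by case: l => [i|] //= im; case: (eqVneq m i) im => [->|//]; rewrite eqxx. Qed.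

Let matches_nil : matches [::].
Proof.
have now0 : now [::] = 0.
  by rewrite /now /= update_time0 add0r big1.
have z0 (f : R -> R) : tame f -> \int[mu]_(u in `[0, 0]) f u = 0.
  move=> tf; rewrite (tame_const (c := 0) tf) ?subrr ?mulr0 //.
  by move=> u /andP[h1 h2]; move: h2; rewrite ltNge h1.
split; rewrite ?now0 //=.
- by apply/andP; split => //; apply/forallP => i; exact: x_gt0.
- exact: path.1.
- by move=> eta; rewrite update_time0 /time_in z0 //; exact: tame_state.
- by move=> i; rewrite tau0 lexx -{1}(tau0 i) tau_lt.
- by move=> i; rewrite tau0 subrr z0 ?if_same //; exact: tame_rate.
Qed.

Section Step.
Variable h : history n.
Hypothesis mh : matches h.

Let okh : ok x h. Proof. by case/andP: (matches_live mh). Qed.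

Let age_lt i : age (sim x h) i < x (current h i).
Proof. by case/andP: (matches_live mh) => _ /forallP. Qed.

Let wait_None_gt0 : 0 < wait x h None.
Proof. by case: (ok_bounds T0_gt0 okh). Qed.

Let now_ge : update_time (frame h) <= now h.
Proof.
rewrite lerDl; apply: sumr_ge0 => eta _.
by case: (ok_bounds T0_gt0 okh).
Qed.

Let update_time_ge0 j : 0 <= update_time j.
Proof. by rewrite -(update_time0 T0); exact: update_time_mono. Qed.

Let boundary : update_time (frame h).+1 = now h + wait x h None.
Proof. by rewrite -now_cons /now /= [\sum_eta _]big1 ?addr0. Qed.

Let rate_const u i : now h <= u < update_time (frame h).+1 ->
  expR (r (frame_of T0 u) i) = expR (r (frame h) i).
Proof.
move=> /andP[u1 u2]; rewrite (@frame_ofP _ _ T0_gt0 u (frame h)) //.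
by rewrite u2 andbT (le_trans now_ge).
Qed.

Let tau_sched i : sigma (tau i (period h i)) i = sched h i.
Proof. by rewrite -(matches_sched mh); apply/esym/tau_const/matches_tau. Qed.

(** Simulated waits extrapolate the present rate, which is valid only up to the end of the frame. A
    wait is therefore the true remaining time for a period ending in this frame; for the others only
    a lower bound is known. *)
Let ring_time i :
  (tau i (period h i).+1 <= update_time (frame h).+1 ->
     tau i (period h i).+1 = now h + wait x h (Some i)) /\
  (update_time (frame h).+1 < tau i (period h i).+1 ->
     wait x h None <= wait x h (Some i)).
Proof.
have /andP[t1 t2] := matches_tau mh i.
have wE : wait x h (Some i) = (x (current h i) - age (sim x h) i) / rate (sim x h) h i by [].
have n0 : 0 <= now h by apply: le_trans now_ge.
have [si|si] := boolP (sched h i).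
  have [tauE _] : tau i (period h i).+1 = tau i (period h i) + x (current h i) /\ True.
    split => //; have := @tau_transmit i (period h i); rewrite tau_sched si => /(_ isT)[-> _].
    by rewrite currentE si.
  have -> : wait x h (Some i) = tau i (period h i).+1 - now h.
    rewrite wE rateE si divr1 (matches_age mh) si tauE; ring.
  by rewrite boundary; split => [_|]; [ring|lra].
have cE : rate (sim x h) h i = expR (r (frame h) i).
  by rewrite rateE (negbTE si) (matches_par mh).
have [IE _] := @tau_waiting i (period h i) (introN idP (elimN idP
  (eq_ind_r (fun b : bool => ~~ b) si (tau_sched i)))).
have xE : x (current h i) = \int[mu]_(u in `[tau i (period h i), tau i (period h i).+1])
   expR (r (frame_of T0 u) i) by rewrite IE currentE (negbTE si).
have aE : age (sim x h) i = \int[mu]_(u in `[tau i (period h i), now h])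
   expR (r (frame_of T0 u) i) by rewrite (matches_age mh) (negbTE si).
have c0 : 0 < expR (r (frame h) i) by exact: expR_gt0.
split => tb.
  rewrite wE cE xE (tame_split (tame_rate i) (tau_ge0 _ _) t1 (ltW t2)) -aE.
  rewrite [X in _ + (X / _)]addrAC subrr add0r.
  rewrite (tame_const (c := expR (r (frame h) i)) (tame_rate i) n0 (ltW t2)).
    by rewrite mulrAC divff ?gt_eqF // mul1r addrC subrK.
  by move=> u /andP[u1 u2]; apply: rate_const; rewrite u1 (lt_le_trans u2).
have nb : now h <= update_time (frame h).+1 by rewrite boundary lerDl ltW.
rewrite wE cE ler_pdivlMr // xE (tame_split (tame_rate i) (tau_ge0 _ _) t1 (ltW t2)) -aE.
rewrite [leRHS]addrAC subrr add0r.
rewrite (tame_split (tame_rate i) n0 nb (ltW tb)).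
rewrite (tame_const (c := expR (r (frame h) i)) (tame_rate i) n0 nb) => [|u]; last exact: rate_const.
have -> : update_time (frame h).+1 - now h = wait x h None by rewrite boundary; ring.
rewrite [leLHS]mulrC lerDl.
by apply: tame_ge0 => u; exact: expR_ge0.
Qed.

(** The next event is the one of least [wait], unique by [no_tie]; until then the schedule and the
    rates are constant. *)
Lemma matches_step : exists2 l, matches (l :: h) &
  forall eta, time_in eta (update_time (frame h)) (now (l :: h)) =
    occ (sim x h) eta + wait x h l *+ (eta == sched h).
Proof.
case: (@arg_minP _ _ _ (None : option 'I_n) xpredT (wait x h) isT) => l _ lmin.
set D := wait x h l in lmin *.
have wait_gt0 l' : 0 < wait x h l'.
  case: l' => [i|] //; rewrite wait_SomeE divr_gt0 ?subr_gt0 //.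
  exact: rate_gt0.
have D0 : 0 < D by exact: wait_gt0.
have lt_wait m : l != Some m -> D < wait x h (Some m).
  move=> lm; rewrite lt_neqAle lmin // andbT eq_sym.
  exact: no_tie.
have lt_None : (l == None) || (D < wait x h None).
  case: (l) @D lmin D0 {lt_wait} => [i|] //= lmin _; rewrite lt_neqAle lmin // andbT.
  exact: no_tie.
have t'E := now_cons l h; rewrite -/D in t'E.
set t' := now (l :: h) in t'E.
have tt' : now h < t' by rewrite t'E ltrDl.
have t'b : t' <= update_time (frame h).+1 by rewrite boundary t'E lerD2l lmin.
have n0 : 0 <= now h by apply: le_trans now_ge.
have lt_tau m : l != Some m -> t' < tau m (period h m).+1.
  move=> lm; have [r1 r2] := ring_time m.
  have [/r1->|] := leP (tau m (period h m).+1) (update_time (frame h).+1).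
    by rewrite t'E ltrD2l lt_wait.
  exact: le_lt_trans.
have eq_tau i : l = Some i -> tau i (period h i).+1 = t'.
  move=> li; have [r1 r2] := ring_time i.
  rewrite t'E /D li; apply: r1; rewrite leNgt; apply/negP => /r2.
  by rewrite leNgt; move: lt_None; rewrite /D li /= => ->.
have ge_tau m : t' <= tau m (period h m).+1.
  have [/eqP/eq_tau <- //|/lt_tau/ltW//] := boolP (l == Some m).
have sigma_const u : now h <= u < t' -> sigma u = sched h.
  move=> /andP[u1 u2]; apply/ffunP => m; rewrite -tau_sched; apply: tau_const.
  have /andP[t1 _] := matches_tau mh m.
  by rewrite (le_trans t1) // (lt_le_trans u2).
have sigma_other m : l != Some m -> sigma t' m = sched h m.
  move=> lm; rewrite -tau_sched; apply: tau_const.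
  have /andP[t1 _] := matches_tau mh m.
  by rewrite (le_trans t1 (ltW tt')) lt_tau.
have sched_after : sigma t' = sched (l :: h).
  apply/ffunP => m; have [lm|lm] := boolP (l == Some m); last first.
    by rewrite sigma_other // sched_cons_other.
  have lE := eqP lm; rewrite lE /= -(eq_tau m lE).
  have [sm|sm] := boolP (sched h m).
    have := @tau_transmit m (period h m); rewrite tau_sched sm => /(_ isT)[_ ->].
    by rewrite /after flip_off_indep ?(matches_indep mh) // flip_self sm.
  have := @tau_waiting m (period h m); rewrite tau_sched sm => /(_ isT)[_ ->].
  rewrite (eq_tau m lE).
  (* No neighbour of [m] has an event at [t'], so the test made at the ring reads the schedule
     preceding it. *)
  have -> : [forall j, e m j ==> ~~ sigma t' j] = [forall j, e m j ==> ~~ sched h j].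
    apply: eq_forallb => j; case: (boolP (e m j)) => //= emj; rewrite sigma_other // lE.
    by apply: contraTneq emj => -[<-]; rewrite e_irr.
  rewrite -(flip_on_indep e_sym e_irr sm (matches_indep mh)) /after.
  by case: ifP => fI; rewrite ?flip_self ?sm //; apply/esym/negbTE.
have time_split eta : time_in eta (update_time (frame h)) t' =
    occ (sim x h) eta + D *+ (eta == sched h).
  rewrite /time_in (tame_split (tame_state eta) (update_time_ge0 _) now_ge (ltW tt')).
  rewrite -/(time_in _ _ _) -(matches_occ mh); congr (_ + _).
  rewrite (tame_const (c := (sched h == eta)%:R) (tame_state eta) n0 (ltW tt')).
    by rewrite t'E addrC addKr mulrC mulr_natr eq_sym.
  by move=> u ut; rewrite sigma_const.
have tsplit := time_split; exists l; last exact: tsplit.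
split; rewrite -/t'.
- apply/andP; split; first by rewrite /= okh D0 lt_None.
  apply/forallP => m; rewrite age_cons -/D.
  have [lm|lm] := boolP (l == Some m); first exact: x_gt0.
  rewrite currentE period_cons_other // sched_cons_other //.
  have := lt_wait m lm; rewrite wait_SomeE ltr_pdivlMr ?rate_gt0 // ltrBrDl.
  by rewrite mulrC.
- exact: sched_after.
- case: (l) => [i|] /=; last exact: matches_indep.
  by rewrite /after; case: ifP => // _; exact: matches_indep.
- case: l @D @t' t'E tt' t'b time_split {lmin lt_wait lt_None lt_tau eq_tau ge_tau sigma_const sigma_other sched_after D0 tsplit}
    => [i|] D t' t'E tt' t'b time_split.
    by rewrite par_Some; exact: matches_par.
  rewrite par_None [RHS]rS (matches_par mh); congr (F _ _ _); apply/funext => eta.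
  by rewrite -time_split t'E -boundary.
- move=> eta; case: l @D @t' t'E tt' t'b time_split {lmin lt_wait lt_None lt_tau eq_tau ge_tau sigma_const sigma_other sched_after D0 tsplit}
    => [i|] D t' t'E tt' t'b time_split.
    by rewrite occ_Some time_split.
  rewrite occ_None t'E -boundary /time_in (tame_const (c := 0) (tame_state eta)) ?subrr ?mulr0 //.
  by move=> u /andP[h1 h2]; move: h2; rewrite ltNge h1.
- move=> m; have [lm|lm] := boolP (l == Some m); last first.
    rewrite period_cons_other // lt_tau // andbT.
    by have /andP[t1 _] := matches_tau mh m; exact: le_trans (ltW tt').
  by rewrite (eqP lm) /= eqxx (eq_tau m (eqP lm)) lexx -(eq_tau m (eqP lm)) tau_lt.
- move=> m; rewrite age_cons -/D; have [lm|lm] := boolP (l == Some m).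
    have -> : tau m (period (l :: h) m) = t' by rewrite (eqP lm) /= eqxx (eq_tau m (eqP lm)).
    rewrite subrr (tame_const (c := 0) (tame_rate m)) ?subrr ?mulr0 ?if_same //.
      by rewrite (le_trans n0) // ltW.
    by move=> u /andP[h1 h2]; move: h2; rewrite ltNge h1.
  rewrite period_cons_other // sched_cons_other // (matches_age mh).
  have /andP[t1 _] := matches_tau mh m.
  case: ifP => sm; first by rewrite rateE sm mul1r t'E; ring.
  rewrite (tame_split (tame_rate m) (tau_ge0 _ _) t1 (ltW tt')); congr (_ + _).
  rewrite (tame_const (c := expR (r (frame h) m)) (tame_rate m) n0 (ltW tt')).
    by rewrite rateE sm (matches_par mh) t'E [X in _ = _ * X]addrAC subrr add0r.
  by move=> u /andP[u1 u2]; apply: rate_const; rewrite u1 (lt_le_trans u2).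
Qed.

End Step.

Lemma size_history (h : history n) : size h = (frame h + \sum_i period h i)%N.
Proof.
elim: h => [|[i|] h IH] /=; first by rewrite big1.
  rewrite IH (bigD1 i) //= [in RHS](bigD1 i) //= eqxx addSn addnS.
  congr (_ + (_ + _)).+1; apply: eq_bigr => m mi; by rewrite (negbTE mi).
by rewrite IH addSn.
Qed.

Lemma path_histories : exists hh : nat -> history n,
  [/\ hh 0%N = [::],
      forall m, exists2 l, hh m.+1 = l :: hh m &
        forall eta, time_in eta (update_time (frame (hh m))) (now (hh m.+1)) =
          occ (sim x (hh m)) eta + wait x (hh m) l *+ (eta == sched (hh m)),
      forall m, matches (hh m)
    & forall j, exists m0, forall m, (m0 <= m)%N -> (j < frame (hh m))%N].
Proof.
pose good h l := matches (l :: h) /\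
  forall eta, time_in eta (update_time (frame h)) (now (l :: h)) =
    occ (sim x h) eta + wait x h l *+ (eta == sched h).
(* The default [None] is never returned at a matching history, by [matches_step]. *)
pose next h := xget None [set l | good h l].
pose hh m := iter m (fun h => next h :: h) [::].
have next_good m : matches (hh m) -> good (hh m) (next (hh m)).
  move=> /matches_step[l l1 l2].
  by apply: (@xgetPex _ None [set l | good (hh m) l]); exists l.
have mm m : matches (hh m).
  by elim: m => [|m /next_good[]//]; exact: matches_nil.
have size_hh m : size (hh m) = m by elim: m => //= m ->.
exists hh; split => // [m|j].
  by exists (next (hh m)) => //; have [] := next_good m (mm m).
have [K HK] : exists K, forall i, update_time j.+1 < tau i K.
  have Ki i : exists K, forall k, (K <= k)%N -> update_time j.+1 < tau i k.
    by have /cvgryPgt/(_ (update_time j.+1))[K _ HK] := @tau_cvg i; exists K => k /HK.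
  pose Kf i := projT1 (cid (Ki i)); exists (\max_i Kf i) => i.
  by apply: (projT2 (cid (Ki i))); exact: leq_bigmax.
(* A history this long with at most [j] frame ends would contain more than [n * K] period ends. *)
exists (j + n * K).+1 => m mK; rewrite ltnNge; apply/negP => fj.
have := size_history (hh m); rewrite size_hh => mE.
have : (\sum_i period (hh m) i <= n * K)%N.
  rewrite -[X in (_ <= X * _)%N]card_ord -sum_nat_const; apply: leq_sum => i _.
  rewrite leqNgt; apply/negP => /ltnW/(@tau_mono i) Kp.
  have /andP[t1 _] := matches_tau (mm m) i.
  have [_ _ w0] := ok_bounds T0_gt0 (andP (matches_live (mm m))).1.
  have : now (hh m) < update_time (frame (hh m)).+1.
    by have := now_cons None (hh m); rewrite /now /= [X in _ + X = _]big1 // addr0 => ->; rewrite ltrDl.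
  have : update_time (frame (hh m)).+1 <= update_time j.+1 by apply: update_time_mono.
  move=> b1 b2; have := lt_le_trans (HK i) (le_trans Kp t1).
  by rewrite ltNge (le_trans (ltW b2) b1).
by lia.
Qed.

End Path.

(** * Event counts of a frame *)

Section EventCounts.
Variables (R : realType) (n : nat) (e : rel 'I_n) (eta0 : schedule n) (T0 : R).
Hypothesis T0_gt0 : 0 < T0.
Hypothesis eta0_indep : eta0 \in indep_sets e.
Variable F : nat -> ('I_n -> R) -> (schedule n -> R) -> 'I_n -> R.
Variables (x : clock n -> R) (j : nat).
Implicit Types (h : history n) (eta rho : schedule n) (i : 'I_n).

Local Notation sched := (sched e eta0).
Local Notation hit := (hit e eta0).
Local Notation sim := (sim e eta0 T0 F).
Local Notation wait := (wait e eta0 T0 F).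

Fixpoint event_count eta i h : nat :=
  if h is l :: h' then (event_count eta i h' + (hit eta j h' && (l == Some i)))%N
  else 0%N.

Fixpoint occupation eta h : R :=
  if h is l :: h' then occupation eta h' + wait x h' l *+ hit eta j h' else 0.

Lemma sched_indep h : sched h \in indep_sets e.
Proof. by elim: h => //= -[i|] h IH //; rewrite /after; case: ifP. Qed.

Let flow rho h : R := \sum_(i | flip i rho \in indep_sets e)
  ((event_count (flip i rho) i h)%:R - (event_count rho i h)%:R).

Let after_flow rho s i : rho \in indep_sets e -> s \in indep_sets e ->
  ((s == flip i rho)%:R - (s == rho)%:R) *+ (flip i rho \in indep_sets e) =
  (after e i s == rho)%:R - (s == rho)%:R :> R.
Proof.
move=> rhoI sI; rewrite /after.
have fE : (s == flip i rho) = (flip i s == rho) by rewrite (canF_eq (flipK i)).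
have [->|sr] := eqVneq s rho.
  case: ifP => _; first by rewrite mulr1n eq_sym (canF_eq (flipK i)) eq_sym.
  by rewrite mulr0n eqxx subrr.
case: (boolP (flip i s \in indep_sets e)) => fs.
  rewrite fE; case: eqP => [<-|_]; first by rewrite flipK sI mulr1n.
  by rewrite subrr mul0rn.
rewrite (negbTE sr) fE; case: eqP => [fr|_]; last by rewrite subrr mul0rn.
by move: fs; rewrite fr rhoI.
Qed.

Let flow_cons rho l h : flow rho (l :: h) = flow rho h +
  if l is Some i then (((sched h == flip i rho)%:R - (sched h == rho)%:R) *+
     (flip i rho \in indep_sets e)) *+ (frame h == j) else 0.
Proof.
rewrite /flow /=; under eq_bigr => i _ do rewrite !natrD.
transitivity (flow rho h + \sum_(i | flip i rho \in indep_sets e)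
   ((hit (flip i rho) j h && (l == Some i))%:R - (hit rho j h && (l == Some i))%:R)).
  by rewrite /flow -big_split /=; apply: eq_bigr => i _; ring.
congr (_ + _); case: l => [i|]; last by rewrite big1 // => i _; rewrite !andbF subrr.
have z k : k != i -> (Some i == Some k :> option 'I_n) = false.
  by move=> ki; apply: contraNF ki => /eqP[->].
rewrite big_mkcond (bigD1 i) //= eqxx !andbT big1 ?addr0; last first.
  by move=> k /z ->; rewrite !andbF subrr if_same.
rewrite !hitE; case: (frame h == j); rewrite ?andbT ?andbF ?mulr1n ?mulr0n ?subrr ?if_same //.
by rewrite -mulrb.
Qed.

(** Arrivals minus departures telescope to the difference of the indicators of [rho] now and at the
    start of the frame, where the schedule is [s]; the flow is 0 before the frame and constant after
    it. Blocked rings are left out by the condition on [flip i rho]. *)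
Lemma event_count_flow rho h : rho \in indep_sets e -> `|flow rho h| <= 1.
Proof.
move=> rhoI.
have b (p q : bool) : `|p%:R - q%:R : R| <= 1.
  by case: p; case: q; rewrite ?subrr ?subr0 ?sub0r ?normrN ?normr1 ?normr0.
suff [//] : [/\ `|flow rho h| <= 1, (frame h < j)%N -> flow rho h = 0
    & frame h = j -> exists s, flow rho h = (sched h == rho)%:R - (s == rho)%:R].
elim: h => [|l h [IH1 IH2 IH3]].
  have -> : flow rho [::] = 0 by rewrite /flow big1 // => i _; rewrite subrr.
  split => //; first by rewrite normr0.
  by move=> _; exists eta0; rewrite subrr.
rewrite flow_cons; case: l => [i|] /=; last first.
  rewrite addr0; split => // [/ltnW//|fj]; exists (sched h).
  by rewrite subrr IH2 // -fj.
have [fj|fj] := eqVneq (frame h) j; last first.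
  by rewrite mulr0n addr0; split => // fj'; rewrite fj' eqxx in fj.
have [s sE] := IH3 fj; rewrite mulr1n after_flow ?sched_indep // sE.
have E : (sched h == rho)%:R - (s == rho)%:R +
  ((after e i (sched h) == rho)%:R - (sched h == rho)%:R) =
  (after e i (sched h) == rho)%:R - (s == rho)%:R :> R by ring.
by rewrite E; split => // [|_]; [rewrite fj ltnn|exists s].
Qed.

Lemma occupation_lt eta h : (frame h < j)%N -> occupation eta h = 0.
Proof.
elim: h => //= l h IH; have fl : (frame h <= frame (l :: h))%N by case: (l) => /=.
move=> fj; have fj' := leq_ltn_trans fl fj.
by rewrite IH // hitE (ltn_eqF fj') andbF addr0.
Qed.

Lemma occupation_notin eta h : eta \notin indep_sets e -> occupation eta h = 0.
Proof.
move=> etaI; elim: h => //= l h ->; rewrite hitE.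
case: eqP => [sE|_]; last by rewrite addr0.
by move: etaI; rewrite -sE sched_indep.
Qed.

Lemma occupation_eq eta h : frame h = j -> occupation eta h = occ (sim x h) eta.
Proof.
elim: h => // -[i|] h IH /= fj; last first.

  by rewrite occupation_lt -?fj // hitE ltn_eqF ?andbF ?addr0.
by rewrite IH // hitE fj eqxx andbT eq_sym.
Qed.

(** The parameters are [q] during the whole frame, so the compensators add up to rate times
    occupation time. The hypothesis ranges over the suffixes of [h], where the recursion reads the
    parameters. *)
Lemma logZ_count q theta eta i h :
  (forall h', (exists2 h'', h = h'' ++ h' & frame h' = j) -> par (sim x h') = q) ->
  logZ e eta0 T0 F eta i j theta x h = theta * (event_count eta i h)%:R -
    (expR theta - 1) * (clock_rate q eta i * occupation eta h).
Proof.
elim: h => [|l h IH] parE /=; first by rewrite !mulr0 subrr.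
rewrite IH => [|h' [h'' hE] fj]; last by apply: parE => //; exists (l :: h''); rewrite // hE.
rewrite hitE natrD; have [fj|fj] := eqVneq (frame h) j; last first.
  by rewrite !andbF !mulr0n !addr0.
have [sE|_] := eqVneq (sched h) eta; last by rewrite !mulr0n !addr0.
rewrite /rate (parE h) ?sE; last by exists [:: l].
by rewrite !mulr1n; case: (l == Some i) => /=; ring.
Qed.

End EventCounts.

Section TameSums.
Variable R : realType.
Local Notation mu := (@lebesgue_measure R).
Implicit Types f g : R -> R.

Lemma tame_add f g : tame f -> tame g -> tame (fun u => f u + g u).
Proof.
move=> [mf bf] [mg bg]; split=> [|b]; first exact: measurable_funD.
have [[M HM] [M' HM']] := (bf b, bg b); exists (M + M') => u ub.
by rewrite (le_trans (ler_normD _ _)) // lerD ?HM ?HM'.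
Qed.

Lemma tame_scale c f : tame f -> tame (fun u => c * f u).
Proof.
move=> [mf bf]; split=> [|b]; first exact: measurable_funM.
have [M HM] := bf b; exists (`|c| * M) => u ub.
by rewrite normrM ler_wpM2l // HM.
Qed.

Lemma tame_integralD f g (a b : R) : tame f -> tame g -> 0 <= a ->
  \int[mu]_(u in `[a, b]) (f u + g u) =
  \int[mu]_(u in `[a, b]) f u + \int[mu]_(u in `[a, b]) g u.
Proof. by move=> tf tg a0; rewrite RintegralD //; exact: tame_integrable. Qed.

Lemma tame_integralZ c f (a b : R) : tame f -> 0 <= a ->
  \int[mu]_(u in `[a, b]) (c * f u) = c * \int[mu]_(u in `[a, b]) f u.
Proof. by move=> tf a0; rewrite RintegralZl //; exact: tame_integrable. Qed.

Lemma tame_integral_sum (I : Type) (s : seq I) (c : I -> R) (f : I -> R -> R) (a b : R) :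
  (forall i, tame (f i)) -> 0 <= a ->
  \int[mu]_(u in `[a, b]) (\sum_(i <- s) c i * f i u) =
  \sum_(i <- s) c i * \int[mu]_(u in `[a, b]) f i u.
Proof.
move=> tf a0.
suff [] : tame (fun u => \sum_(i <- s) c i * f i u) /\
  \int[mu]_(u in `[a, b]) (\sum_(i <- s) c i * f i u) =
  \sum_(i <- s) c i * \int[mu]_(u in `[a, b]) f i u by [].
elim: s => [|i s [IH1 IH2]].
  have -> : (fun u => \sum_(i <- [::]) c i * f i u) = fun=> 0.
    by apply/funext => u; rewrite big_nil.
  rewrite big_nil Rintegral_cst // mul0r; split => //; split; first exact: measurable_cst.
  by move=> b'; exists 0 => u _; rewrite normr0.
have -> : (fun u => \sum_(k <- i :: s) c k * f k u) =
    fun u => c i * f i u + \sum_(k <- s) c k * f k u.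
  by apply/funext => u; rewrite big_cons.
rewrite big_cons -IH2 tame_integralD ?tame_integralZ //; last exact: tame_scale.
by split => //; apply: tame_add => //; exact: tame_scale.
Qed.

End TameSums.

Section FrameData.
Variables (R : realType) (n : nat) (e : rel 'I_n) (T0 : R).
Hypotheses (e_sym : symmetric e) (e_irr : irreflexive e) (T0_gt0 : 0 < T0).
Local Notation mu := (@lebesgue_measure R).
Variable F : nat -> ('I_n -> R) -> (schedule n -> R) -> 'I_n -> R.
Variables (x : clock n -> R) (tau : 'I_n -> nat -> R) (sigma : R -> schedule n).
Variable r : nat -> 'I_n -> R.
Local Notation update_time := (update_time T0).
Hypothesis path : csma_path e (fun i t => r (frame_of T0 t) i)
  (fun i k => x (i, k, false)) (fun i k => x (i, k, true)) tau sigma.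
Hypothesis r0 : r 0%N = fun=> 0.
Hypothesis rS : forall j, r j.+1 =
  F j (r j) (fun eta => time_in sigma eta (update_time j) (update_time j.+1)).
Hypothesis x_gt0 : forall c, 0 < x c.
Hypothesis no_tie : forall h i l, ok e (sigma 0) T0 F x h -> l != Some i ->
  wait e (sigma 0) T0 F x h (Some i) != wait e (sigma 0) T0 F x h l.

Lemma sum_time_in i (a b : R) : 0 <= a ->
  \sum_(eta : schedule n) (eta i)%:R * time_in sigma eta a b = \int[mu]_(u in `[a, b]) (sigma u i)%:R.
Proof.
move=> a0; rewrite /time_in -tame_integral_sum //; last by move=> eta; exact: (tame_state path).
apply: eq_Rintegral => u _; rewrite (bigD1 (sigma u)) //= eqxx mulr1 big1 ?addr0 // => eta.
by rewrite eq_sym => /negbTE ->; rewrite mulr0.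
Qed.

(** Once the frame [j] is over, its counts and occupation times no longer change, so one [N] serves
    all longer histories. *)
Lemma frame_data j : exists N : schedule n -> 'I_n -> R,
  [/\ forall rho, rho \in indep_sets e ->
        `|\sum_(i | flip i rho \in indep_sets e) (N (flip i rho) i - N rho i)| <= 1,
      forall eta i theta, exists m0, forall m, (m0 <= m)%N -> exists h,
        [/\ size h = m, live e (sigma 0) T0 F x h
          & logZ e (sigma 0) T0 F eta i j theta x h =
            theta * N eta i - (expR theta - 1) *
            (clock_rate (r j) eta i * time_in sigma eta (update_time j) (update_time j.+1))],
      \sum_(eta in indep_sets e) time_in sigma eta (update_time j) (update_time j.+1) =
        frame_length T0 j
    & forall eta, eta \notin indep_sets e ->
        time_in sigma eta (update_time j) (update_time j.+1) = 0].
Proof.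
have [hh [hh0 hhS mh Hf]] := path_histories e_sym e_irr T0_gt0 path r0 rS x_gt0 no_tie.
have eta0I : sigma 0 \in indep_sets e by case: path.
have size_hh m : size (hh m) = m.
  by elim: m => [|m IH]; [rewrite hh0|have [l -> _] := hhS m; rewrite /= IH].
have tails m h' : (exists h'', hh m = h'' ++ h') -> exists k, h' = hh k.
  elim: m => [[h'']|m IH [h'']].
    by rewrite hh0; case: h'' => [/= <-|//]; exists 0%N; rewrite hh0.
  have [l E _] := hhS m; case: h'' => [/= <-|l' h'']; first by exists m.+1.
  by rewrite E => -[_ hE]; apply: IH; exists h''.
have occE m : (j < frame (hh m))%N -> (forall eta, occupation e (sigma 0) T0 F x j eta (hh m) =
    time_in sigma eta (update_time j) (update_time j.+1)) /\
    \sum_eta occupation e (sigma 0) T0 F x j eta (hh m) = frame_length T0 j.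
  elim: m => [|m IH]; first by rewrite hh0.
  have [l E tE] := hhS m; rewrite E.
  have [jm _|mj] := ltnP j (frame (hh m)).
    have [IH1 IH2] := IH jm.
    have oE eta : occupation e (sigma 0) T0 F x j eta (l :: hh m) =
        occupation e (sigma 0) T0 F x j eta (hh m).
      by rewrite /= hitE (gtn_eqF jm) andbF addr0.
    by split => [eta|]; rewrite ?oE // -IH2; apply: eq_bigr => eta _; exact: oE.
  case: l E tE => [i|] E tE /=; first by rewrite ltnNge mj.
  rewrite ltnS => jm; have fj : frame (hh m) = j by apply/eqP; rewrite eqn_leq mj.
  have oE eta : occupation e (sigma 0) T0 F x j eta (hh m) +
      wait e (sigma 0) T0 F x (hh m) None *+ hit e (sigma 0) eta j (hh m) =
      occ (sim e (sigma 0) T0 F x (hh m)) eta +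
      wait e (sigma 0) T0 F x (hh m) None *+ (eta == sched e (sigma 0) (hh m)).
    by rewrite occupation_eq // hitE fj eqxx andbT eq_sym.
  have nE : now e T0 F x sigma (hh m.+1) = update_time j.+1.
    by rewrite E /now [X in _ + X]big1 ?addr0 /= ?fj.
  split => [eta|]; first by rewrite oE -tE nE fj.
  rewrite (eq_bigr _ (fun eta _ => oE eta)) big_split /=.
  rewrite [X in _ + X](bigD1 (sched e (sigma 0) (hh m))) //= eqxx.
  rewrite [X in _ + (_ + X)]big1 => [|eta /negbTE -> //].
  by rewrite addr0 wait_NoneE fj addrC subrK.
have cntE : exists m0 : nat, forall m, (m0 <= m)%N -> (j < frame (hh m))%N /\
    forall eta i, event_count e (sigma 0) j eta i (hh m) =
      event_count e (sigma 0) j eta i (hh m0).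
  have [m0 Hm0] := Hf j; exists m0 => m mm; split; first exact: Hm0.
  move=> eta i; elim: m mm => [|m IH]; first by rewrite leqn0 => /eqP ->.
  rewrite leq_eqVlt => /predU1P[-> //|mm]; have [l -> _] := hhS m.
  by rewrite /= IH // hitE (gtn_eqF (Hm0 m mm)) andbF addn0.
have [m0 Hm0] := cntE.
exists (fun eta i => (event_count e (sigma 0) j eta i (hh m0))%:R); split.
- by move=> rho; exact: event_count_flow.
- move=> eta i theta; exists m0 => m mm; exists (hh m); split => //.
    exact: (matches_live (mh m)).
  have [jm cE] := Hm0 m mm; have [oE _] := occE m jm.
  rewrite (@logZ_count _ _ _ _ _ _ _ _ (r j)) ?oE ?cE // => h' [h'' hE fj].
  have [k kE] := tails m h' (ex_intro _ h'' hE).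
  by rewrite kE (matches_par (mh k)) -kE fj.
- have [oE <-] := occE m0 (Hm0 m0 (leqnn _)).1.
  rewrite [RHS](bigID [in indep_sets e]) /= [X in _ = _ + X]big1 ?addr0.
    by apply: eq_bigr => eta _; rewrite oE.
  by move=> eta; exact: occupation_notin.
- have [oE _] := occE m0 (Hm0 m0 (leqnn _)).1.
  by move=> eta etaI; rewrite -oE occupation_notin.
Qed.

End FrameData.

(** * Accuracy of the empirical service rates *)

Section Deviation.
Variables (R : realType) (n : nat) (e : rel 'I_n).
Implicit Types (j : nat) (eta rho : schedule n) (i : 'I_n) (s : bool).

(** The inverse square root of the frame length, for [j > 0]. *)
Definition tilt_size j : R := expR (- (Num.sqrt j%:R / 2)).

(** Polynomial, so that its logarithm is harmless, with inverses that telescope to a sum at most 1,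
    as Borel-Cantelli requires. *)
Definition deviation_level j : R := j.+1%:R * j.+2%:R.

Lemma deviation_level_gt0 j : 0 < deviation_level j.
Proof. by rewrite mulr_gt0. Qed.

Lemma sum_deviation_level m : \sum_(0 <= j < m) (deviation_level j)^-1 <= 1.
Proof.
suff -> : \sum_(0 <= j < m) (deviation_level j)^-1 = 1 - m.+1%:R^-1.
  by rewrite gerBl invr_ge0.
elim: m => [|m IH]; first by rewrite big_nil invr1 subrr.
rewrite big_nat_recr //= IH /deviation_level.
have h1 : (m.+1%:R : R) != 0 by rewrite pnatr_eq0.
have h2 : (m.+2%:R : R) != 0 by rewrite pnatr_eq0.
move: h1 h2; rewrite -[m.+2%:R]natr1; move: (m.+1%:R : R) => y h1 h2.
by field; rewrite h1 h2.
Qed.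

(** For [z = sqrt j] the left-hand side has degree [p = 2 k] in [z]; the term of degree [p + 1] of
    the series of [expR (z / 4)] dominates it once [z >= A]. *)
Lemma polynomial_exp_sqrt (K : R) (k : nat) : \forall j \near \oo,
  K * j%:R ^+ k <= expR (Num.sqrt j%:R / 4).
Proof.
pose p := k.*2.
pose A : R := `|K| * (4 ^+ p.+1 * (p.+1)`!%:R).
have A0 : 0 <= A by rewrite mulr_ge0.
exists (Num.bound (A ^+ 2)) => // j /= Aj.
have zA : A <= Num.sqrt j%:R.
  rewrite -[leLHS]ger0_norm // -sqrtr_sqr ler_wsqrtr //.
  apply: ltW; apply: lt_le_trans (archi_boundP (sqr_ge0 A)) _.
  by rewrite ler_nat.
have -> : j%:R ^+ k = Num.sqrt j%:R ^+ p :> R by rewrite /p -muln2 mulnC exprM sqr_sqrtr.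
set z := Num.sqrt _ in zA *; have z0 : 0 <= z by exact: sqrtr_ge0.
apply: le_trans (_ : (z / 4) ^+ p.+1 / (p.+1)`!%:R <= _); last first.
  have z4 : 0 <= z / 4 by rewrite divr_ge0.
  by apply: le_trans (expR_ge1Dxn p z4); rewrite lerDr.
have f0 : 0 < (p.+1)`!%:R :> R by rewrite ltr0n fact_gt0.
rewrite ler_pdivlMr // exprMn exprVn ler_pdivlMr ?exprn_gt0 //.
apply: le_trans (_ : A * z ^+ p <= _).
  have -> : K * z ^+ p * (p.+1)`!%:R * 4 ^+ p.+1 = K * (4 ^+ p.+1 * (p.+1)`!%:R) * z ^+ p.
    by move: (4 ^+ p.+1) (z ^+ p) ((p.+1)`!%:R) => *; ring.
  by rewrite ler_wpM2r ?exprn_ge0 // ler_wpM2r ?ler_norm.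
by rewrite exprSr [leRHS]mulrC ler_wpM2r ?exprn_ge0.
Qed.

(* [expR (± theta)] is linearized at the scale [theta = T^(- 1/2)], [T] being
   the length of the frame, which balances the two error terms. *)
Lemma counts_near (theta C c x N O : R) :
  0 < theta <= 2^-1 -> 0 <= O -> O * theta ^+ 2 <= 1 -> 0 <= c <= C ->
  (forall s, (-1) ^+ s * theta * N - (expR ((-1) ^+ s * theta) - 1) * (c * O) <= x) ->
  `|N - c * O| <= (x + 2 * C) / theta.
Proof.
move=> /andP[t0 t2] O0 Ot /andP[c0 cC] H.
have b s : (-1) ^+ s * theta * (N - c * O) <= x + 2 * C.
  have := expR_le_quad (_ : (-1) ^+ s * theta <= 2^-1).
  have -> : (-1) ^+ s * theta <= 2^-1 by case: s; rewrite ?expr1 ?expr0; lra.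
  move=> /(_ isT); have := H s; rewrite [((-1) ^+ s * theta) ^+ 2]exprMn -exprM mulnC exprM sqrrN expr1n expr1n mul1r.
  set E := expR _; set sg := (-1) ^+ s => H1 H2.
  have cO : 0 <= c * O by rewrite mulr_ge0.
  have cOt : c * O * theta ^+ 2 <= C.
    by rewrite -mulrA -[leRHS]mulr1 ler_pM // mulr_ge0 // sqr_ge0.
  have H3 : (E - 1) * (c * O) <= (sg * theta + 2 * theta ^+ 2) * (c * O).
    by rewrite ler_wpM2r //; lra.
  have -> : sg * theta * (N - c * O) = sg * theta * N - sg * theta * (c * O) by ring.
  have : (sg * theta + 2 * theta ^+ 2) * (c * O) = sg * theta * (c * O) + 2 * (c * O * theta ^+ 2) by ring.
  lra.
rewrite ler_pdivlMr // -[theta in leLHS]gtr0_norm // -normrM ler_norml.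
have := b true; have := b false; rewrite expr1 expr0.
move: (x + 2 * C) => D; set u := (N - c * O) * theta.
have -> : 1 * theta * (N - c * O) = u by rewrite /u; ring.
have -> : -1 * theta * (N - c * O) = - u by rewrite /u; ring.
lra.
Qed.

Lemma service_near (a0 : R) : 0 < a0 -> exists j0, forall j, (j0 <= j)%N ->
  forall (q : 'I_n -> R) (O : schedule n -> R) (N : schedule n -> 'I_n -> R) T0,
  (forall i, 0 <= q i <= a0 + 2 * ln j%:R) ->
  (forall rho, 0 <= O rho) ->
  \sum_(rho in indep_sets e) O rho = frame_length T0 j ->
  (forall rho, rho \in indep_sets e ->
    `|\sum_(i | flip i rho \in indep_sets e) (N (flip i rho) i - N rho i)| <= 1) ->
  (forall rho i s, (-1) ^+ s * tilt_size j * N rho i -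
     (expR ((-1) ^+ s * tilt_size j) - 1) * (clock_rate q rho i * O rho) <=
     ln (deviation_level j)) ->
  forall i, `|(\sum_(rho in indep_sets e) (rho i)%:R * O rho) / frame_length T0 j -
    service e q i| <= (j%:R ^+ 2)^-1.
Proof.
move=> a0_gt0; pose M : R := \sum_(rho in indep_sets e) 1.
have M0 : 0 <= M by exact: sumr_ge0.
have M1 : 1 <= M by rewrite /M (bigD1 (idle n)) ?idle_indep //= lerDl sumr_ge0.
pose ea := expR a0.
have ea1 : 1 <= ea by rewrite -expR0 ler_expR ltW.
(* The 6 comes from [ln (deviation_level j) <= 6 j^2], and [ea * j^2] bounds the clock rates, which
   [counts_near] doubles. *)
pose K : R := 6 + 2 * ea.
have K0 : 0 <= K by rewrite /K; lra.
pose K2 := 2 * M * (1 + n%:R * (2 * K)).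
have K20 : 0 <= K2 by rewrite /K2 !mulr_ge0 // addr_ge0 // mulr_ge0 // mulr_ge0.
pose K3 := M * (2 * n%:R * (Num.sqrt K2 * (M * ea ^+ n))).
(* The exponent collects [2 n] from the lower bound on the Gibbs weights, 1 from the square root of
   the count errors, and 2 from the target [1/j^2]. *)
have [J _ HJ] := polynomial_exp_sqrt K3 (n * 2 + 3).
(* For [j >= 4] the tilt is at most [expR (- 1) <= 1/2]. *)
exists (maxn 4 J) => j; rewrite geq_max => /andP[j4 Jj] q O N T0 qB O0 OT Nf Nd i.
have [j' jE] : exists j', j = j'.+1 by case: (j) j4 => // j'; exists j'.
have jj1 : 1 <= j%:R :> R by rewrite ler1n (leq_trans _ j4).
have j_gt0 : 0 < j%:R :> R by lra.
have jsq1 : 1 <= j%:R ^+ 2 :> R by rewrite exprn_ege1.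
pose th := tilt_size j.
have th0 : 0 < th by exact: expR_gt0.
have th2 : th <= 2^-1.
  rewrite /th /tilt_size expRN lef_pV2 ?posrE ?expR_gt0 //.
  apply: le_trans (_ : 1 + 1 <= _); first by lra.
  apply: le_trans (expR_ge1Dx _); rewrite lerD2l ler_pdivlMr // mul1r.
  have -> : (2 : R) = Num.sqrt 4.
    by rewrite -[LHS]ger0_norm // -sqrtr_sqr expr2; congr Num.sqrt; ring.
  by rewrite ler_wsqrtr // ler_nat.
have TE : frame_length T0 j = (th ^+ 2)^-1.
  by rewrite /th /tilt_size -expRM_natl -expRN jE /=; congr expR; field.
have T_gt0 : 0 < frame_length T0 j by rewrite TE invr_gt0 exprn_gt0.
have ln_j : 0 <= ln (j%:R : R) by rewrite ln_ge0.
have eB : expR (a0 + 2 * ln j%:R) = ea * j%:R ^+ 2.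
  by rewrite expRD mulrC [2 * _]mulrC expRM_natr lnK ?posrE // mulrC.
have N_near rho k : rho \in indep_sets e ->
    `|N rho k - clock_rate q rho k * O rho| <= K * j%:R ^+ 2 / th.
  move=> rhoI.
  have cB : 0 <= clock_rate q rho k <= ea * j%:R ^+ 2.
    rewrite ltW ?clock_rate_gt0 //= /clock_rate; case: ifP => _; last first.
      by rewrite -eB ler_expR; case/andP: (qB k).
    by rewrite -[leLHS]mulr1 ler_pM.
  have lB : ln (deviation_level j) <= 6 * j%:R ^+ 2 :> R.
    apply: le_trans (ltW (ln_sublinear (deviation_level_gt0 j))) _.
    have aux (y : R) : 1 <= y -> (y + 1) * (y + 1 + 1) <= 6 * y ^+ 2.
      move=> y1; have : 0 <= (y - 1) * (5 * y + 2) by rewrite mulr_ge0; lra.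
      rewrite expr2; lra.
    by rewrite /deviation_level -[j.+2%:R]natr1 -[j.+1%:R]natr1; exact: aux.
  have Ot : O rho * th ^+ 2 <= 1.
    rewrite -ler_pdivlMr ?exprn_gt0 // div1r -TE -OT (bigD1 rho) //= lerDl.
    exact: sumr_ge0.
  have := counts_near (_ : 0 < th <= 2^-1) (O0 rho) Ot cB (Nd rho k).
  rewrite th0 th2 => /(_ isT)/le_trans; apply.
  have -> : K * j%:R ^+ 2 = 6 * j%:R ^+ 2 + 2 * (ea * j%:R ^+ 2).
    by rewrite /K; move: (j%:R ^+ 2) => y; ring.
  by rewrite ler_pM2r ?invr_gt0 // lerD2r.
have g rho : rho \in indep_sets e -> (M * (ea * j%:R ^+ 2) ^+ n)^-1 <= gibbs e q rho.
  by move=> _; rewrite -eB; apply: gibbs_lower_bound.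
have m0 : 0 < (M * (ea * j%:R ^+ 2) ^+ n)^-1.
  by rewrite invr_gt0 mulr_gt0 ?exprn_gt0 ?mulr_gt0 ?expR_gt0 ?exprn_gt0 //; lra.
have y0 : 0 <= j%:R ^+ 2 :> R by exact: sqr_ge0.
have d0 : 0 <= K * j%:R ^+ 2 / th by rewrite divr_ge0 ?mulr_ge0 // ltW.
have q0 k : 0 <= q k by case/andP: (qB k).
have := @occupation_service _ _ _ q q0 _ M _ _ O N m0 T_gt0 d0 (erefl _) g O0 OT N_near Nf i.
move/le_trans; apply.
pose w := expR (- (Num.sqrt (j%:R : R) / 4)).
have w0 : 0 < w by exact: expR_gt0.
have thw : th = w ^+ 2.
  by rewrite /th /w /tilt_size -expRM_natl; congr expR; field.
have sq : Num.sqrt (2 * M * ((1 + n%:R * (2 * (K * j%:R ^+ 2 / th))) / frame_length T0 j)) <=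
    Num.sqrt K2 * (j%:R * w).
  have jw0 : 0 <= j%:R * w by rewrite mulr_ge0 // ltW.
  rewrite -[j%:R * w]ger0_norm // -sqrtr_sqr -sqrtrM //.
  rewrite exprMn -thw; move: (j%:R ^+ 2) {d0} y0 jsq1 => y y0 y1.
  apply: ler_wsqrtr; rewrite TE invrK /K2 -!mulrA ler_wpM2l // ler_wpM2l //.
  have -> : (1 + n%:R * (2 * (K * (y * th^-1)))) * th ^+ 2 =
      th * th + n%:R * (2 * K) * (y * th) by field; rewrite gt_eqF.
  rewrite [leRHS]mulrDl mul1r lerD2r; apply: ler_wpM2r; [exact: ltW|lra].
have E4 : K3 * j%:R ^+ (n * 2 + 3) * w <= 1.
  rewrite /w expRN ler_pdivrMr ?expR_gt0 // mul1r; exact: HJ.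
rewrite -[leRHS]mul1r ler_pdivlMr ?exprn_gt0 //; apply: le_trans E4.
rewrite invrK exprMn -exprM.
have -> : K3 * j%:R ^+ (n * 2 + 3) * w = M * (2 * n%:R * (Num.sqrt K2 * (j%:R * w) *
    (M * (ea ^+ n * j%:R ^+ (2 * n))))) * j%:R ^+ 2.
  rewrite exprD [(n * 2)%N]mulnC exprS /K3.
  by move: (Num.sqrt K2) (ea ^+ n) (_ ^+ (2 * n)) => *; ring.
rewrite ler_wpM2r // ler_wpM2l // ler_wpM2l ?mulr_ge0 // ler_wpM2r //.
by rewrite !mulr_ge0 ?exprn_ge0 //; lra.
Qed.

End Deviation.

Section BorelCantelli.
Variables (R : realType) (n : nat) (e : rel 'I_n) (T0 : R).
Variable F : nat -> ('I_n -> R) -> (schedule n -> R) -> 'I_n -> R.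
Hypothesis T0_gt0 : 0 < T0.
Hypothesis F_measurable : forall j d (S : measurableType d)
    (r : 'I_n -> S -> R) (o : schedule n -> S -> R),
  (forall i, measurable_fun setT (r i)) ->
  (forall eta, measurable_fun setT (o eta)) ->
  forall i, measurable_fun setT (fun w => F j (fun k => r k w) (fun eta => o eta w) i).
Context d (T : measurableType d) (P : probability T R).
Variable X : clock n -> {RV P >-> R}.
Hypothesis X_indep : forall (J : seq (clock n)) (B : clock n -> set R), uniq J ->
  (forall b, measurable (B b)) ->
  P (\big[setI/setT]_(b <- J) (X b @^-1` B b)) = (\prod_(b <- J) P (X b @^-1` B b))%E.
Hypothesis X_exp : forall b, exponential_rv 1 (X b).

Let XX w : clock n -> R := fun c => X c w.

Lemma deviation_ae : {ae P, forall w, forall (eta0 eta : schedule n) (i : 'I_n) (s : bool),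
  \forall j \near \oo, ~ exists m0, forall m, (m0 <= m)%N -> exists h,
    [/\ size h = m, live e eta0 T0 F (XX w) h
      & deviation_level R j <=
        expR (logZ e eta0 T0 F eta i j ((-1) ^+ s * tilt_size R j) (XX w) h)]}.
Proof.
suff H : {ae P, forall w, forall z : schedule n * schedule n * 'I_n * bool,
  \forall j \near \oo, ~ exists m0, forall m, (m0 <= m)%N -> exists h,
    [/\ size h = m, live e z.1.1.1 T0 F (XX w) h
      & deviation_level R j <= expR (logZ e z.1.1.1 T0 F z.1.1.2 z.1.2 j
          ((-1) ^+ z.2 * tilt_size R j) (XX w) h)]}.
  by apply: filterS H => w Hw eta0 eta i s; exact: (Hw (eta0, eta, i, s)).
apply: ae_countable => -[[[eta0 eta] i] s] /=.
pose bd j := deviation_bound e eta0 T0_gt0 F_measurable X_indep X_exp eta i j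
  ((-1) ^+ s * tilt_size R j) (deviation_level_gt0 R j).
pose B j := s2val (cid2 (bd j)).
have mB j : measurable (B j) by have [] := s2valP (cid2 (bd j)).
have PB j : (P (B j) <= ((deviation_level R j)^-1)%:E)%E.
  by have [] := s2valP (cid2 (bd j)).
have sB j := s2valP' (cid2 (bd j)).
exists (lim_sup_set B); split.
- apply: bigcap_measurable => // k _; exact: bigcup_measurable.
- apply: lim_sup_set_cvg0 => //; apply: le_lt_trans (ltry 1%R).
  apply: lime_le; first by apply: is_cvg_nneseries.
  apply: nearW => m; apply: le_trans (_ : (\sum_(0 <= j < m) (deviation_level R j)^-1)%:E <= _)%E.
    by rewrite -sumEFin; apply: lee_sum => j _; exact: PB.
  by rewrite lee_fin sum_deviation_level.
- move=> w /= Hw k _ /=; apply: contrapT => nB; apply: Hw; exists k => // j /= kj ex.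
  by apply: nB; exists j => //; exact: sB.
Qed.

End BorelCantelli.

(** * Queues *)

Section Queue.
Variable R : realType.
Local Notation mu := (@lebesgue_measure R).
Variables s lam Q : R -> R.
Hypotheses (tame_s : tame s) (tame_lam : tame lam).
Hypothesis s01 : forall u, 0 <= s u <= 1.
Hypothesis Q_path : queue_path s lam Q.

Let X t := \int[mu]_(u in `[0, t]) (lam u - s u).

Let tame_net : tame (fun u => lam u - s u).
Proof.
have -> : (fun u => lam u - s u) = fun u => lam u + -1 * s u.
  by apply/funext => u; rewrite mulN1r.
by apply: tame_add => //; exact: tame_scale.
Qed.

Lemma tame_mono f g (a b : R) : tame f -> tame g -> 0 <= a ->
  (forall u, a <= u <= b -> f u <= g u) ->
  \int[mu]_(u in `[a, b]) f u <= \int[mu]_(u in `[a, b]) g u.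
Proof.
by move=> tf tg a0 fg; apply: le_Rintegral => //; exact: tame_integrable.
Qed.

(* The last zero of [Q] before [t] need not exist as [Q] is not known to be
   continuous; a zero within distance 1 of the supremum of the zeros will do. *)
Lemma queue_bound t : 0 <= t -> exists2 u, 0 <= u <= t & Q t <= X t - X u + 1.
Proof.
move=> t0; have [Q0 Qge0 [b [mb b01 b1 QE]]] := Q_path.
pose Z := [set u | 0 <= u <= t /\ Q u = 0].
have Z0 : Z 0 by split => //; rewrite lexx.
have hZ : has_sup Z.
  by split; [exists 0|exists t => u [/andP[_ ut] _]].
pose v := sup Z.
have vt : v <= t by apply: ge_sup; [exists 0|move=> u [/andP[]]].
have v_ge0 : 0 <= v by apply: ub_le_sup => //; exact: hZ.2.
have [u [/andP[u0 ut] Qu] uv] := sup_adherent ltr01 hZ.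
rewrite -/v in uv.
have u_le_v : u <= v by apply: ub_le_sup; [exact: hZ.2|split; rewrite ?u0].
exists u; first by rewrite u0.
have tame_b : tame (fun z => s z * b z).
  split; first by apply: measurable_funM => //; exact: tame_s.1.
  move=> c; exists 1 => z /andP[z0 _].
  have /andP[s0 s1] := s01 z; have /andP[b0 bb] := b01 z z0.
  by rewrite ger0_norm ?mulr_ge0 // mulr_ile1.
have [ut'|ut'] := eqVneq u t; first by rewrite -ut' Qu subrr add0r.
have ult : u < t by rewrite lt_neqAle ut'.
rewrite (QE u t u0 ult) Qu sub0r.
rewrite !Rintegral_itv_obnd_cbnd; try exact: tame_integrable.
have XE : X t - X u = \int[mu]_(z in `[u, t]) (lam z - s z).
  by rewrite /X (tame_split tame_net (lexx 0) u0 ut) addrAC subrr add0r.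
pose lost := fun z => s z + -1 * (s z * b z).
have tame_lost : tame lost by apply: tame_add => //; exact: tame_scale.
have lost1 z : 0 <= z -> lost z <= 1.
  move=> z0; rewrite /lost mulN1r -[X in X - _]mulr1 -mulrBr.
  have /andP[s0 s1] := s01 z; have /andP[b0 bb] := b01 z z0.
  by rewrite mulr_ile1 ?subr_ge0 // gerBl.
have lost0 z : v < z <= t -> lost z = 0.
  move=> /andP[vz zt]; have z0 := ltW (le_lt_trans v_ge0 vz).
  rewrite /lost b1 ?mulr1 ?mulN1r ?subrr //.
  rewrite lt_neqAle Qge0 // andbT eq_sym.
  apply: contraTneq vz => Qz; rewrite -leNgt; apply: ub_le_sup; first exact: hZ.2.
  by split => //; rewrite z0.
have lostE : \int[mu]_(z in `[u, t]) lost z <= 1.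
  rewrite (tame_split tame_lost u0 u_le_v vt) -[leRHS]addr0 lerD //.
    apply: le_trans (_ : 1 * (v - u) <= _); last by rewrite mul1r; lra.
    rewrite -(@tame_const _ (fun=> 1) u v 1) //; last first.
      split; [exact: measurable_cst|move=> c; exists 1 => z _; by rewrite normr1].
    apply: tame_mono => //.
      split; [exact: measurable_cst|move=> c; exists 1 => z _; by rewrite normr1].
    by move=> z /andP[uz _]; apply: lost1; exact: le_trans uz.
  rewrite -Rintegral_itv_obnd_cbnd; last exact: tame_integrable.
  rewrite (@eq_Rintegral _ _ _ mu _ (fun=> 0)); last first.
    by move=> z; rewrite inE /= in_itv /=; exact: lost0.
  by rewrite Rintegral_cst // mul0r.
have -> : - (\int[mu]_(z in `[u, t]) (s z * b z)) + \int[mu]_(z in `[u, t]) lam z =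
    \int[mu]_(z in `[u, t]) (lam z - s z) + \int[mu]_(z in `[u, t]) lost z.
  rewrite -tame_integralD // -mulN1r -tame_integralZ // -tame_integralD //; last exact: tame_scale.
  by apply: eq_Rintegral => z _; rewrite /lost; ring.
by rewrite XE lerD2l.
Qed.

Lemma queue_sublinear :
  (forall eps, 0 < eps -> exists C, forall t, 0 <= t -> `|X t| <= C + eps * t) ->
  Q t / t @[t --> +oo] --> (0 : R).
Proof.
move=> X_small; apply/cvgrPdist_le => /= eps eps0.
have e4 : 0 < eps / 4 by rewrite divr_gt0.
have [C HC] := X_small _ e4.
have C0 : 0 <= C by apply: le_trans (normr_ge0 _) (le_trans (HC 0 (lexx _)) _); rewrite mulr0 addr0.
near=> t.
have t0 : 0 < t by near: t; exact: nbhs_pinfty_gt.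
have tC : (2 * C + 1) / (eps / 2) <= t by near: t; apply: nbhs_pinfty_ge; exact: num_real.
have [_ Qge0 _] := Q_path.
have [u /andP[u0 ut] Qt] := queue_bound (ltW t0).
have Qt0 : 0 <= Q t / t by rewrite divr_ge0 ?Qge0 ?(ltW t0).
rewrite sub0r normrN ger0_norm // ler_pdivrMr //.
apply: le_trans Qt _.
have h1 := le_trans (ler_norm _) (HC t (ltW t0)).
have h2 := le_trans (ler_norm _) (_ : `|- X u| <= C + eps / 4 * u).
rewrite normrN in h2; have h3 := h2 (HC u u0).
have h4 : eps / 4 * u <= eps / 4 * t by rewrite ler_wpM2l // ltW.
move: tC; rewrite ler_pdivrMr ?divr_gt0 // => tC.
have h5 : t * (eps / 2) = 2 * (eps / 4 * t) by field.
have h6 : eps * t = 4 * (eps / 4 * t) by field.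
rewrite h6; move: (X t) (X u) (eps / 4 * t) h1 h3 h4 h5 tC => *; lra.
Unshelve. all: by end_near. Qed.

End Queue.

Section Cumulative.
Variables (R : realType) (T0 : R).
Hypothesis T0_gt0 : 0 < T0.
Local Notation mu := (@lebesgue_measure R).
Local Notation frame_length := (frame_length T0).
Local Notation update_time := (update_time T0).

(** A Cesàro argument: the terms with [|a k| > eps] lie among the first [K], whose sum is the
    constant [C]. *)
Lemma weighted_sum_small (a : nat -> R) : a j @[j --> \oo] --> 0 ->
  forall eps, 0 < eps -> exists C, forall j,
  \sum_(k < j) frame_length k * `|a k| <= C + eps * update_time j.
Proof.
move=> a0 eps eps0; have f0 k : 0 <= frame_length k * `|a k|.
  by rewrite mulr_ge0 // ltW // frame_length_gt0.
have [K _ HK] : \forall k \near \oo, `|a k| <= eps.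
  by move/cvgrPdist_le: a0 => /(_ eps eps0); apply: filterS => k; rewrite sub0r normrN.
exists (\sum_(k < K) frame_length k * `|a k|).
elim=> [|j IH].
  by rewrite big_ord0 update_time0 mulr0 addr0 sumr_ge0.
have [jK|Kj] := leqP j.+1 K; last first.
  rewrite big_ord_recr /= update_timeS mulrDr addrA lerD // [leRHS]mulrC ler_wpM2l //.
    by rewrite ltW // frame_length_gt0.
  exact: HK.

apply: le_trans (_ : \sum_(k < K) frame_length k * `|a k| <= _); last first.
  rewrite lerDl mulr_ge0 ?(ltW eps0) // -(update_time0 T0); exact: update_time_mono.
rewrite (big_ord_widen K (fun k => frame_length k * `|a k|) jK).
by rewrite [leRHS](bigID (fun k : 'I_K => (k < j.+1)%N)) /= lerDl sumr_ge0.
Qed.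

(* The increments of the square root tend to 0, so that
   [T(j+1) - T(j) <= eps * T(j)] eventually. *)
Lemma frame_length_small eps : 0 < eps -> exists C, forall j,
  frame_length j <= C + eps * update_time j.
Proof.
move=> eps0; pose J := maxn 4 (Num.bound ((2 / eps) ^+ 2)).
have incr j : (J <= j)%N -> frame_length j.+1 <= frame_length j + eps * frame_length j.
  rewrite geq_max => /andP[j4 jJ].
  have [j' jE] : exists j', j = j'.+1 by case: (j) j4 => // j'; exists j'.
  have -> : frame_length j = expR (Num.sqrt j%:R) by rewrite jE.
  set z := Num.sqrt _.
  have z2 : 2 <= z.
    have -> : (2 : R) = Num.sqrt 4.
      by rewrite -[LHS]ger0_norm // -sqrtr_sqr expr2; congr Num.sqrt; ring.
    by rewrite ler_wsqrtr // ler_nat.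
  have ze : 2 / eps <= z.
    have q0 : 0 <= 2 / eps by rewrite divr_ge0 // ltW.
    rewrite -[leLHS]ger0_norm // -sqrtr_sqr ler_wsqrtr //.
    apply: ltW; apply: lt_le_trans (archi_boundP (sqr_ge0 _)) _.
    by rewrite ler_nat.
  have z0 : 0 < z by lra.
  have zz : j%:R = z ^+ 2 by rewrite sqr_sqrtr.
  have h : Num.sqrt j.+1%:R <= z + z^-1.
    have q0 : 0 <= z + z^-1 by rewrite addr_ge0 ?invr_ge0 // ltW.
    rewrite -[leRHS]ger0_norm // -sqrtr_sqr ler_wsqrtr //.
    rewrite -natr1 zz sqrrD divff ?gt_eqF // -[leLHS]addr0 lerD ?sqr_ge0 //.
    by rewrite lerD2l; lra.
  apply: le_trans (_ : expR (z + z^-1) <= _); first by rewrite /= ler_expR.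
  rewrite expRD -[X in _ <= X + _]mulr1 [eps * _]mulrC -mulrDr ler_wpM2l ?expR_ge0 //.
  have zi : z^-1 <= 2^-1 by rewrite lef_pV2 ?posrE.
  have zi0 : 0 < z^-1 by rewrite invr_gt0.
  apply: le_trans (expR_le_quad zi) _; rewrite -addrA lerD2l.
  have e2 : 2 * z^-1 <= eps.
    by rewrite ler_pdivrMr // mulrC -ler_pdivrMr.
  apply: le_trans e2; rewrite [leRHS]mulrDl mul1r lerD2l expr2 mulrA.
  by rewrite -[leRHS]mul1r ler_wpM2r ?(ltW zi0) //; lra.
exists (\sum_(k < J.+1) frame_length k).
have f0 k : 0 <= frame_length k by rewrite ltW ?frame_length_gt0.
have u0 k : 0 <= update_time k by rewrite -(update_time0 T0); exact: update_time_mono.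
elim=> [|j IH].
  by rewrite (bigD1 ord0) //= -addrA lerDl addr_ge0 ?sumr_ge0 // mulr_ge0 // ltW.
have [jJ|Jj] := leqP j.+1 J; last first.
  by apply: le_trans (incr j Jj) _; rewrite update_timeS mulrDr addrA lerD2r.
have jJ' : (j.+1 < J.+1)%N by [].
apply: le_trans (_ : frame_length (Ordinal jJ') <= _); first exact: lexx.
rewrite (bigD1 (Ordinal jJ')) // -addrA lerDl addr_ge0 ?sumr_ge0 //.
by rewrite mulr_ge0 // ltW.
Qed.

Variables (s : R -> R) (lam : nat -> R).
Hypothesis tame_s : tame s.
Hypothesis s01 : forall u, 0 <= s u <= 1.
Hypothesis lam01 : forall j, 0 <= lam j <= 1.
Let a j := lam j - (frame_length j)^-1 *
  \int[mu]_(u in `[update_time j, update_time j.+1]) s u.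

Hypothesis balance : a j @[j --> \oo] --> 0.

(** Complete frames contribute a weighted sum of the vanishing [a]; the unfinished frame contributes
    at most its length, which is small compared with its starting time. *)
Lemma cumulative_small eps : 0 < eps -> exists C, forall t, 0 <= t ->
  `|\int[mu]_(u in `[0, t]) (lam (frame_of T0 u) - s u)| <= C + eps * t.
Proof.
move=> eps0; have e2 : 0 < eps / 2 by rewrite divr_gt0.
have [C1 H1] := weighted_sum_small balance e2.
have [C2 H2] := frame_length_small e2.
pose f u := lam (frame_of T0 u) + -1 * s u.
have fE : (fun u => lam (frame_of T0 u) - s u) = f.
  by apply/funext => u; rewrite /f mulN1r.
have tl : tame (fun u => lam (frame_of T0 u)) by exact: frame_of_tame.
have tf : tame f by apply: tame_add => //; exact: tame_scale.
have f1 u : `|f u| <= 1.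
  have /andP[l0 l1] := lam01 (frame_of T0 u); have /andP[s0 s1] := s01 u.
  by rewrite /f mulN1r ler_norml; apply/andP; split; lra.
have u0 k : 0 <= update_time k by rewrite -(update_time0 T0); exact: update_time_mono.
have uS k : update_time k <= update_time k.+1 by exact: update_time_mono.
have frameE j : \int[mu]_(u in `[update_time j, update_time j.+1]) f u = frame_length j * a j.
  rewrite /f tame_integralD //; last exact: tame_scale.
  rewrite (@tame_const _ _ _ _ (lam j)) //; last first.
    by move=> u uj; rewrite (frame_ofP T0_gt0 uj).
  rewrite tame_integralZ // update_timeS /a -update_timeS.
  have f0 : frame_length j != 0 by rewrite gt_eqF ?frame_length_gt0.
  have -> : update_time j.+1 - update_time j = frame_length j by rewrite update_timeS; ring.
  by move: (\int[mu]_(u in _) s u) => I; field.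
have startE j : \int[mu]_(u in `[0, update_time j]) f u = \sum_(k < j) frame_length k * a k.
  elim: j => [|j IH].
    rewrite big_ord0 update_time0 (@tame_const _ _ _ _ 0) ?subrr ?mulr0 //.
    by move=> u /andP[h1 h2]; move: h2; rewrite ltNge h1.
  by rewrite big_ord_recr /= (tame_split tf (lexx 0) (u0 j) (uS j)) IH frameE.
exists (C1 + C2) => t t0; rewrite fE.
have [j /andP[jt tj]] := step_ex (update_time0 T0) (update_time_cvg T0_gt0) t0.
rewrite (tame_split tf (lexx 0) (u0 j) jt) startE.
have t1 : `|\int[mu]_(u in `[update_time j, t]) f u| <= frame_length j.
  have b (g : R -> R) : tame g -> (forall u, g u <= 1) ->
      \int[mu]_(u in `[update_time j, t]) g u <= frame_length j.
    move=> tg g1; apply: le_trans (_ : 1 * (t - update_time j) <= _).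
      have t1 : tame (fun=> 1 : R).
        by split; [exact: measurable_cst|move=> c; exists 1 => z _; rewrite normr1].
      by rewrite -(@tame_const _ (fun=> 1) _ _ 1 t1) //; apply: tame_mono.
    by rewrite mul1r; move: tj; rewrite update_timeS; lra.
  rewrite ler_norml lerNl -mulN1r -tame_integralZ // !b //.
  - by move=> u; exact: le_trans (ler_norm _) (f1 u).
  - exact: tame_scale.
  - by move=> u; rewrite mulN1r; apply: le_trans (ler_norm _) _; rewrite normrN.
have t2 : `|\sum_(k < j) frame_length k * a k| <= C1 + eps / 2 * update_time j.
  apply: le_trans (H1 j); apply: le_trans (ler_norm_sum _ _ _) _.
  by apply: ler_sum => k _; rewrite normrM ger0_norm // ltW // frame_length_gt0.
apply: le_trans (ler_normD _ _) _; have t3 := H2 j.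
have t4 : eps / 2 * update_time j <= eps / 2 * t by rewrite ler_wpM2l // ltW.
have t5 : eps * t = eps / 2 * t + eps / 2 * t by field.
rewrite t5; move: (eps / 2 * t) (eps / 2 * update_time j) t2 t3 t4 => y z t2 t3 t4.
move: t1 t2; move: `|_| `|_| (frame_length j) t3 => p q g *; lra.
Qed.

End Cumulative.

(** * The controlled network *)

Section ArgmaxExtension.
Variables (R : realType) (f : R -> R).
Hypothesis f_concave : strictly_concave01 f.
Implicit Types q y : R.

(* A monotone, hence measurable, function that gives the maximizer of
   [f y - q * y] whenever it exists ([f] may jump down at 1). *)
Definition argmax_ext q : R := sup [set y | y = 0 \/
  exists2 q', q <= q' & is_argmax01 (fun z => f z - q' * z) y].

Let ub1 q : has_sup [set y | y = 0 \/
  exists2 q', q <= q' & is_argmax01 (fun z => f z - q' * z) y].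
Proof.
by split; [exists 0; left|exists 1 => y [->//|[q' _ [/andP[_ //]]]]].
Qed.

Lemma argmax_ext_nonincreasing : nonincreasing_fun argmax_ext.
Proof.
move=> q q' qq'; apply: ge_sup; first by exists 0; left.
move=> y Hy; apply: ub_le_sup; first exact: (ub1 q).2.
by case: Hy => [->|[q2 q2q ym]]; [left|right; exists q2 => //; exact: le_trans q2q].
Qed.

(** Maximizers are nonincreasing in the slope and unique for each slope, so a maximizer at [q]
    dominates those at all larger slopes. *)
Lemma argmax_extE q y : is_argmax01 (fun z => f z - q * z) y -> argmax_ext q = y.
Proof.
move=> ym; apply/le_anti/andP; split; last first.
  by apply: ub_le_sup; [exact: (ub1 q).2|right; exists q].
apply: ge_sup; first by exists 0; left.
move=> z [->|[q' qq' zm]]; first by case: ym => /andP[].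
have [qE|qq] := eqVneq q q'; first by rewrite (argmax_unique f_concave ym (_ : is_argmax01 (fun v => f v - q * v) z)) // qE.
have q0 : 0 < q' - q by rewrite subr_gt0 lt_neqAle qq.
have := argmax_antitone zm ym.
by rewrite pmulr_rle0 // subr_le0.
Qed.

End ArgmaxExtension.

Section ControlLaw.
Variables (R : realType) (n : nat) (f : 'I_n -> R -> R) (a0 T0 : R).

(** The arrival rates are eliminated, so that the parameters evolve as a function of the occupation
    times alone. The first rate is the prescribed 1, not a maximizer. *)
Definition control_law (j : nat) (q : 'I_n -> R) (o : schedule n -> R) (i : 'I_n) : R :=
  Num.max (q i + step_size a0 j *
    ((if j is 0%N then 1 else argmax_ext (f i) (q i)) -
     (frame_length T0 j)^-1 * \sum_(eta : schedule n) (eta i)%:R * o eta)) 0.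

Lemma measurable_control_law j d (S : measurableType d)
    (q : 'I_n -> S -> R) (o : schedule n -> S -> R) :
  (forall i, measurable_fun setT (q i)) -> (forall eta, measurable_fun setT (o eta)) ->
  forall i, measurable_fun setT
    (fun w => control_law j (fun k => q k w) (fun eta => o eta w) i).
Proof.
move=> mq mo i; apply: measurable_maxr; last exact: measurable_cst.
apply: measurable_funD => //; apply: measurable_funM => //; apply: measurable_funB.
  case: j => [|j]; first exact: measurable_cst.
  apply: (@measurableT_comp _ _ _ _ _ _ (argmax_ext (f i))) => //.
  apply: nonincreasing_measurable => //; exact: argmax_ext_nonincreasing.
by apply: measurable_funM => //; apply: measurable_sum => eta; exact: measurable_funM.
Qed.

End ControlLaw.

Section SamplePath.
Variables (R : realType) (n : nat) (e : rel 'I_n) (U : 'I_n -> R -> R) (beta a0 T0 : R).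
Hypotheses (e_sym : symmetric e) (e_irr : irreflexive e).
Hypotheses (a0_gt0 : 0 < a0) (T0_gt0 : 0 < T0).
Let f i y : R := beta * U i y.
Hypothesis f_concave : forall i, strictly_concave01 (f i).
Local Notation mu := (@lebesgue_measure R).
Variables (x : clock n -> R) (tau : 'I_n -> nat -> R) (sigma : R -> schedule n).
Variables (r lam : nat -> 'I_n -> R) (Q : 'I_n -> R -> R) (rs : 'I_n -> R).
Hypothesis rs_gt0 : forall i, 0 < rs i.
Hypothesis rs_argmax :
  forall i, is_argmax01 (fun y => f i y - rs i * y) (service e rs i).
Local Notation F := (control_law f a0 T0).
Local Notation update_time := (update_time T0).
Local Notation frame_length := (frame_length T0).
Hypothesis path : csma_path e (fun i t => r (frame_of T0 t) i)
  (fun i k => x (i, k, false)) (fun i k => x (i, k, true)) tau sigma.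
Hypothesis control : congestion_control_path U beta a0 T0 sigma r lam.
Hypothesis queues : forall i, queue_path (fun t => (sigma t i)%:R)
  (fun t => lam (frame_of T0 t) i) (Q i).
Hypothesis x_gt0 : forall c, 0 < x c.
Hypothesis no_tie : forall h i l, ok e (sigma 0) T0 F x h -> l != Some i ->
  wait e (sigma 0) T0 F x h (Some i) != wait e (sigma 0) T0 F x h l.
Hypothesis no_deviation : forall (eta : schedule n) (i : 'I_n) (s : bool),
  \forall j \near \oo, ~ exists m0, forall m, (m0 <= m)%N -> exists h,
    [/\ size h = m, live e (sigma 0) T0 F x h
      & deviation_level R j <=
        expR (logZ e (sigma 0) T0 F eta i j ((-1) ^+ s * tilt_size R j) x h)].

Local Notation shat := (empirical_service T0 sigma).

Let r0 : r 0%N = fun=> 0.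
Proof. by apply/funext => i; case: (control i). Qed.

Let lam_argmax j i : is_argmax01 (fun y => f i y - r j.+1 i * y) (lam j.+1 i).
Proof. by case: (control i). Qed.

Let lam01 j i : 0 <= lam j i <= 1.
Proof.
case: j => [|j]; last by case: (lam_argmax j i).
by case: (control i) => _ -> _ _; rewrite ler01 lexx.
Qed.

Let update_time_ge0 j : 0 <= update_time j.
Proof. by rewrite -(update_time0 T0); exact: update_time_mono. Qed.

Let occ j eta := time_in sigma eta (update_time j) (update_time j.+1).

Let shatE j i : shat i j = (frame_length j)^-1 * \sum_(eta : schedule n) (eta i)%:R * occ j eta.
Proof. by rewrite /empirical_service /occ (sum_time_in path). Qed.

Let rS j : r j.+1 = F j (r j) (occ j).
Proof.
apply/funext => i; rewrite /control_law -shatE.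
have [_ l0 -> _] := control i.
case: j => [|j]; first by rewrite l0.
by rewrite (argmax_extE (f_concave i) (lam_argmax j i)).
Qed.

Let shat01 j i : 0 <= shat i j <= 1.
Proof.
have T_gt0 := frame_length_gt0 T0_gt0 j.
have ts := tame_service path i.
rewrite /empirical_service mulrC divr_ge0 ?(ltW T_gt0) ?tame_ge0 //.
rewrite ler_pdivrMr // mul1r.
have t1 : tame (fun=> 1 : R).
  by split; [exact: measurable_cst|move=> c; exists 1 => z _; rewrite normr1].
have LT : update_time j.+1 - update_time j = frame_length j by rewrite update_timeS; ring.
rewrite -LT -[leRHS]mul1r -(@tame_const _ (fun=> 1) _ _ 1 t1) //; last exact: update_time_mono.
by apply: tame_mono => // u _; case: (sigma u i).
Qed.

Let shat_near : exists j0, forall j i, (j0 <= j)%N ->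
  `|shat i j - service e (r j) i| <= (j%:R ^+ 2)^-1.
Proof.
have [j0 Hj0] := service_near (n := n) e a0_gt0.
have dev (z : schedule n * 'I_n * bool) : exists K, forall j, (K <= j)%N ->
    ~ exists m0, forall m, (m0 <= m)%N -> exists h,
    [/\ size h = m, live e (sigma 0) T0 F x h
      & deviation_level R j <= expR (logZ e (sigma 0) T0 F z.1.1 z.1.2 j
          ((-1) ^+ z.2 * tilt_size R j) x h)].
  by have [K _ HK] := no_deviation z.1.1 z.1.2 z.2; exists K => j /HK.
(* A common threshold for the finitely many states, nodes and signs. *)
pose K z := projT1 (cid (dev z)); pose K1 := \max_z K z.
have HK z j : (K1 <= j)%N -> _ := fun K1j =>
  projT2 (cid (dev z)) j (leq_trans (leq_bigmax z) K1j).
exists (maxn 1 (maxn j0 K1)) => j i; rewrite !geq_max => /and3P[j1 jj0 jK].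
have [N [Nf Nl Ns N0]] := frame_data e_sym e_irr T0_gt0 path r0 rS x_gt0 no_tie j.
have q_bound k : 0 <= r j k <= a0 + 2 * ln j%:R.
  case: (j) j1 => // j' _; apply/andP; split.
    by rewrite rS /control_law le_max lexx orbT.
  apply: (@dual_bound _ _ a0 r lam (fun j i => shat i j)) => //.
    by move=> i'; rewrite r0.
  by move=> k' i'; case: (control i').
have O0 rho : 0 <= occ j rho by apply: tame_ge0.
have Nd rho k (s : bool) : (-1) ^+ s * tilt_size R j * N rho k -
     (expR ((-1) ^+ s * tilt_size R j) - 1) * (clock_rate (r j) rho k * occ j rho) <=
     ln (deviation_level R j).
  rewrite leNgt; apply/negP => lt; apply: (HK (rho, k, s) j jK) => /=.
  have [m0 Hm0] := Nl rho k ((-1) ^+ s * tilt_size R j); exists m0 => m /Hm0[h [sh lh lE]].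
  exists h; split => //; rewrite lE -[leLHS]lnK ?posrE ?deviation_level_gt0 //.
  by rewrite ler_expR ltW.
have := Hj0 j jj0 (r j) (occ j) N T0 q_bound O0 Ns Nf Nd i.
suff -> : shat i j =
    (\sum_(rho in indep_sets e) (rho i)%:R * occ j rho) / frame_length j by [].
rewrite shatE mulrC; congr (_ / _).
rewrite [LHS](bigID [in indep_sets e]) /= [X in _ + X]big1 ?addr0 // => eta etaI.
by rewrite /occ N0 // mulr0.
Qed.

Lemma sample_path_cvg : (forall i, Q i t / t @[t --> +oo] --> (0 : R)) /\
  forall i, lam j i @[j --> \oo] --> service e rs i.
Proof.
have [j0 near] := shat_near.
have r0' i : r 0%N i = 0 by rewrite r0.
have rS' j i : r j.+1 i = Num.max (r j i + step_size a0 j * (lam j i - shat i j)) 0.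
  by case: (control i).
have lam_cvg := @rate_iteration_cvg _ _ e f a0 r lam (fun j i => shat i j) rs j0
  e_irr f_concave a0_gt0 r0' rS' lam01 shat01 lam_argmax rs_gt0 rs_argmax near.
have srv_cvg := @service_iteration_cvg _ _ e f a0 r lam (fun j i => shat i j) rs j0
  e_irr a0_gt0 r0' rS' lam01 shat01 lam_argmax rs_gt0 rs_argmax near.
split => // i.
have s01 u : 0 <= ((sigma u i)%:R : R) <= 1 by case: (sigma u i); rewrite ?lexx ler01.
apply: (queue_sublinear (tame_service path i) _ s01 (queues i)).
  exact: frame_of_tame T0_gt0 (fun j => lam j i).
apply: (@cumulative_small _ _ T0_gt0 (fun u => (sigma u i)%:R) (fun j => lam j i)
  (tame_service path i) s01 (fun j => lam01 j i)).
have shat_cvg : shat i j @[j --> \oo] --> service e rs i.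
  have : (shat i j - service e (r j) i) + service e (r j) i @[j --> \oo] --> 0 + service e rs i.
    apply: cvgD (srv_cvg i); apply/cvgrPdist_le => /= e1 e10.
    exists (maxn (maxn 1 j0) (Num.bound e1^-1)) => // j /=.
    rewrite !geq_max => /andP[/andP[j1 jj0] je]; rewrite sub0r normrN.
    apply: le_trans (near j i jj0) _.
    have j1' : 1 <= j%:R :> R by rewrite ler1n.
    have j2 : 0 < j%:R ^+ 2 :> R by rewrite exprn_gt0 // (lt_le_trans ltr01).
    rewrite -[leRHS]invrK lef_pV2 ?posrE ?invr_gt0 //.
    apply: le_trans (_ : j%:R <= _); last by rewrite expr2 ler_peMl //; lra.
    apply: ltW; apply: lt_le_trans (archi_boundP _) _; last by rewrite ler_nat.
    by rewrite invr_ge0 ltW.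
  by rewrite add0r; under eq_fun do rewrite subrK.
rewrite -(subrr (service e rs i)); exact: cvgB (lam_cvg i) shat_cvg.
Qed.

End SamplePath.

Theorem theorem3 (R : realType) (n : nat) (e : rel 'I_n)
    (e_sym : symmetric e) (e_irr : irreflexive e)
    (U : 'I_n -> R -> R)
    (U_concave : forall i, strictly_concave01 (U i))
    (U_increasing : forall i, increasing01 (U i))
    (beta a0 T0 : R) (beta_gt0 : 0 < beta) (a0_gt0 : 0 < a0) (T0_gt0 : 0 < T0)
    (d : measure_display) (T : measurableType d) (P : probability T R)
    (W S : 'I_n -> nat -> {RV P >-> R})
    (tau : T -> 'I_n -> nat -> R) (sigma : T -> R -> schedule n)
    (r lam : T -> nat -> 'I_n -> R) (Q : T -> 'I_n -> R -> R)
    (network : congestion_controlled_network e U beta a0 T0 W S tau sigma r lam Q) :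
  exists lbar : 'I_n -> R,
    [/\ forall i, 0 <= lbar i <= 1,
        {ae P, forall w,
          (forall i, Q w i t / t @[t --> +oo] --> (0 : R)) /\
          (forall i, lam w j i @[j --> \oo] --> lbar i)}
      & forall lstar : 'I_n -> R, solves_utility_max e U lstar ->
          \sum_i U i (lbar i) >=
          \sum_i U i (lstar i) - ln (#|indep_sets e|%:R) / beta].
Proof.
case: network => W_exp S_exp indep _ path_ae control_ae queue_ae.
pose f i y := beta * U i y.
have f_concave i : strictly_concave01 (f i).
  move=> u v c u01 v01 uv c01; have := U_concave i u v c u01 v01 uv c01.
  rewrite -(ltr_pM2l beta_gt0); rewrite /f; congr (_ < _); ring.
have f_incr i : increasing01 (f i).
  by move=> u v u0 uv v1; rewrite ltr_pM2l //; exact: U_increasing.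
have [rs [rs_gt0 rs_argmax]] := dual_optimum e_irr f_concave f_incr.
exists (fun i => service e rs i); split.
- by move=> i; rewrite service_ge0 ltW // service_lt1.
- pose X (c : clock n) : {RV P >-> R} := if c.2 then S c.1.1 c.1.2 else W c.1.1 c.1.2.
  have X_exp c : exponential_rv 1 (X c) by rewrite /X; case: ifP.
  have X_indep (J : seq (clock n)) (B : clock n -> set R) : uniq J ->
      (forall b, measurable (B b)) ->
      P (\big[setI/setT]_(b <- J) (X b @^-1` B b)) = (\prod_(b <- J) P (X b @^-1` B b))%E.
    move=> uJ mB.
    (* Clocks are embedded among the primitive events through [inr]; the value [setT] on the initial
       schedule is a placeholder. *)
    pose code (c : clock n) : unit + ('I_n * nat + 'I_n * nat) :=
      inr (if c.2 then inr c.1 else inl c.1).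
    pose A (z : unit + ('I_n * nat + 'I_n * nat)) : set T :=
      match z with
      | inl _ => setT
      | inr (inl ik) => X (ik, false) @^-1` B (ik, false)
      | inr (inr ik) => X (ik, true) @^-1` B (ik, true)
      end.
    have AE c : A (code c) = X c @^-1` B c by case: c => ik [].
    have := indep [seq code c | c <- J] A.
    rewrite !big_map map_inj_uniq //; last by move=> [ik []] [ik' []] //= [->].
    under eq_bigr do rewrite AE; under [RHS]eq_bigr do rewrite AE.
    apply=> // z /mapP[[[i k] b] _ ->].
    case: b; [exists (B (i, k, true))|exists (B (i, k, false))] => //; exact: mB.
  have F_measurable := @measurable_control_law R n f a0 T0.
  (* The initial schedule is random, so the properties of the simulation are established almost
     surely for all its finitely many values at once, then used at [sigma w 0]. *)
  have extend_ae : {ae P, forall w, forall eta0 : schedule n,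
      (forall c, 0 < X c w) /\ forall h i l,
      ok e eta0 T0 (control_law f a0 T0) (fun c => X c w) h -> l != Some i ->
      wait e eta0 T0 (control_law f a0 T0) (fun c => X c w) h (Some i) !=
      wait e eta0 T0 (control_law f a0 T0) (fun c => X c w) h l}.
    apply: ae_countable => eta0.
    exact: (extendable_ae e eta0 T0 F_measurable X_indep X_exp).
  have dev_ae := deviation_ae e T0_gt0 F_measurable X_indep X_exp.
  have FP := ae_filter_ringOfSetsType P.
  have dynamics_ae := @filterI _ _ FP _ _ path_ae (@filterI _ _ FP _ _ control_ae queue_ae).
  apply: (@filterS3 _ _ FP _ _ _ _ _ dynamics_ae extend_ae dev_ae) => w [path [control queues]] /(_ (sigma w 0))[X_gt0 no_tie] /(_ (sigma w 0)) dev.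
  exact: (sample_path_cvg e_sym e_irr a0_gt0 T0_gt0 f_concave rs_gt0 rs_argmax
    (x := fun c => X c w) path control queues X_gt0 no_tie dev).
- move=> lstar [lstar_rate _].
  apply: (utility_gap beta_gt0 _ rs_argmax lstar_rate) => i; exact: ltW.
Qed.
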